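(* Let $p$ be a prime and let $\mathcal{O}$ be a complete local principal ideal domain of characteristic $0$ whose residue field $k$ is an algebraic closure of $\mathbb{F}_p$. Let $G$ be a finite group and $b$ a central idempotent of $\mathcal{O}G$. Set $B=\mathcal{O}Gb$. (i) Let $M$ be a $(B,B)$-bimodule inducing a Morita equivalence on $B$. There exists a $p$-adic subring $\mathcal{O}_0$ of $\mathcal{O}$ such that $b\in\mathcal{O}_0G$ and such that, setting $B_0=\mathcal{O}_0Gb$, we have $M\cong\mathcal{O}\otimes_{\mathcal{O}_0}M_0$ for some $(B_0,B_0)$-bimodule $M_0$ inducing a Morita equivalence on $B_0$. (ii) The group $\mathrm{Pic}(B)$ is the colimit of the finite groups $\mathrm{Pic}(\mathcal{O}_0Gb)$, with $\mathcal{O}_0$ running over the $p$-adic subrings of $\mathcal{O}$ such that $b\in\mathcal{O}_0G$. In particular, all elements in $\mathrm{Pic}(B)$ have finite order.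
   Context: For an algebra $B$, $\mathrm{Pic}(B)$ is the group of isomorphism classes of $(B,B)$-bimodules inducing a Morita equivalence, with product induced by $\otimes_B$. A $p$-adic subring of $\mathcal{O}$ is a finite extension of the ring of $p$-adic integers $\mathbb{Z}_p$ contained in $\mathcal{O}$, that is, the valuation ring of a finite extension of $\mathbb{Q}_p$ inside the field of fractions of $\mathcal{O}$. The $p$-adic subrings of $\mathcal{O}$ form a directed system under inclusion; for $\mathcal{O}_0\subseteq\mathcal{O}_1$ the map $\mathrm{Pic}(\mathcal{O}_0Gb)\to\mathrm{Pic}(\mathcal{O}_1Gb)$ is induced by $\mathcal{O}_1\otimes_{\mathcal{O}_0}-$, and the map $\mathrm{Pic}(\mathcal{O}_0Gb)\to\mathrm{Pic}(B)$ by $\mathcal{O}\otimes_{\mathcal{O}_0}-$. *)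

(* Defs.v *)
From HB Require Import structures.
From mathcomp Require Import all_boot all_order all_fingroup all_algebra.
From mathcomp Require Import boolp classical_sets.

Set Implicit Arguments.
Unset Strict Implicit.
Unset Printing Implicit Defensive.

Import GRing.Theory.
Local Open Scope ring_scope.
Local Open Scope quotient_scope.

Local Notation repr := generic_quotient.repr.

Definition additivef (U V : zmodType) (f : U -> V) : Prop :=
  forall x y, f (x + y) = f x + f y.

Lemma additivef0 (U V : zmodType) (f : U -> V) : additivef f -> f 0 = 0.
Proof. by move=> fD; apply: (addIr (f 0)); rewrite -fD !add0r. Qed.

Lemma additivef_sum (U V : zmodType) (f : U -> V) (I : Type) (s : seq I) F :
  additivef f -> f (\sum_(i <- s) F i) = \sum_(i <- s) f (F i).
Proof. by move=> fD; apply: (big_morph f fD (additivef0 fD)). Qed.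

Lemma additivef_comp (U V W : zmodType) (g : V -> W) (f : U -> V) :
  additivef g -> additivef f -> additivef (fun x => g (f x)).
Proof. by move=> gD fD x y; rewrite fD gD. Qed.

Section Tensor.

Variables (S : Type) (M U : zmodType) (r : M -> S -> M) (l : S -> U -> U).

Definition balanced (V : zmodType) (f : M -> U -> V) : Prop :=
  [/\ forall m m' u, f (m + m') u = f m u + f m' u,
      forall m u u', f m (u + u') = f m u + f m u' &
      forall m s u, f (r m s) u = f m (l s u)].

Definition formal_eval (V : zmodType) (f : M -> U -> V) (s : seq (M * U)) : V :=
  \sum_(x <- s) f x.1 x.2.

(* The tensor product is the set of formal sums of pairs, two of them being
   identified when no balanced map separates them; see [tlift_universal]. *)
Definition formal_eq (s t : seq (M * U)) : bool :=
  `[< forall (V : zmodType) (f : M -> U -> V),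
        balanced f -> formal_eval f s = formal_eval f t >].

Lemma formal_eq_refl : reflexive formal_eq.
Proof. by move=> s; apply/asboolP. Qed.

Lemma formal_eq_sym : symmetric formal_eq.
Proof.
move=> s t; apply/asboolP/asboolP => h V f bf; by rewrite h.
Qed.

Lemma formal_eq_trans : transitive formal_eq.
Proof.
move=> t s w /asboolP h /asboolP h'; apply/asboolP => V f bf.
by rewrite h // h'.
Qed.

Canonical formal_eq_equiv :=
  EquivRel formal_eq formal_eq_refl formal_eq_sym formal_eq_trans.

Definition tensor := {eq_quot formal_eq}.
HB.instance Definition _ := Choice.on tensor.
HB.instance Definition _ := EqQuotient.on tensor.

Definition tens (m : M) (u : U) : tensor := \pi_tensor [:: (m, u)].

Definition tlift (V : zmodType) (f : M -> U -> V) (x : tensor) : V :=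
  formal_eval f (repr x).

Lemma formal_evalP (V : zmodType) (f : M -> U -> V) s :
  balanced f -> tlift f (\pi_tensor s) = formal_eval f s.
Proof.
move=> bf; rewrite /tlift.
have /eqmodP /asboolP : repr (\pi_tensor s) = s %[mod tensor] by rewrite reprK.
exact.
Qed.

Lemma tensor_eqP (s t : seq (M * U)) :
  (forall (V : zmodType) (f : M -> U -> V),
     balanced f -> formal_eval f s = formal_eval f t) ->
  \pi_tensor s = \pi_tensor t.
Proof. by move=> h; apply/eqmodP/asboolP. Qed.

Definition tensor_add (x y : tensor) : tensor := \pi_tensor (repr x ++ repr y).
Definition tensor_opp (x : tensor) : tensor :=
  \pi_tensor [seq (- z.1, z.2) | z <- repr x].
Definition tensor_zero : tensor := \pi_tensor [::].

Lemma formal_eval_cat (V : zmodType) (f : M -> U -> V) s t :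
  formal_eval f (s ++ t) = formal_eval f s + formal_eval f t.
Proof. by rewrite /formal_eval big_cat. Qed.

Lemma formal_eval_repr (V : zmodType) (f : M -> U -> V) s :
  balanced f -> formal_eval f (repr (\pi_tensor s)) = formal_eval f s.
Proof. exact: formal_evalP. Qed.

Lemma formal_eval_opp (V : zmodType) (f : M -> U -> V) s : balanced f ->
  formal_eval f [seq (- z.1, z.2) | z <- s] = - formal_eval f s.
Proof.
case=> fD _ _; rewrite /formal_eval big_map /= -sumrN.
apply: eq_bigr => -[m u] _ /=.
have f0 : f 0 u = 0 by apply: (@additivef0 _ _ (f ^~ u)) => x y; apply: fD.
by apply: (addrI (f m u)); rewrite -fD !subrr.
Qed.

Lemma tensor_addA : associative tensor_add.
Proof.
move=> x y z; apply: tensor_eqP => V f bf.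
by rewrite !formal_eval_cat !formal_eval_repr // !formal_eval_cat addrA.
Qed.

Lemma tensor_addC : commutative tensor_add.
Proof.
by move=> x y; apply: tensor_eqP => V f bf; rewrite !formal_eval_cat addrC.
Qed.

Lemma tensor_add0 : left_id tensor_zero tensor_add.
Proof.
move=> x; rewrite -[RHS]reprK; apply: tensor_eqP => V f bf.
by rewrite formal_eval_cat formal_eval_repr // /formal_eval big_nil add0r.
Qed.

Lemma tensor_addN : left_inverse tensor_zero tensor_opp tensor_add.
Proof.
move=> x; apply: tensor_eqP => V f bf.
rewrite formal_eval_cat formal_eval_repr // formal_eval_opp // addNr.
by rewrite /formal_eval big_nil.
Qed.

HB.instance Definition _ :=
  GRing.isZmodule.Build tensor tensor_addA tensor_addC tensor_add0 tensor_addN.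

Lemma pi_tensor_cat s t :
  \pi_tensor (s ++ t) = \pi_tensor s + \pi_tensor t :> tensor.
Proof.
apply: tensor_eqP => V f bf.
by rewrite !formal_eval_cat !formal_eval_repr.
Qed.

Lemma tlift_additivef (V : zmodType) (f : M -> U -> V) :
  balanced f -> additivef (tlift f).
Proof.
move=> bf x y; rewrite -[x]reprK -[y]reprK -pi_tensor_cat.
by rewrite !formal_evalP // formal_eval_cat.
Qed.

Lemma tliftE (V : zmodType) (f : M -> U -> V) m u :
  balanced f -> tlift f (tens m u) = f m u.
Proof. by move=> bf; rewrite formal_evalP // /formal_eval big_seq1. Qed.

Lemma tensDl m m' u : tens (m + m') u = tens m u + tens m' u.
Proof.
rewrite /tens -pi_tensor_cat; apply: tensor_eqP => V f [fD _ _].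
by rewrite /formal_eval big_cat /= !big_seq1 fD.
Qed.

Lemma tensDr m u u' : tens m (u + u') = tens m u + tens m u'.
Proof.
rewrite /tens -pi_tensor_cat; apply: tensor_eqP => V f [_ fD _].
by rewrite /formal_eval big_cat /= !big_seq1 fD.
Qed.

Lemma tensA m s u : tens (r m s) u = tens m (l s u).
Proof.
by apply: tensor_eqP => V f [_ _ fA]; rewrite /formal_eval !big_seq1 fA.
Qed.

Lemma tens_ext (V : zmodType) (f g : tensor -> V) : additivef f -> additivef g ->
  (forall m u, f (tens m u) = g (tens m u)) -> f =1 g.
Proof.
move=> fD gD fg x; rewrite -[x]reprK; elim: (repr x) => [|[m u] s IHs].
  have -> : \pi_tensor [::] = 0 :> tensor by [].
  by rewrite (additivef0 fD) (additivef0 gD).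
by rewrite -cat1s pi_tensor_cat fD gD IHs fg.
Qed.

Lemma tlift_universal (V : zmodType) (f : M -> U -> V) : balanced f ->
  exists! h : tensor -> V, additivef h /\ forall m u, h (tens m u) = f m u.
Proof.
move=> bf; exists (tlift f); split.
  by split=> [|m u]; [apply: tlift_additivef | apply: tliftE].
move=> h [hD hE]; apply/funext; apply: tens_ext => // [|m u].
  exact: tlift_additivef.
by rewrite hE tliftE.
Qed.

End Tensor.

Lemma additivef_tensl (S : Type) (M U : zmodType) r l u :
  additivef (fun m => @tens S M U r l m u).
Proof. by move=> x y; apply: tensDl. Qed.

Lemma additivef_tensr (S : Type) (M U : zmodType) r l m :
  additivef (fun u => @tens S M U r l m u).
Proof. by move=> x y; apply: tensDr. Qed.

(* MathComp's [algType] excludes the zero algebra, which [corner] below can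
   be. *)
Record ualg (R : comPzRingType) := Ualg {
  ualg_ring :> pzRingType;
  ualg_str : {rmorphism R -> ualg_ring};
  ualg_central : forall c x, ualg_str c * x = x * ualg_str c
}.

(* Bimodules over R-algebras are R-central: both actions of R coincide. *)
Record bimod (R : comPzRingType) (A B : ualg R) := Bimod {
  bm_sort :> lmodType A;
  bm_ract : bm_sort -> B -> bm_sort;
  ract1 : forall m, bm_ract m 1 = m;
  ractM : forall m x y, bm_ract m (x * y) = bm_ract (bm_ract m x) y;
  ractDl : forall m n x, bm_ract (m + n) x = bm_ract m x + bm_ract n x;
  ractDr : forall m x y, bm_ract m (x + y) = bm_ract m x + bm_ract m y;
  ractZ : forall (a : A) m x, bm_ract (a *: m) x = a *: bm_ract m x;
  bm_central : forall (c : R) m, ualg_str A c *: m = bm_ract m (ualg_str B c)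
}.

Definition bimod_iso (R : comPzRingType) (A B : ualg R) (M N : bimod A B) :=
  exists f : {linear M -> N},
    bijective f /\ forall m x, f (bm_ract m x) = bm_ract (f m) x.

Definition lmod_iso (A : pzRingType) (U V : lmodType A) : Prop :=
  exists f : {linear U -> V}, bijective f.

Section LinOf.
Variables (A : pzRingType) (U V : lmodType A) (f : U -> V).
Hypotheses (fD : additivef f) (fZ : forall a x, f (a *: x) = a *: f x).

Lemma lin_of_subproof : linear f.
Proof. by move=> a u v; rewrite fD fZ. Qed.

Definition lin_fun (fD : additivef f) (fZ : forall a x, f (a *: x) = a *: f x) := f.
HB.instance Definition _ :=
  GRing.isLinear.Build A U V *:%R (lin_fun fD fZ) lin_of_subproof.

Definition lin_of : {linear U -> V} := lin_fun fD fZ.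

Lemma lin_ofE : lin_of =1 f. Proof. by []. Qed.
End LinOf.

Lemma lin_additivef (A : pzRingType) (U V : lmodType A) (f : {linear U -> V}) :
  additivef f.
Proof. exact: linearD. Qed.

Section ModTensor.
Variables (R : comPzRingType) (A B : ualg R) (M : bimod A B) (U : lmodType B).

Definition bm_tensor : Type :=
  tensor (@bm_ract R A B M) (fun (b : B) (u : U) => b *: u).
HB.instance Definition _ := GRing.Zmodule.on bm_tensor.

Definition bmt (m : M) (u : U) : bm_tensor := tens _ _ m u.

Lemma bmtDl m m' u : bmt (m + m') u = bmt m u + bmt m' u.
Proof. exact: tensDl. Qed.
Lemma bmtDr m u u' : bmt m (u + u') = bmt m u + bmt m u'.
Proof. exact: tensDr. Qed.
Lemma bmtA m b u : bmt (bm_ract m b) u = bmt m (b *: u).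
Proof. exact: tensA. Qed.

Lemma bmt_ext (V : zmodType) (f g : bm_tensor -> V) : additivef f -> additivef g ->
  (forall m u, f (bmt m u) = g (bmt m u)) -> f =1 g.
Proof. exact: tens_ext. Qed.

Definition bmt_scale (a : A) : bm_tensor -> bm_tensor :=
  tlift (fun m u => bmt (a *: m) u).

Lemma bmt_scale_balanced (a : A) :
  balanced (@bm_ract R A B M) (fun (b : B) (u : U) => b *: u)
    (fun m u => bmt (a *: m) u).
Proof.
split=> [m m' u|m u u'|m b u].
- by rewrite scalerDr bmtDl.
- exact: bmtDr.
- by rewrite -ractZ bmtA.
Qed.

Lemma bmt_scaleD a : additivef (bmt_scale a).
Proof. exact/tlift_additivef/bmt_scale_balanced. Qed.

Lemma bmt_scaleE a m u : bmt_scale a (bmt m u) = bmt (a *: m) u.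
Proof. exact/tliftE/bmt_scale_balanced. Qed.

Lemma bmt_scaleA a b x : bmt_scale a (bmt_scale b x) = bmt_scale (a * b) x.
Proof.
apply: (bmt_ext (f := fun x => bmt_scale a (bmt_scale b x))) => [|| m u].
- exact: additivef_comp (bmt_scaleD a) (bmt_scaleD b).
- exact: bmt_scaleD.
- by rewrite !bmt_scaleE scalerA.
Qed.

Lemma bmt_scale1 : left_id 1 bmt_scale.
Proof.
apply: bmt_ext => // [|m u]; first exact: bmt_scaleD.
by rewrite bmt_scaleE scale1r.
Qed.

Lemma bmt_scaleDl x : {morph bmt_scale^~ x : a b / a + b}.
Proof.
move=> a b; apply: (bmt_ext (g := fun x => bmt_scale a x + bmt_scale b x)).
- exact: bmt_scaleD.
- by move=> y z; rewrite !bmt_scaleD addrACA.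
- by move=> m u; rewrite !bmt_scaleE scalerDl bmtDl.
Qed.

HB.instance Definition _ := GRing.Zmodule_isLmodule.Build A bm_tensor
  bmt_scaleA bmt_scale1 bmt_scaleD bmt_scaleDl.

Lemma bmtZ (a : A) m u : a *: bmt m u = bmt (a *: m) u.
Proof. exact: bmt_scaleE. Qed.

(* Balanced maps out of M and U, as used to define maps on M ⊗_B U. *)
Definition bm_balanced (V : zmodType) (f : M -> U -> V) : Prop :=
  [/\ forall m m' u, f (m + m') u = f m u + f m' u,
      forall m u u', f m (u + u') = f m u + f m u' &
      forall m b u, f (bm_ract m b) u = f m (b *: u)].

Definition bm_lift (V : zmodType) (f : M -> U -> V) : bm_tensor -> V := tlift f.

Lemma bm_lift_additivef (V : zmodType) (f : M -> U -> V) :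
  bm_balanced f -> additivef (bm_lift f).
Proof. exact: tlift_additivef. Qed.

Lemma bm_liftE (V : zmodType) (f : M -> U -> V) m u :
  bm_balanced f -> bm_lift f (bmt m u) = f m u.
Proof. exact: tliftE. Qed.

Lemma additivef_bmtl u : additivef (bmt^~ u).
Proof. by move=> x y; apply: bmtDl. Qed.
Lemma additivef_bmtr m : additivef (bmt m).
Proof. by move=> x y; apply: bmtDr. Qed.
End ModTensor.

Arguments bmt {R A B M U} m u.

Section TensorMap.
Variables (R : comPzRingType) (A B : ualg R) (M : bimod A B).
Variables (U V : lmodType B) (g : {linear U -> V}).

Definition tmap_fun : bm_tensor M U -> bm_tensor M V :=
  bm_lift (fun m u => bmt m (g u)).

Lemma tmap_balanced : bm_balanced (fun (m : M) u => bmt m (g u)).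
Proof.
split=> [m m' u|m u u'|m b u].
- exact: bmtDl.
- by rewrite linearD bmtDr.
- by rewrite linearZ bmtA.
Qed.

Lemma tmap_additivef : additivef tmap_fun.
Proof. exact/bm_lift_additivef/tmap_balanced. Qed.

Lemma tmap_funE m u : tmap_fun (bmt m u) = bmt m (g u).
Proof. exact/bm_liftE/tmap_balanced. Qed.

Lemma tmapZ a x : tmap_fun (a *: x) = a *: tmap_fun x.
Proof.
apply: (bmt_ext (f := fun x => tmap_fun (a *: x))
  (g := fun x => a *: tmap_fun x)) => [|| m u].
- by move=> y z; rewrite scalerDr tmap_additivef.
- by move=> y z; rewrite tmap_additivef scalerDr.
- by rewrite bmtZ !tmap_funE bmtZ.
Qed.

Definition tmap : {linear bm_tensor M U -> bm_tensor M V} :=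
  lin_of tmap_additivef tmapZ.

Lemma tmapE m u : tmap (bmt m u) = bmt m (g u).
Proof. exact: tmap_funE. Qed.
End TensorMap.

Arguments tmap {R A B} M {U V} g.

(* M ⊗_B - : Mod(B) -> Mod(A) is faithful, full and essentially surjective. *)
Definition morita (R : comPzRingType) (A B : ualg R) (M : bimod A B) : Prop :=
  [/\ forall (U V : lmodType B) (f g : {linear U -> V}),
        tmap M f =1 tmap M g -> f =1 g,
      forall (U V : lmodType B) (h : {linear bm_tensor M U -> bm_tensor M V}),
        exists f : {linear U -> V}, tmap M f =1 h &
      forall V : lmodType A, exists U : lmodType B, lmod_iso (bm_tensor M U) V].

Section TmapTheory.
Variables (R : comPzRingType) (A B : ualg R).
Implicit Types (M N : bimod A B) (U V W : lmodType B).

Lemma tmap_comp M U V W (g : {linear V -> W}) (f : {linear U -> V})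
    (h : {linear U -> W}) : h =1 g \o f ->
  tmap M h =1 tmap M g \o tmap M f.
Proof.
move=> hE; apply: bmt_ext => [||m u /=]; first exact: lin_additivef.
  exact: additivef_comp (lin_additivef _) (lin_additivef _).
by rewrite !tmapE hE.
Qed.

Lemma tmap_id M U (f : {linear U -> U}) : f =1 id -> tmap M f =1 id.
Proof.
move=> fE; apply: bmt_ext => [||m u] //; first exact: lin_additivef.
by rewrite tmapE fE.
Qed.

Lemma eq_tmap M U V (f g : {linear U -> V}) : f =1 g -> tmap M f =1 tmap M g.
Proof.
move=> fg; apply: bmt_ext => [||m u]; try exact: lin_additivef.
by rewrite !tmapE fg.
Qed.

Lemma tmap_cancel M U V (f : {linear U -> V}) (g : {linear V -> U}) :
  cancel f g -> cancel (tmap M f) (tmap M g).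
Proof.
move=> fK; apply: (bmt_ext (f := fun x => tmap M g (tmap M f x))) => [||m u] //.
  exact: additivef_comp (lin_additivef _) (lin_additivef _).
by rewrite !tmapE fK.
Qed.
End TmapTheory.

Section LinInv.
Variables (A : pzRingType) (U V : lmodType A) (f : {linear U -> V}) (g : V -> U).
Hypotheses (fK : cancel f g) (gK : cancel g f).
Lemma inv_additivef : additivef g.
Proof. by move=> x y; rewrite -{1}[x]gK -{1}[y]gK -linearD fK. Qed.
Lemma inv_lin a x : g (a *: x) = a *: g x.
Proof. by rewrite -{1}[x]gK -linearZ fK. Qed.
Definition lin_inv : {linear V -> U} := lin_of inv_additivef inv_lin.
End LinInv.

Lemma lin_bij (A : pzRingType) (U V : lmodType A) (f : {linear U -> V}) :
  bijective f -> exists g : {linear V -> U}, cancel f g /\ cancel g f.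
Proof. by case=> g fK gK; exists (lin_inv fK gK). Qed.

Section BimodTensor.
Variables (R : comPzRingType) (A B C : ualg R) (M : bimod A B) (N : bimod B C).

Definition bmt_ract (x : bm_tensor M N) (c : C) : bm_tensor M N :=
  bm_lift (fun m n => bmt m (bm_ract n c)) x.

Lemma bmt_ract_balanced c : bm_balanced (fun (m : M) (n : N) => bmt m (bm_ract n c)).
Proof.
split=> [m m' u|m u u'|m b u].
- exact: bmtDl.
- by rewrite ractDl bmtDr.
- by rewrite ractZ bmtA.
Qed.

Lemma bmt_ractD c : additivef (bmt_ract^~ c).
Proof. exact/bm_lift_additivef/bmt_ract_balanced. Qed.

Lemma bmt_ractE m n c : bmt_ract (bmt m n) c = bmt m (bm_ract n c).
Proof. exact/bm_liftE/bmt_ract_balanced. Qed.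

Lemma bmt_ract1 x : bmt_ract x 1 = x.
Proof.
apply: (bmt_ext (f := bmt_ract^~ 1)) => [||m n] //; first exact: bmt_ractD.
by rewrite bmt_ractE ract1.
Qed.

Lemma bmt_ractM x c d : bmt_ract x (c * d) = bmt_ract (bmt_ract x c) d.
Proof.
apply: (bmt_ext (f := bmt_ract^~ (c * d))
  (g := fun x => bmt_ract (bmt_ract x c) d)) => [||m n].
- exact: bmt_ractD.
- exact: (additivef_comp (bmt_ractD d) (bmt_ractD c)).
- by rewrite !bmt_ractE ractM.
Qed.

Lemma bmt_ractDr x c d : bmt_ract x (c + d) = bmt_ract x c + bmt_ract x d.
Proof.
apply: (bmt_ext (f := bmt_ract^~ (c + d))
  (g := fun x => bmt_ract x c + bmt_ract x d)) => [||m n].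
- exact: bmt_ractD.
- by move=> y z; rewrite !bmt_ractD addrACA.
- by rewrite !bmt_ractE ractDr bmtDr.
Qed.

Lemma bmt_ractZ (a : A) x c : bmt_ract (a *: x) c = a *: bmt_ract x c.
Proof.
apply: (bmt_ext (f := fun x => bmt_ract (a *: x) c)
  (g := fun x => a *: bmt_ract x c)) => [||m n].
- by move=> y z; rewrite scalerDr bmt_ractD.
- by move=> y z; rewrite bmt_ractD scalerDr.
- by rewrite bmtZ !bmt_ractE bmtZ.
Qed.

Lemma bmt_central (r : R) x : ualg_str A r *: x = bmt_ract x (ualg_str C r).
Proof.
apply: (bmt_ext (f := fun x => ualg_str A r *: x)
  (g := bmt_ract^~ (ualg_str C r))) => [||m n].
- by move=> y z; rewrite scalerDr.
- exact: bmt_ractD.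
- by rewrite bmtZ bmt_ractE bm_central bmtA bm_central.
Qed.

Definition bimod_tensor : bimod A C :=
  @Bimod R A C (bm_tensor M N) bmt_ract bmt_ract1 bmt_ractM
    (fun x y c => bmt_ractD c x y) bmt_ractDr bmt_ractZ bmt_central.
End BimodTensor.

Section Regular.
Variables (R : comPzRingType) (A : ualg R).

Lemma regular_central (c : R) (m : A^o) :
  ualg_str A c *: m = (m : A) * ualg_str A c.
Proof. exact: ualg_central. Qed.

Definition bimod_regular : bimod A A :=
  @Bimod R A A A^o (fun m x => m * x) (@mulr1 A)
    (fun m x y => @mulrA A m x y) (fun m n x => @mulrDl A m n x)
    (fun m x y => @mulrDr A m x y)
    (fun a m x => esym (@mulrA A a m x)) regular_central.
End Regular.

Section Assoc.
Variables (R : comPzRingType) (A B C : ualg R) (M : bimod A B) (N : bimod B C).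
Variable U : lmodType C.

Local Notation MN := (bimod_tensor M N).
Local Notation NU := (bm_tensor N U).

Definition asc_in (m : M) : NU -> bm_tensor MN U :=
  bm_lift (fun n u => bmt (bmt m n : MN) u).

Lemma asc_in_balanced m :
  bm_balanced (fun (n : N) u => bmt (bmt m n : MN) u : bm_tensor MN U).
Proof.
split=> [n n' u|n u u'|n c u].
- by rewrite bmtDr bmtDl.
- by rewrite bmtDr.
- by rewrite -bmtA /= bmt_ractE.
Qed.

Lemma asc_inD m : additivef (asc_in m).
Proof. exact/bm_lift_additivef/asc_in_balanced. Qed.

Lemma asc_inE m n u : asc_in m (bmt n u) = bmt (bmt m n : MN) u.
Proof. exact/bm_liftE/asc_in_balanced. Qed.

Definition asc_fun : bm_tensor M NU -> bm_tensor MN U := bm_lift asc_in.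

Lemma asc_balanced : bm_balanced asc_in.
Proof.
split=> [m m' y|m y y'|m b y].
- apply: (bmt_ext (f := asc_in (m + m')) (g := fun y => asc_in m y + asc_in m' y)).
  + exact: asc_inD.
  + by move=> z t; rewrite !asc_inD addrACA.
  + by move=> n u; rewrite !asc_inE bmtDl bmtDl.
- exact: asc_inD.
- apply: (bmt_ext (f := asc_in (bm_ract m b)) (g := fun y => asc_in m (b *: y))).
  + exact: asc_inD.
  + by move=> z t; rewrite scalerDr asc_inD.
  + by move=> n u; rewrite bmtZ !asc_inE bmtA.
Qed.

Lemma asc_funD : additivef asc_fun.
Proof. exact/bm_lift_additivef/asc_balanced. Qed.

Lemma asc_funE m n u : asc_fun (bmt m (bmt n u)) = bmt (bmt m n : MN) u.
Proof. by rewrite /asc_fun bm_liftE ?asc_inE //; apply: asc_balanced. Qed.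

Lemma asc_ext (V : zmodType) (f g : bm_tensor M NU -> V) :
  additivef f -> additivef g ->
  (forall m n u, f (bmt m (bmt n u)) = g (bmt m (bmt n u))) -> f =1 g.
Proof.
move=> fD gD fg; apply: bmt_ext => // m y.
apply: (bmt_ext (f := fun y => f (bmt m y)) (g := fun y => g (bmt m y))) => //.
- exact: (additivef_comp fD (@additivef_bmtr _ _ _ _ _ _)).
- exact: (additivef_comp gD (@additivef_bmtr _ _ _ _ _ _)).
Qed.

Lemma asc_ext' (V : zmodType) (f g : bm_tensor MN U -> V) :
  additivef f -> additivef g ->
  (forall m n u, f (bmt (bmt m n : MN) u) = g (bmt (bmt m n : MN) u)) -> f =1 g.
Proof.
move=> fD gD fg; apply: bmt_ext => // y u.
apply: (bmt_ext (f := fun y => f (bmt (y : MN) u))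
  (g := fun y => g (bmt (y : MN) u))) => //.
- exact: (additivef_comp fD (@additivef_bmtl _ _ _ MN _ _)).
- exact: (additivef_comp gD (@additivef_bmtl _ _ _ MN _ _)).
Qed.

Lemma asc_funZ a x : asc_fun (a *: x) = a *: asc_fun x.
Proof.
apply: (asc_ext (f := fun x => asc_fun (a *: x)) (g := fun x => a *: asc_fun x)).
- by move=> y z; rewrite scalerDr asc_funD.
- by move=> y z; rewrite asc_funD scalerDr.
- by move=> m n u; rewrite bmtZ !asc_funE bmtZ bmtZ.
Qed.

Definition asc : {linear bm_tensor M NU -> bm_tensor MN U} :=
  lin_of asc_funD asc_funZ.

Lemma ascE m n u : asc (bmt m (bmt n u)) = bmt (bmt m n : MN) u.
Proof. exact: asc_funE. Qed.

Definition csa_in (u : U) : MN -> bm_tensor M NU :=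
  bm_lift (fun m n => bmt m (bmt n u)).

Lemma csa_in_balanced u :
  bm_balanced (fun (m : M) (n : N) => bmt m (bmt n u : NU)).
Proof.
split=> [n n' v|n v u'|m b n].
- exact: bmtDl.
- by rewrite bmtDl bmtDr.
- by rewrite bmtA bmtZ.
Qed.

Lemma csa_inD u : additivef (csa_in u).
Proof. exact/bm_lift_additivef/csa_in_balanced. Qed.

Lemma csa_inE m n u : csa_in u (bmt m n) = bmt m (bmt n u).
Proof. exact/bm_liftE/csa_in_balanced. Qed.

Lemma csa_balanced : bm_balanced (fun y u => csa_in u y).
Proof.
split=> [y y' u|y u u'|y c u].
- exact: csa_inD.
- apply: (bmt_ext (f := csa_in (u + u')) (g := fun y => csa_in u y + csa_in u' y)).
  + exact: csa_inD.
  + by move=> z t; rewrite !csa_inD addrACA.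
  + by move=> m n; rewrite !csa_inE !bmtDr.
- apply: (bmt_ext (f := fun y => csa_in u (bm_ract (y : MN) c)) (g := csa_in (c *: u))).
  + by move=> z t; rewrite ractDl csa_inD.
  + exact: csa_inD.
  + by move=> m n; rewrite /= bmt_ractE !csa_inE bmtA.
Qed.

Definition csa : bm_tensor MN U -> bm_tensor M NU :=
  bm_lift (fun y u => csa_in u y).

Lemma csaD : additivef csa.
Proof. exact/bm_lift_additivef/csa_balanced. Qed.

Lemma csaE m n u : csa (bmt (bmt m n : MN) u) = bmt m (bmt n u).
Proof. by rewrite /csa bm_liftE ?csa_inE //; apply: csa_balanced. Qed.

Lemma ascK : cancel asc csa.
Proof.
apply: (asc_ext (f := fun x => csa (asc x))) => // [|m n u].
  exact: additivef_comp csaD (lin_additivef _).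
by rewrite ascE csaE.
Qed.

Lemma csaK : cancel csa asc.
Proof.
apply: (asc_ext' (f := fun x => asc (csa x))) => // [|m n u].
  exact: additivef_comp (lin_additivef _) csaD.
by rewrite csaE ascE.
Qed.

Lemma asc_bij : bijective asc.
Proof. by exists csa; [apply: ascK | apply: csaK]. Qed.
End Assoc.

Lemma asc_nat (R : comPzRingType) (A B C : ualg R) (M : bimod A B)
    (N : bimod B C) (U V : lmodType C) (f : {linear U -> V}) :
  asc M N V \o tmap M (tmap N f) =1 tmap (bimod_tensor M N) f \o asc M N U.
Proof.
apply: asc_ext => [||m n u /=]; try exact: additivef_comp (lin_additivef _) (lin_additivef _).
by rewrite tmapE tmapE !ascE tmapE.
Qed.

Section TensorMapLeft.
Variables (R : comPzRingType) (A B : ualg R) (M N : bimod A B) (U : lmodType B).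
Variables (f : {linear M -> N}).
Hypothesis fr : forall m x, f (bm_ract m x) = bm_ract (f m) x.

Lemma tmapl_balanced : bm_balanced (fun (m : M) (u : U) => bmt (f m : N) u).
Proof.
split=> [m m' u|m u u'|m b u].
- by rewrite linearD bmtDl.
- exact: bmtDr.
- by rewrite fr bmtA.
Qed.

Definition tmapl_fun : bm_tensor M U -> bm_tensor N U :=
  bm_lift (fun (m : M) u => bmt (f m : N) u).

Lemma tmapl_funD : additivef tmapl_fun.
Proof. exact/bm_lift_additivef/tmapl_balanced. Qed.

Lemma tmapl_funE m u : tmapl_fun (bmt m u) = bmt (f m : N) u.
Proof. exact/bm_liftE/tmapl_balanced. Qed.

Lemma tmapl_funZ a x : tmapl_fun (a *: x) = a *: tmapl_fun x.
Proof.
apply: (bmt_ext (f := fun x => tmapl_fun (a *: x))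
  (g := fun x => a *: tmapl_fun x)) => [||m u].
- by move=> y z; rewrite scalerDr tmapl_funD.
- by move=> y z; rewrite tmapl_funD scalerDr.
- by rewrite bmtZ !tmapl_funE bmtZ linearZ.
Qed.

Definition tmapl : {linear bm_tensor M U -> bm_tensor N U} :=
  lin_of tmapl_funD tmapl_funZ.

Lemma tmaplE m u : tmapl (bmt m u) = bmt (f m : N) u.
Proof. exact: tmapl_funE. Qed.
End TensorMapLeft.

Arguments tmapl {R A B M N} U {f} fr.

Section BimodIso.
Variable R : comPzRingType.

Lemma bimod_iso_refl (A B : ualg R) (M : bimod A B) : bimod_iso M M.
Proof.
exists (lin_of (f := @id M) (fun x y => erefl) (fun a x => erefl)).
by split=> //; exists id.
Qed.

Lemma bimod_iso_sym (A B : ualg R) (M N : bimod A B) :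
  bimod_iso M N -> bimod_iso N M.
Proof.
case=> f [/lin_bij[g [fK gK]] fr]; exists g; split; first by exists f.
by move=> m x; rewrite -{1}[m]gK -fr fK.
Qed.

Lemma bimod_iso_trans (A B : ualg R) (M N L : bimod A B) :
  bimod_iso M N -> bimod_iso N L -> bimod_iso M L.
Proof.
case=> f [fb fr] [g [gb gr]].
have hD : additivef (g \o f) by exact: additivef_comp (lin_additivef g) (lin_additivef f).
have hZ a x : (g \o f) (a *: x) = a *: (g \o f) x by rewrite /= !linearZ.
exists (lin_of hD hZ); split; last by move=> m x; rewrite !lin_ofE /= fr gr.
exact: bij_comp gb fb.
Qed.

Lemma bimod_tensor_iso (A B C : ualg R) (M M' : bimod A B) (N N' : bimod B C) :
  bimod_iso M M' -> bimod_iso N N' ->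
  bimod_iso (bimod_tensor M N) (bimod_tensor M' N').
Proof.
move=> [f [/lin_bij[f' [fK fK']] fr]] [g [/lin_bij[g' [gK gK']] gr]].
have f'r m x : f' (bm_ract m x) = bm_ract (f' m) x by rewrite -{1}[m]fK' -fr fK.
have g'r m x : g' (bm_ract m x) = bm_ract (g' m) x by rewrite -{1}[m]gK' -gr gK.
apply: (@bimod_iso_trans _ _ _ (bimod_tensor M N')).
  exists (tmap M g); split.
    by exists (tmap M g'); apply: tmap_cancel.
  move=> x c; apply: (bmt_ext (f := fun x => tmap M g (bmt_ract x c))
    (g := fun x => bmt_ract (tmap M g x) c)) => [||m u].
  - exact: (additivef_comp (lin_additivef _) (@bmt_ractD _ _ _ _ _ _ _)).
  - exact: (additivef_comp (@bmt_ractD _ _ _ _ _ _ _) (lin_additivef _)).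
  - by rewrite tmapE !bmt_ractE tmapE gr.
exists (tmapl N' fr); split.
  exists (tmapl N' f'r).
    apply: (bmt_ext (f := fun x => tmapl N' f'r (tmapl N' fr x))) => [||m u] //.
      exact: additivef_comp (lin_additivef _) (lin_additivef _).
    by rewrite !tmaplE fK.
  apply: (bmt_ext (f := fun x => tmapl N' fr (tmapl N' f'r x))) => [||m u] //.
    exact: additivef_comp (lin_additivef _) (lin_additivef _).
  by rewrite !tmaplE fK'.
move=> x c; apply: (bmt_ext (f := fun x => tmapl N' fr (bmt_ract x c))
  (g := fun x => bmt_ract (tmapl N' fr x) c)) => [||m u].
- exact: (additivef_comp (lin_additivef _) (@bmt_ractD _ _ _ _ _ _ _)).
- exact: (additivef_comp (@bmt_ractD _ _ _ _ _ _ _) (lin_additivef _)).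
- by rewrite tmaplE !bmt_ractE tmaplE.
Qed.

Lemma bimod_tensorA (A B C D : ualg R) (M : bimod A B) (N : bimod B C)
    (L : bimod C D) :
  bimod_iso (bimod_tensor M (bimod_tensor N L))
            (bimod_tensor (bimod_tensor M N) L).
Proof.
exists (asc M N L); split; first exact: asc_bij.
move=> x d.
apply: (asc_ext (f := fun x => asc M N L (bmt_ract (N := bimod_tensor N L) x d))
  (g := fun x => bmt_ract (M := bimod_tensor M N) (asc M N L x) d)) => [||m n u].
- by move=> y z; rewrite bmt_ractD linearD.
- by move=> y z; rewrite linearD bmt_ractD.
- by rewrite bmt_ractE /= bmt_ractE !ascE bmt_ractE.
Qed.

Section Units.
Variables (A B : ualg R).

Lemma lunit_balanced (U : lmodType A) :
  bm_balanced (fun (a : bimod_regular A) (u : U) => (a : A) *: u).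
Proof.
split=> [m m' u|m u u'|m b u].
- exact: scalerDl.
- exact: scalerDr.
- by rewrite scalerA.
Qed.

Definition lunit_fun (U : lmodType A) : bm_tensor (bimod_regular A) U -> U :=
  bm_lift (fun (a : bimod_regular A) u => (a : A) *: u).

Lemma lunit_funD U : additivef (@lunit_fun U).
Proof. exact/bm_lift_additivef/lunit_balanced. Qed.

Lemma lunit_funE (U : lmodType A) (a : A) (u : U) :
  lunit_fun (bmt (a : bimod_regular A) u) = a *: u.
Proof. exact/bm_liftE/lunit_balanced. Qed.

Lemma lunit_funZ U a x : @lunit_fun U (a *: x) = a *: lunit_fun x.
Proof.
apply: (bmt_ext (f := fun x => lunit_fun (a *: x))
  (g := fun x => a *: lunit_fun x)) => [||m u].
- by move=> y z; rewrite scalerDr lunit_funD.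
- by move=> y z; rewrite lunit_funD scalerDr.
- by rewrite bmtZ !lunit_funE scalerA.
Qed.

Definition lunit (U : lmodType A) : {linear bm_tensor (bimod_regular A) U -> U} :=
  lin_of (@lunit_funD U) (@lunit_funZ U).

Lemma lunitE (U : lmodType A) (a : A) (u : U) :
  lunit U (bmt (a : bimod_regular A) u) = a *: u.
Proof. exact: lunit_funE. Qed.

Lemma lunit_bij U : bijective (lunit U).
Proof.
exists (fun u => bmt (1 : bimod_regular A) u) => [|u]; last first.
  by rewrite lunitE scale1r.
apply: (bmt_ext (f := fun x => bmt (1 : bimod_regular A) (lunit U x))) => //.
  exact: additivef_comp (@additivef_bmtr _ _ _ _ _ _) (lin_additivef _).
by move=> a u; rewrite lunitE -bmtA /= mul1r.
Qed.

Lemma lunit_nat (U V : lmodType A) (f : {linear U -> V}) :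
  f \o lunit U =1 lunit V \o tmap _ f.
Proof.
apply: bmt_ext => [||m u /=]; try exact: additivef_comp (lin_additivef _) (lin_additivef _).
by rewrite tmapE !lunitE linearZ.
Qed.

Lemma bimod_tensor1l (M : bimod A B) :
  bimod_iso (bimod_tensor (bimod_regular A) M) M.
Proof.
exists (lunit M); split=> [|x b]; first exact: lunit_bij.
apply: (bmt_ext (f := fun x => lunit M (bmt_ract x b))
  (g := fun x => bm_ract (lunit M x) b)) => [||m u].
- exact: (additivef_comp (lin_additivef _) (@bmt_ractD _ _ _ _ _ _ _)).
- by move=> y z; rewrite linearD ractDl.
- by rewrite bmt_ractE !lunitE ractZ.
Qed.

Variable M : bimod A B.

Lemma runit_balanced :
  bm_balanced (fun (m : M) (b : bimod_regular B) => bm_ract m (b : B)).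
Proof.
split=> [m m' u|m u u'|m b u].
- exact: ractDl.
- exact: ractDr.
- by rewrite -ractM.
Qed.

Definition runit_fun : bm_tensor M (bimod_regular B) -> M :=
  bm_lift (fun m (b : bimod_regular B) => bm_ract m (b : B)).

Lemma runit_funD : additivef runit_fun.
Proof. exact/bm_lift_additivef/runit_balanced. Qed.

Lemma runit_funE m (b : B) : runit_fun (bmt m (b : bimod_regular B)) = bm_ract m b.
Proof. exact/bm_liftE/runit_balanced. Qed.

Lemma runit_funZ a x : runit_fun (a *: x) = a *: runit_fun x.
Proof.
apply: (bmt_ext (f := fun x => runit_fun (a *: x))
  (g := fun x => a *: runit_fun x)) => [||m u].
- by move=> y z; rewrite scalerDr runit_funD.
- by move=> y z; rewrite runit_funD scalerDr.
- by rewrite bmtZ !runit_funE ractZ.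
Qed.

Definition runit : {linear bm_tensor M (bimod_regular B) -> M} :=
  lin_of runit_funD runit_funZ.

Lemma runitE m (b : B) : runit (bmt m (b : bimod_regular B)) = bm_ract m b.
Proof. exact: runit_funE. Qed.

Lemma bimod_tensor1r : bimod_iso (bimod_tensor M (bimod_regular B)) M.
Proof.
exists runit; split=> [|x b].
  exists (fun m => bmt m (1 : bimod_regular B)) => [|m]; last first.
    by rewrite runitE ract1.
  apply: (bmt_ext (f := fun x => bmt (runit x) (1 : bimod_regular B))) => //.
    exact: additivef_comp (@additivef_bmtl _ _ _ _ _ _) (lin_additivef _).
  move=> m b; rewrite runitE bmtA; congr bmt; exact: mulr1.
apply: (bmt_ext (f := fun x => runit (bmt_ract x b))
  (g := fun x => bm_ract (runit x) b)) => [||m u].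
- exact: (additivef_comp (lin_additivef _) (@bmt_ractD _ _ _ _ _ _ _)).
- by move=> y z; rewrite linearD ractDl.
- by rewrite bmt_ractE !runitE /= ractM.
Qed.
End Units.
End BimodIso.

Definition bimod_inverse (R : comPzRingType) (A B : ualg R) (M : bimod A B)
    (N : bimod B A) : Prop :=
  bimod_iso (bimod_tensor M N) (bimod_regular A) /\
  bimod_iso (bimod_tensor N M) (bimod_regular B).

Section MoritaInverse.
Variables (R : comPzRingType).

Lemma lmod_iso_trans (A : pzRingType) (U V W : lmodType A) :
  lmod_iso U V -> lmod_iso V W -> lmod_iso U W.
Proof.
case=> f fb [g gb].
have hD : additivef (g \o f) by exact: additivef_comp (lin_additivef g) (lin_additivef f).
have hZ a x : (g \o f) (a *: x) = a *: (g \o f) x by rewrite /= !linearZ.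
by exists (lin_of hD hZ); apply: (bij_comp gb fb).
Qed.

(* N ⊗ (M ⊗ U) ≅ U, naturally in U. *)
Lemma inverse_nat (A B : ualg R) (M : bimod A B) (N : bimod B A) :
  bimod_iso (bimod_tensor N M) (bimod_regular B) ->
  exists th : forall U : lmodType B, {linear bm_tensor N (bm_tensor M U) -> U},
    (forall U, bijective (th U)) /\
    forall (U V : lmodType B) (f : {linear U -> V}), f \o th U =1 th V \o tmap N (tmap M f).
Proof.
case=> g [gbij gr].
have [g' [gK g'K]] := lin_bij gbij.
have g'r m x : g' (bm_ract m x) = bm_ract (g' m) x by rewrite -{1}[m]g'K -gr gK.
pose F (U : lmodType B) := lunit U \o tmapl U gr \o asc N M U.
have FD U : additivef (F U).
  exact: (additivef_comp (additivef_comp (lin_additivef (lunit U)) (lin_additivef (tmapl U gr)))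
    (lin_additivef (asc N M U))).
have FZ U b x : F U (b *: x) = b *: F U x by rewrite /F /= !linearZ.
have FE U n m u : F U (bmt n (bmt m u)) = (g (bmt n m) : B) *: u.
  by rewrite /F /= ascE tmaplE lunitE.
exists (fun U => lin_of (FD U) (FZ U)); split=> [U|U V f].
  apply: (bij_comp (f := _ \o _)); last exact: asc_bij.
  apply: bij_comp; first exact: lunit_bij.
  exists (tmapl U g'r).
    apply: (bmt_ext (f := fun x => tmapl U g'r (tmapl U gr x))) => [||m u] //.
      exact: additivef_comp (lin_additivef _) (lin_additivef _).
    by rewrite !tmaplE gK.
  apply: (bmt_ext (f := fun x => tmapl U gr (tmapl U g'r x))) => [||m u] //.
    exact: additivef_comp (lin_additivef _) (lin_additivef _).
  by rewrite !tmaplE g'K.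
apply: asc_ext => [||n m u /=]; try exact: additivef_comp (lin_additivef _) (lin_additivef _).
by rewrite !tmapE !lin_ofE !FE linearZ.
Qed.

Lemma inverse_morita (A B : ualg R) (M : bimod A B) (N : bimod B A) :
  bimod_inverse M N -> morita M.
Proof.
case=> MN NM.
have [th [thb thn]] := inverse_nat NM.
have [ps [psb psn]] := inverse_nat MN.
have faithM (U V : lmodType B) (f g : {linear U -> V}) : tmap M f =1 tmap M g -> f =1 g.
  move=> fg x; have [th' thK thK'] := thb U.
  rewrite -[x]thK'; have /= -> := thn _ _ f (th' x).
  by have /= -> := thn _ _ g (th' x); congr (th V _); apply: eq_tmap.
have faithN (U V : lmodType A) (f g : {linear U -> V}) : tmap N f =1 tmap N g -> f =1 g.
  move=> fg x; have [th' thK thK'] := psb U.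
  rewrite -[x]thK'; have /= -> := psn _ _ f (th' x).
  by have /= -> := psn _ _ g (th' x); congr (ps V _); apply: eq_tmap.
split=> // [U V h|V].
  have [th' [thK thK']] := lin_bij (thb U).
  pose f := th V \o tmap N h \o th'.
  have fD : additivef f.
    exact: (additivef_comp (additivef_comp (lin_additivef (th V)) (lin_additivef (tmap N h)))
      (lin_additivef th')).
  have fZ b x : f (b *: x) = b *: f x by rewrite /f /= !linearZ.
  exists (lin_of fD fZ); apply: faithN => x.
  apply: (bij_inj (thb V)).
  by have /= <- := thn _ _ (lin_of fD fZ) x; rewrite lin_ofE /f /= thK.
by exists (bm_tensor N V), (ps V).
Qed.

Section MoritaToInverse.
Variables (A B : ualg R) (M : bimod A B).
Hypothesis Mm : morita M.

Let faith : forall (U V : lmodType B) (f g : {linear U -> V}),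
  tmap M f =1 tmap M g -> f =1 g.
Proof. by case: Mm. Qed.

Variables (X : lmodType B) (phi : {linear bm_tensor M X -> A^o}).
Variable (psi : {linear A^o -> bm_tensor M X}).
Hypotheses (phiK : cancel phi psi) (psiK : cancel psi phi).

Definition mi_hom_fun (a : A) (x : bm_tensor M X) : bm_tensor M X :=
  psi ((phi x : A) * a).

Lemma mi_homD a : additivef (mi_hom_fun a).
Proof. by move=> x y; rewrite /mi_hom_fun linearD mulrDl linearD. Qed.

Lemma mi_homZ a c x : mi_hom_fun a (c *: x) = c *: mi_hom_fun a x.
Proof.
have phiZ : phi (c *: x) = c * (phi x : A) :> A by apply: (linearZZ phi).
rewrite /mi_hom_fun phiZ -mulrA.
exact: (linearZZ psi c ((phi x : A) * a)).
Qed.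

Lemma mi_ex (a : A) : exists f : {linear X -> X},
  tmap M f =1 lin_of (@mi_homD a) (@mi_homZ a).
Proof. by case: Mm => _ h _; apply: h. Qed.

Definition mi_map (a : A) : {linear X -> X} := projT1 (cid (mi_ex a)).

Lemma mi_mapE a x : tmap M (mi_map a) x = psi ((phi x : A) * a).
Proof. exact: (projT2 (cid (mi_ex a))). Qed.

Lemma mi_map1 x : mi_map 1 x = x.
Proof.
pose idl := lin_of (f := @id X) (fun x y => erefl) (fun a x => erefl).
apply: (faith (g := idl)) => y.
by rewrite mi_mapE mulr1 phiK (tmap_id (f := idl)).
Qed.

Lemma mi_mapM x a c : mi_map (a * c) x = mi_map c (mi_map a x).
Proof.
have hZ b y : (mi_map c \o mi_map a) (b *: y) = b *: (mi_map c \o mi_map a) y.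
  by rewrite /= !linearZ.
pose h := lin_of (f := mi_map c \o mi_map a)
  (additivef_comp (lin_additivef _) (lin_additivef _)) hZ.
apply: (faith (g := h)) => y.
rewrite (@tmap_comp _ _ _ M _ _ _ (mi_map c) (mi_map a) h) //=.
by rewrite !mi_mapE psiK mulrA.
Qed.

Lemma mi_mapDr x a c : mi_map (a + c) x = mi_map a x + mi_map c x.
Proof.
have hD : additivef (fun x => mi_map a x + mi_map c x).
  by move=> y z; rewrite !linearD addrACA.
have hZ b y : mi_map a (b *: y) + mi_map c (b *: y)
  = b *: (mi_map a y + mi_map c y) by rewrite !linearZ -scalerDr.
apply: (faith (g := lin_of hD hZ)).
have E y : tmap M (lin_of hD hZ) y = tmap M (mi_map a) y + tmap M (mi_map c) y.
  apply: (bmt_ext (f := tmap M (lin_of hD hZ))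
    (g := fun y => tmap M (mi_map a) y + tmap M (mi_map c) y)) => [||m u].
  - exact: lin_additivef.
  - by move=> z t; rewrite !linearD addrACA.
  - by rewrite !tmapE lin_ofE bmtDr.
by move=> y; rewrite E !mi_mapE mulrDr linearD.
Qed.

Lemma mi_central (r : R) x : ualg_str B r *: x = mi_map (ualg_str A r) x.
Proof.
have hD : additivef (fun x : X => ualg_str B r *: x) by move=> y z; apply: scalerDr.
have hZ b (y : X) : ualg_str B r *: (b *: y) = b *: (ualg_str B r *: y).
  by rewrite !scalerA ualg_central.
apply: (faith (f := lin_of hD hZ)) => y.
rewrite mi_mapE -ualg_central.
have -> : psi (ualg_str A r * (phi y : A)) = ualg_str A r *: y.
  by rewrite -[in RHS](phiK y); apply: (linearZZ psi (ualg_str A r) (phi y)).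
apply: (bmt_ext (f := tmap M (lin_of hD hZ))
    (g := fun y => ualg_str A r *: y)) => [||m u].
- exact: lin_additivef.
- by move=> z t; rewrite scalerDr.
- by rewrite tmapE lin_ofE -bmtA bmtZ bm_central.
Qed.

Definition mi_bimod : bimod B A :=
  @Bimod R B A X (fun x a => mi_map a x) mi_map1 mi_mapM
   (fun x y a => linearD (mi_map a) x y) mi_mapDr
   (fun b x a => linearZZ (mi_map a) b x) mi_central.

Lemma mi_right : bimod_iso (bimod_tensor M mi_bimod) (bimod_regular A).
Proof.
exists phi; split=> [|x a]; first by exists psi.
have -> : bm_ract (x : bimod_tensor M mi_bimod) a = tmap M (mi_map a) x.
  apply: (bmt_ext (f := fun x => bmt_ract (N := mi_bimod) x a)) => [||m u].
  - exact: bmt_ractD.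
  - exact: lin_additivef.
  - by rewrite bmt_ractE tmapE.
by rewrite mi_mapE psiK.
Qed.

Lemma mi_left : bimod_iso (bimod_tensor mi_bimod M) (bimod_regular B).
Proof.
set N := mi_bimod.
have full : (forall (U V : lmodType B)
    (h : {linear bm_tensor M U -> bm_tensor M V}),
    exists f : {linear U -> V}, tmap M f =1 h) by case: Mm.
have : bimod_iso (bimod_tensor M (bimod_tensor N M))
                 (bimod_tensor M (bimod_regular B)).
  apply: bimod_iso_trans (bimod_tensorA _ _ _) _.
  apply: bimod_iso_trans (bimod_tensor_iso mi_right (bimod_iso_refl M)) _.
  apply: bimod_iso_trans (bimod_tensor1l _) _.
  exact: bimod_iso_sym (bimod_tensor1r _).
case=> h [/lin_bij[h' [hK h'K]] hr].
have [g gE] := full _ _ h; have [g' g'E] := full _ _ h'.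
have cc (U V : lmodType B) (f : {linear U -> V}) (f' : {linear V -> U}) :
    cancel (tmap M f) (tmap M f') -> cancel f f'.
  move=> fK; have hZ b y : (f' \o f) (b *: y) = b *: (f' \o f) y.
    by rewrite /= !linearZ.
  pose k := lin_of (f := f' \o f) (additivef_comp (lin_additivef _) (lin_additivef _)) hZ.
  pose idl := lin_of (f := @id U) (fun x y => erefl) (fun a x => erefl).
  apply: (faith (f := k) (g := idl)) => y.
  by rewrite (@tmap_comp _ _ _ M _ _ _ f' f k) //= fK (tmap_id (f := idl)).
exists g; split.
  exists g'; apply: cc => x; first by rewrite gE g'E hK.
  by rewrite g'E gE h'K.
move=> x b.
pose T := bimod_tensor N M.
have rD (L : bimod B B) : additivef (fun x : L => bm_ract x b).
  by move=> y z; apply: ractDl.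
have rZ (L : bimod B B) c (y : L) : bm_ract (c *: y) b = c *: bm_ract y b.
  exact: ractZ.
pose rr L := lin_of (rD L) (rZ L).
have rrE L y : tmap M (rr L) y = bm_ract (y : bimod_tensor M L) b.
  apply: (bmt_ext (g := fun y => bmt_ract (N := L) y b)) => [||m u].
  - exact: lin_additivef.
  - exact: bmt_ractD.
  - by rewrite bmt_ractE tmapE.
have kD : additivef (g \o rr T) by exact: additivef_comp (lin_additivef _) (lin_additivef _).
have kZ c y : (g \o rr T) (c *: y) = c *: (g \o rr T) y by rewrite /= !linearZ.
have lD : additivef (rr (bimod_regular B) \o g).
  exact: additivef_comp (lin_additivef _) (lin_additivef _).
have lZ c y : (rr (bimod_regular B) \o g) (c *: y)
  = c *: (rr (bimod_regular B) \o g) y by rewrite /= !linearZ.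
apply: (faith (f := lin_of kD kZ) (g := lin_of lD lZ)) => y.
have -> : tmap M (lin_of kD kZ) y = tmap M g (tmap M (rr T) y).
  exact: (@tmap_comp _ _ _ M _ _ _ g (rr T) (lin_of kD kZ)).
have -> : tmap M (lin_of lD lZ) y
    = tmap M (rr (bimod_regular B)) (tmap M g y).
  exact: (@tmap_comp _ _ _ M _ _ _ (rr (bimod_regular B)) g (lin_of lD lZ)).
by rewrite !rrE !gE hr.
Qed.
End MoritaToInverse.

Lemma morita_inverse (A B : ualg R) (M : bimod A B) :
  morita M -> exists N, bimod_inverse M N.
Proof.
move=> Mm; have [_ _ /(_ A^o)[X [phi /lin_bij[psi [phiK psiK]]]]] := Mm.
by exists (mi_bimod Mm phiK psiK); split; [apply: mi_right | apply: mi_left].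
Qed.

Lemma moritaP (A B : ualg R) (M : bimod A B) :
  morita M <-> exists N, bimod_inverse M N.
Proof.
by split=> [|[N]]; [apply: morita_inverse | apply: inverse_morita].
Qed.
End MoritaInverse.

(* Picard groups are groups of classes of modules and thus live in a universe
   above the carriers of MathComp's [groupType], which is why groups are
   defined here. *)
Record grp := Grp {
  grp_sort :> Type;
  gmul : grp_sort -> grp_sort -> grp_sort;
  gone : grp_sort;
  ginv : grp_sort -> grp_sort;
  gmulA : associative gmul;
  gmul1 : left_id gone gmul;
  gmulV : left_inverse gone ginv gmul
}.
Arguments gone {g}.

Definition gexp (H : grp) (x : H) (n : nat) : H := iter n (gmul x) gone.

Definition grp_finite (H : grp) : Prop :=
  exists (n : nat) (f : 'I_n -> H), forall x, exists i, f i = x.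

Record ghom (H K : grp) := Ghom {
  ghom_fun :> H -> K;
  ghomM : forall x y, ghom_fun (gmul x y) = gmul (ghom_fun x) (ghom_fun y)
}.

Definition is_colimit (I : Type) (le : I -> I -> Prop) (X : I -> grp)
    (f : forall i j, le i j -> ghom (X i) (X j))
    (L : grp) (g : forall i, ghom (X i) L) : Prop :=
  (forall i j (ij : le i j) x, g j (f i j ij x) = g i x) /\
  forall (H : grp) (u : forall i, ghom (X i) H),
    (forall i j (ij : le i j) x, u j (f i j ij x) = u i x) ->
    exists v : ghom L H,
      (forall i x, v (g i x) = u i x) /\
      forall v' : ghom L H, (forall i x, v' (g i x) = u i x) -> v' =1 v.

Section Picard.
Variables (R : comPzRingType) (A : ualg R).

Lemma bimod_inverse_tensor (M N M' N' : bimod A A) :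
  bimod_inverse M M' -> bimod_inverse N N' ->
  bimod_inverse (bimod_tensor M N) (bimod_tensor N' M').
Proof.
have half (M1 N1 M2 N2 : bimod A A) :
    bimod_iso (bimod_tensor M1 M2) (bimod_regular A) ->
    bimod_iso (bimod_tensor N1 N2) (bimod_regular A) ->
    bimod_iso (bimod_tensor (bimod_tensor M1 N1) (bimod_tensor N2 M2))
      (bimod_regular A).
  move=> hM hN; apply: bimod_iso_trans (bimod_iso_sym (bimod_tensorA _ _ _)) _.
  apply: bimod_iso_trans hM; apply: bimod_tensor_iso (bimod_iso_refl _) _.
  apply: bimod_iso_trans (bimod_tensorA _ _ _) _.
  apply: bimod_iso_trans (bimod_tensor1l _).
  exact: bimod_tensor_iso hN (bimod_iso_refl _).
by move=> [h1 h2] [h3 h4]; split; apply: half.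
Qed.

Lemma morita_tensor (M N : bimod A A) :
  morita M -> morita N -> morita (bimod_tensor M N).
Proof.
move=> /moritaP[M' hM] /moritaP[N' hN]; apply/moritaP.
by exists (bimod_tensor N' M'); apply: bimod_inverse_tensor.
Qed.

Lemma morita_regular : morita (bimod_regular A).
Proof.
by apply/moritaP; exists (bimod_regular A); split; apply: bimod_tensor1l.
Qed.

Record pic := PicClass {
  pic_mem :> bimod A A -> Prop;
  picP : exists M, morita M /\ pic_mem = bimod_iso M
}.

Lemma pic_ext (P Q : pic) : (forall M, P M <-> Q M) -> P = Q.
Proof.
case: P Q => [P hP] [Q hQ] /= PQ.
have E : P = Q by apply/funext => M; apply/propext.
by move: hP; rewrite E => hP; congr PicClass; apply: Prop_irrelevance.
Qed.

Definition pic_of (M : bimod A A) (hM : morita M) : pic :=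
  PicClass (ex_intro _ M (conj hM erefl)).

Lemma pic_surj (P : pic) : exists M (hM : morita M), P = pic_of hM.
Proof.
by have [M [hM E]] := picP P; exists M, hM; apply: pic_ext => N; rewrite E.
Qed.

Lemma pic_of_eq (M N : bimod A A) (hM : morita M) (hN : morita N) :
  pic_of hM = pic_of hN <-> bimod_iso M N.
Proof.
split=> [/(congr1 pic_mem) /= E|MN]; first by rewrite E; apply: bimod_iso_refl.
apply: pic_ext => L; split=> /=; last exact: bimod_iso_trans.
exact: bimod_iso_trans (bimod_iso_sym MN).
Qed.

Definition pic_mul_mem (P Q : pic) (L : bimod A A) : Prop :=
  exists M N : bimod A A, [/\ P M, Q N & bimod_iso (bimod_tensor M N) L].

Lemma pic_mul_subproof (P Q : pic) :
  exists M, morita M /\ pic_mul_mem P Q = bimod_iso M.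
Proof.
have [M [hM ->]] := pic_surj P; have [N [hN ->]] := pic_surj Q.
exists (bimod_tensor M N); split; first exact: morita_tensor.
apply/funext => L; apply/propext; split=> [[M' [N' [hM' hN']]]|hL].
  exact/bimod_iso_trans/bimod_tensor_iso.
by exists M, N; split=> //; apply: bimod_iso_refl.
Qed.

Definition pic_mul (P Q : pic) : pic := PicClass (pic_mul_subproof P Q).

Lemma pic_mulE (M N : bimod A A) (hM : morita M) (hN : morita N) :
  pic_mul (pic_of hM) (pic_of hN) = pic_of (morita_tensor hM hN).
Proof.
apply: pic_ext => L; split=> [[M' [N' [hM' hN']]]|hL].
  exact/bimod_iso_trans/bimod_tensor_iso.
by exists M, N; split=> //; apply: bimod_iso_refl.
Qed.

Definition pic_inv_mem (P : pic) (N : bimod A A) : Prop :=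
  exists M : bimod A A, P M /\ bimod_inverse M N.

Lemma bimod_inverse_uniq (M M' N N' : bimod A A) :
  bimod_iso M M' -> bimod_inverse M N -> bimod_inverse M' N' -> bimod_iso N N'.
Proof.
move=> MM' [_ NM] [M'N' _].
apply: bimod_iso_trans (bimod_iso_sym (bimod_tensor1r N)) _.
apply: bimod_iso_trans
  (bimod_tensor_iso (bimod_iso_refl _) (bimod_iso_sym M'N')) _.
apply: bimod_iso_trans (bimod_tensorA _ _ _) _.
apply: bimod_iso_trans (bimod_tensor1l _).
apply: bimod_tensor_iso (bimod_iso_refl _).
apply: bimod_iso_trans NM.
exact: bimod_tensor_iso (bimod_iso_refl _) (bimod_iso_sym MM').
Qed.

Lemma bimod_inverse_iso (M N N' : bimod A A) :
  bimod_iso N N' -> bimod_inverse M N -> bimod_inverse M N'.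
Proof.
move=> NN' [h1 h2]; split.
  apply: bimod_iso_trans h1.
  exact: bimod_tensor_iso (bimod_iso_refl _) (bimod_iso_sym NN').
apply: bimod_iso_trans h2.
exact: bimod_tensor_iso (bimod_iso_sym NN') (bimod_iso_refl _).
Qed.

Lemma bimod_inverse_sym (M N : bimod A A) :
  bimod_inverse M N -> bimod_inverse N M.
Proof. by case. Qed.

Lemma pic_inv_subproof (P : pic) :
  exists N, morita N /\ pic_inv_mem P = bimod_iso N.
Proof.
have [M [hM ->]] := pic_surj P; have /moritaP[N MN] := hM.
exists N; split; first by apply/moritaP; exists M; apply: bimod_inverse_sym.
apply/funext => L; apply/propext; split=> [[M' [hM' M'L]]|NL].
  exact: bimod_inverse_uniq hM' MN M'L.
by exists M; split; [apply: bimod_iso_refl | apply: bimod_inverse_iso NL MN].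
Qed.

Definition pic_inv (P : pic) : pic := PicClass (pic_inv_subproof P).

Definition pic_one : pic := pic_of morita_regular.

Lemma pic_mulA : associative pic_mul.
Proof.
move=> P Q S; have [L [hL ->]] := pic_surj P.
have [M [hM ->]] := pic_surj Q; have [N [hN ->]] := pic_surj S.
by rewrite !pic_mulE; apply/pic_of_eq; apply: bimod_tensorA.
Qed.

Lemma pic_mul1 : left_id pic_one pic_mul.
Proof.
move=> P; have [L [hL ->]] := pic_surj P.
by rewrite !pic_mulE; apply/pic_of_eq; apply: bimod_tensor1l.
Qed.

Lemma pic_mulV : left_inverse pic_one pic_inv pic_mul.
Proof.
move=> P; have [M [hM ->]] := pic_surj P; have /moritaP[N MN] := hM.
have hN : morita N by apply/moritaP; exists M; apply: bimod_inverse_sym.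
have -> : pic_inv (pic_of hM) = pic_of hN.
  apply: pic_ext => L; split=> [[M' [hM' M'L]]|NL].
    exact: bimod_inverse_uniq hM' MN M'L.
  by exists M; split; [apply: bimod_iso_refl | apply: bimod_inverse_iso NL MN].
by rewrite pic_mulE; apply/pic_of_eq; case: MN.
Qed.

Definition Pic : grp := Grp pic_mulA pic_mul1 pic_mulV.
End Picard.

Section GroupAlgebra.
Variables (R : comPzRingType) (gT : finGroupType).

(* The group algebra R[gT], with the convolution product. *)
Definition grpalg : Type := {ffun gT -> R}.
HB.instance Definition _ := GRing.Zmodule.on grpalg.

Definition grpalg_mul (x y : grpalg) : grpalg :=
  [ffun g => \sum_(h : gT) x h * y (h^-1 * g)%g].
Definition gscal (c : R) : grpalg := [ffun g => c *+ (g == 1%g)].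

Lemma grpalg_mulA : associative grpalg_mul.
Proof.
move=> x y z; apply/ffunP => g; rewrite !ffunE.
under eq_bigr => h _ do rewrite ffunE mulr_sumr.
under [RHS]eq_bigr => h _ do rewrite ffunE mulr_suml.
rewrite [RHS]exchange_big /=; apply: eq_bigr => h _.
rewrite [RHS](reindex_inj (mulgI h)) /=; apply: eq_bigr => k _.
by rewrite mulrA mulKg invMg mulgA.
Qed.

Lemma gscalE c x g : grpalg_mul (gscal c) x g = c * x g.
Proof.
rewrite ffunE (bigD1 1%g) //= big1 ?addr0 => [|h /negPf h1].
  by rewrite ffunE eqxx invg1 mul1g.
by rewrite ffunE h1 mulr0n mul0r.
Qed.

Lemma grpalg_mul1 : left_id (gscal 1) grpalg_mul.
Proof. by move=> x; apply/ffunP => g; rewrite gscalE mul1r. Qed.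

Lemma gscalC c x g : grpalg_mul x (gscal c) g = x g * c.
Proof.
rewrite ffunE (bigD1 g) //= big1 ?addr0 => [|h hg].
  by rewrite ffunE mulVg eqxx.
by rewrite ffunE -eq_invg_mul invgK (negPf hg) mulr0n mulr0.
Qed.

Lemma grpalg_mulr1 : right_id (gscal 1) grpalg_mul.
Proof. by move=> x; apply/ffunP => g; rewrite gscalC mulr1. Qed.

Lemma grpalg_mulDl : left_distributive grpalg_mul +%R.
Proof.
move=> x y z; apply/ffunP => g; rewrite !ffunE -big_split /=.
by apply: eq_bigr => h _; rewrite ffunE mulrDl.
Qed.

Lemma grpalg_mulDr : right_distributive grpalg_mul +%R.
Proof.
move=> x y z; apply/ffunP => g; rewrite !ffunE -big_split /=.
by apply: eq_bigr => h _; rewrite ffunE mulrDr.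
Qed.

HB.instance Definition _ := GRing.Zmodule_isPzRing.Build grpalg
  grpalg_mulA grpalg_mul1 grpalg_mulr1 grpalg_mulDl grpalg_mulDr.

Lemma grpalgM (x y : grpalg) g :
  (x * y) g = \sum_(h : gT) x h * y (h^-1 * g)%g.
Proof. by rewrite /GRing.mul /= ffunE. Qed.

Lemma gscalMl c (x : grpalg) g : (gscal c * x) g = c * x g.
Proof. exact: gscalE. Qed.

Lemma gscal_central c (x : grpalg) : gscal c * x = x * gscal c.
Proof.
apply/ffunP => g; rewrite gscalMl; symmetry.
by apply: etrans (gscalC _ _ _) _; apply: mulrC.
Qed.

Lemma gscal1 : gscal 1 = 1. Proof. by []. Qed.

Lemma gscalD : {morph gscal : c d / c + d}.
Proof. by move=> c d; apply/ffunP => g; rewrite !ffunE mulrnDl. Qed.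

Lemma gscalM : {morph gscal : c d / c * d >-> c * d}.
Proof.
by move=> c d; apply/ffunP => g; rewrite gscalMl !ffunE mulrnAr.
Qed.

Definition gel (g : gT) : grpalg := [ffun h => (h == g)%:R].

Lemma gelMl g (x : grpalg) h : (gel g * x) h = x (g^-1 * h)%g.
Proof.
rewrite grpalgM (bigD1 g) //= big1 ?addr0 => [|k /negPf kg].
  by rewrite ffunE eqxx mul1r.
by rewrite ffunE kg mul0r.
Qed.

Lemma gelM g h : gel g * gel h = gel (g * h)%g.
Proof.
apply/ffunP => k; rewrite gelMl !ffunE; congr (nat_of_bool _)%:R.
by rewrite -(inj_eq (mulgI g)) mulKVg.
Qed.

Lemma gel1 : gel 1%g = 1.
Proof. by apply/ffunP => g; rewrite !ffunE. Qed.

Lemma grpalg_expand (x : grpalg) : x = \sum_(g : gT) gscal (x g) * gel g.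
Proof.
apply/ffunP => h; rewrite sum_ffunE (bigD1 h) //= big1 ?addr0 => [|k kh].
  by rewrite gscalMl ffunE eqxx mulr1.
by rewrite gscalMl ffunE eq_sym (negPf kh) mulr0.
Qed.
End GroupAlgebra.

Definition central_idempotent (A : pzRingType) (b : A) : Prop :=
  b * b = b /\ forall x, b * x = x * b.

Section Corner.
Variables (A : pzRingType) (b : A).

Definition corner_pred : {pred A} := [pred x | x * b == x].

Lemma corner_zmod_closed : zmod_closed corner_pred.
Proof.
split=> [|x y]; first by rewrite inE mul0r.
by rewrite !inE => /eqP xb /eqP yb; rewrite mulrBl xb yb.
Qed.

HB.instance Definition _ :=
  GRing.isZmodClosed.Build A corner_pred corner_zmod_closed.

(* The ring Ab, with unit b. *)
Record corner (hb : central_idempotent b) :=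
  Corner { corner_val : A; corner_valP : corner_val \in corner_pred }.

Variable hb : central_idempotent b.

HB.instance Definition _ := [isSub for @corner_val hb].
HB.instance Definition _ := [Choice of corner hb by <:].
HB.instance Definition _ := [SubChoice_isSubZmodule of corner hb by <:].

Lemma corner_inj : injective (@corner_val hb).
Proof. exact: val_inj. Qed.

Lemma corner_valE (x : corner hb) : corner_val x * b = corner_val x.
Proof. by have := corner_valP x; rewrite inE => /eqP. Qed.

Lemma corner_in x : x * b \in corner_pred.
Proof. by rewrite inE -mulrA (proj1 hb). Qed.

Definition corner_proj (x : A) : corner hb := Corner hb (corner_in x).

Definition corner_mul (x y : corner hb) : corner hb :=
  corner_proj (corner_val x * corner_val y).
Definition corner_one : corner hb := corner_proj 1.

Lemma corner_mulE x y :
  corner_val (corner_mul x y) = corner_val x * corner_val y.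
Proof. by rewrite /= -mulrA corner_valE. Qed.

Lemma corner_valD (x y : corner hb) :
  corner_val (x + y) = corner_val x + corner_val y.
Proof. exact: (raddfD (val : corner hb -> A)). Qed.

Lemma corner_mulA : associative corner_mul.
Proof. by move=> x y z; apply: corner_inj; rewrite !corner_mulE mulrA. Qed.

Lemma corner_mul1 : left_id corner_one corner_mul.
Proof.
move=> x; apply: corner_inj; rewrite corner_mulE /= mul1r (proj2 hb).
exact: corner_valE.
Qed.

Lemma corner_mulr1 : right_id corner_one corner_mul.
Proof.
move=> x; apply: corner_inj; rewrite corner_mulE /= mul1r; exact: corner_valE.
Qed.

Lemma corner_mulDl : left_distributive corner_mul +%R.
Proof.
move=> x y z; apply: corner_inj.
by rewrite !(corner_valD, corner_mulE) mulrDl.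
Qed.

Lemma corner_mulDr : right_distributive corner_mul +%R.
Proof.
move=> x y z; apply: corner_inj.
by rewrite !(corner_valD, corner_mulE) mulrDr.
Qed.

HB.instance Definition _ := GRing.Zmodule_isPzRing.Build (corner hb)
  corner_mulA corner_mul1 corner_mulr1 corner_mulDl corner_mulDr.

Lemma corner_valM (x y : corner hb) :
  corner_val (x * y) = corner_val x * corner_val y.
Proof. exact: corner_mulE. Qed.

Lemma corner_val1 : corner_val (1 : corner hb) = b.
Proof. by rewrite /= mul1r. Qed.

Lemma corner_val_sum (I : Type) (s : seq I) (F : I -> corner hb) :
  corner_val (\sum_(i <- s) F i) = \sum_(i <- s) corner_val (F i).
Proof. exact: (raddf_sum (val : corner hb -> A)). Qed.
End Corner.

Section Block.
Variables (R : comPzRingType) (gT : finGroupType) (b : grpalg R gT).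
Hypothesis hb : central_idempotent b.

Definition block_str (c : R) : corner hb := corner_proj hb (gscal gT c).

Lemma block_str_zmod : zmod_morphism block_str.
Proof.
move=> c d; apply: (addIr (block_str d)); rewrite subrK; apply: corner_inj.
rewrite corner_valD /= -mulrDl; congr (_ * _).
by rewrite -gscalD subrK.
Qed.

Lemma block_str_monoid : monoid_morphism block_str.
Proof.
split=> [|c d]; first exact: corner_inj.
apply: corner_inj; rewrite corner_valM /= gscalM.
by rewrite -!mulrA (mulrA b) -(gscal_central d b) -mulrA (proj1 hb).
Qed.

HB.instance Definition _ :=
  GRing.isZmodMorphism.Build R (corner hb) block_str block_str_zmod.
HB.instance Definition _ :=
  GRing.isMonoidMorphism.Build R (corner hb) block_str block_str_monoid.

Lemma block_str_central c (x : corner hb) : block_str c * x = x * block_str c.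
Proof.
apply: corner_inj; by rewrite !corner_valM /= -mulrA (proj2 hb) corner_valE mulrA
  -gscal_central -mulrA corner_valE.
Qed.

(* The R-algebra R[gT]b. *)
Definition block : ualg R :=
  @Ualg R (corner hb) block_str block_str_central.

Definition bel (g : gT) : block := corner_proj hb (gel R g).

Lemma belM g h : bel g * bel h = bel (g * h)%g.
Proof.
apply: corner_inj; rewrite corner_valM /= -gelM.
by rewrite -mulrA (mulrA b) (proj2 hb) -!mulrA (proj1 hb) mulrA.
Qed.

Lemma bel1 : bel 1%g = 1.
Proof. by apply: corner_inj; rewrite /= gel1. Qed.

Lemma block_expand (a : block) :
  a = \sum_(g : gT) ualg_str block (corner_val a g) * bel g.
Proof.
apply: corner_inj; rewrite corner_val_sum.
rewrite -[LHS]corner_valE.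
rewrite {1}[corner_val a]grpalg_expand mulr_suml; apply: eq_bigr => g _.
by rewrite corner_valM /= -mulrA (mulrA b) (proj2 hb) -!mulrA (proj1 hb).
Qed.
End Block.

Definition grpalg_map (R0 R1 : comPzRingType) (iota : {rmorphism R0 -> R1})
    (gT : finGroupType) (x : grpalg R0 gT) : grpalg R1 gT :=
  [ffun g => iota (x g)].

Section Extension.
Variables (R0 R1 : comPzRingType) (iota : {rmorphism R0 -> R1}).
Variables (gT : finGroupType) (b0 : grpalg R0 gT) (b1 : grpalg R1 gT).
Variables (hb0 : central_idempotent b0) (hb1 : central_idempotent b1).
Hypothesis eqb : grpalg_map iota b0 = b1.

Local Notation B0 := (block hb0).
Local Notation B1 := (block hb1).

Lemma b1E g : b1 g = iota (b0 g). Proof. by rewrite -eqb ffunE. Qed.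

Definition ext_tensor (M : lmodType B0) : Type :=
  tensor (fun (x : R1) (c : R0) => x * iota c)
         (fun (c : R0) (m : M) => ualg_str B0 c *: m).
HB.instance Definition _ M := GRing.Zmodule.on (ext_tensor M).

Section Action.
Variable M : lmodType B0.

Definition ext_pure (x : R1) (m : M) : ext_tensor M := tens _ _ x m.

Lemma ext_pureDl x y m : ext_pure (x + y) m = ext_pure x m + ext_pure y m.
Proof. exact: tensDl. Qed.
Lemma ext_pureDr x m n : ext_pure x (m + n) = ext_pure x m + ext_pure x n.
Proof. exact: tensDr. Qed.
Lemma ext_pureA x c m :
  ext_pure (x * iota c) m = ext_pure x (ualg_str B0 c *: m).
Proof. exact: tensA. Qed.

Lemma ext_pure_sumr x (I : Type) (s : seq I) (F : I -> M) :
  ext_pure x (\sum_(i <- s) F i) = \sum_(i <- s) ext_pure x (F i).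
Proof. by apply: additivef_sum => m n; apply: ext_pureDr. Qed.

Lemma ext_pure_suml m (I : Type) (s : seq I) (F : I -> R1) :
  ext_pure (\sum_(i <- s) F i) m = \sum_(i <- s) ext_pure (F i) m.
Proof. by apply: (additivef_sum (f := ext_pure^~ m)) => x y; apply: ext_pureDl. Qed.

Definition ext_balanced (V : zmodType) (f : R1 -> M -> V) : Prop :=
  [/\ forall x y m, f (x + y) m = f x m + f y m,
      forall x m n, f x (m + n) = f x m + f x n &
      forall x c m, f (x * iota c) m = f x (ualg_str B0 c *: m)].

Definition ext_lift (V : zmodType) (f : R1 -> M -> V) : ext_tensor M -> V :=
  tlift f.

Lemma ext_lift_additivef (V : zmodType) (f : R1 -> M -> V) :
  ext_balanced f -> additivef (ext_lift f).
Proof. exact: tlift_additivef. Qed.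

Lemma ext_liftE (V : zmodType) (f : R1 -> M -> V) x m :
  ext_balanced f -> ext_lift f (ext_pure x m) = f x m.
Proof. exact: tliftE. Qed.

Lemma ext_ext (V : zmodType) (f g : ext_tensor M -> V) : additivef f -> additivef g ->
  (forall x m, f (ext_pure x m) = g (ext_pure x m)) -> f =1 g.
Proof. exact: tens_ext. Qed.

(* Given an action rho of gT on M, the element x = \sum_g x_g g of R1[gT] maps
   r ⊗ m to \sum_g x_g r ⊗ rho g m. *)
Definition gact (rho : gT -> M -> M) (x : grpalg R1 gT) :
    ext_tensor M -> ext_tensor M :=
  ext_lift (fun r m => \sum_(g : gT) ext_pure (x g * r) (rho g m)).

Definition gact_ok (rho : gT -> M -> M) : Prop :=
  (forall g, additivef (rho g)) /\
  forall g c m, rho g (ualg_str B0 c *: m) = ualg_str B0 c *: rho g m.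

Section Rho.
Variable rho : gT -> M -> M.
Hypothesis ok : gact_ok rho.

Lemma gact_balanced x :
  ext_balanced (fun r m => \sum_(g : gT) ext_pure (x g * r) (rho g m)).
Proof.
case: ok => rD rZ; split=> [r s m|r m n|r c m].
- by rewrite -big_split; apply: eq_bigr => g _ /=; rewrite mulrDr ext_pureDl.
- by rewrite -big_split; apply: eq_bigr => g _ /=; rewrite rD ext_pureDr.
- by apply: eq_bigr => g _; rewrite rZ -ext_pureA mulrA.
Qed.

Lemma gactD x : additivef (gact rho x).
Proof. exact/ext_lift_additivef/gact_balanced. Qed.

Lemma gactE x r m :
  gact rho x (ext_pure r m) = \sum_(g : gT) ext_pure (x g * r) (rho g m).
Proof. exact/ext_liftE/gact_balanced. Qed.

Lemma gactDx x y t : gact rho (x + y) t = gact rho x t + gact rho y t.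
Proof.
apply: (ext_ext (f := gact rho (x + y)) (g := fun t => gact rho x t + gact rho y t)).
- exact: gactD.
- by move=> s u; rewrite !gactD addrACA.
- move=> r m; rewrite !gactE -big_split; apply: eq_bigr => g _ /=.
  by rewrite ffunE mulrDl ext_pureDl.
Qed.

Lemma gactM x y t : (forall g h m, rho g (rho h m) = rho (g * h)%g m) ->
  gact rho x (gact rho y t) = gact rho (x * y) t.
Proof.
move=> rM; apply: (ext_ext (f := fun t => gact rho x (gact rho y t))) => [||r m].
- exact: additivef_comp (gactD _) (gactD _).
- exact: gactD.
rewrite !gactE (additivef_sum _ _ (gactD x)).
under eq_bigr => h _ do rewrite gactE.
rewrite exchange_big.
under [RHS]eq_bigr => k _ do rewrite grpalgM mulr_suml ext_pure_suml.
rewrite [RHS]exchange_big /=; apply: eq_bigr => g _.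
rewrite [RHS](reindex_inj (mulgI g)) /=; apply: eq_bigr => h _.
by rewrite rM mulKg mulrA.
Qed.

Lemma gactMr x y t : (forall g h m, rho g (rho h m) = rho (h * g)%g m) ->
  gact rho x (gact rho y t) = gact rho (y * x) t.
Proof.
move=> rM; apply: (ext_ext (f := fun t => gact rho x (gact rho y t))) => [||r m].
- exact: additivef_comp (gactD _) (gactD _).
- exact: gactD.
rewrite !gactE (additivef_sum _ _ (gactD x)).
under eq_bigr => h _ do rewrite gactE.
under [RHS]eq_bigr => k _ do rewrite grpalgM mulr_suml ext_pure_suml.
rewrite [RHS]exchange_big /=; apply: eq_bigr => h _.
rewrite [RHS](reindex_inj (mulgI h)) /=; apply: eq_bigr => g _.
by rewrite rM mulKg mulrA [y h * x g]mulrC.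
Qed.

Hypothesis rho1 : forall m, \sum_(g : gT) ualg_str B0 (b0 g) *: rho g m = m.

Lemma gact_idem t : gact rho b1 t = t.
Proof.
apply: (ext_ext (f := gact rho b1)) => [||r m] //; first exact: gactD.
rewrite gactE -[in RHS](rho1 m) ext_pure_sumr; apply: eq_bigr => g _.
by rewrite -ext_pureA b1E mulrC.
Qed.

Lemma gact_scal c r m :
  gact rho (gscal gT c * b1) (ext_pure r m) = ext_pure (c * r) m.
Proof.
rewrite -[RHS]gact_idem !gactE; apply: eq_bigr => g _.
by rewrite gscalMl mulrCA mulrA.
Qed.
End Rho.

Lemma gact_comm rho rho' x y t : gact_ok rho -> gact_ok rho' ->
  (forall g h m, rho g (rho' h m) = rho' h (rho g m)) ->
  gact rho x (gact rho' y t) = gact rho' y (gact rho x t).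
Proof.
move=> ok ok' cm; apply: (ext_ext (f := fun t => gact rho x (gact rho' y t))
  (g := fun t => gact rho' y (gact rho x t))) => [||r m].
- exact: additivef_comp (gactD ok _) (gactD ok' _).
- exact: additivef_comp (gactD ok' _) (gactD ok _).
rewrite !gactE // (additivef_sum _ _ (gactD ok x)) (additivef_sum _ _ (gactD ok' y)).
under eq_bigr => h _ do rewrite gactE //.
under [RHS]eq_bigr => h _ do rewrite gactE //.
rewrite exchange_big; apply: eq_bigr => g _; apply: eq_bigr => h _.
by rewrite cm mulrCA.
Qed.

Definition lrho (g : gT) (m : M) : M := bel hb0 g *: m.

Lemma lrho_ok : gact_ok lrho.
Proof.
split=> [g x y|g c m]; first exact: scalerDr.
by rewrite /lrho !scalerA ualg_central.
Qed.

Lemma lrhoM g h m : lrho g (lrho h m) = lrho (g * h)%g m.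
Proof. by rewrite /lrho scalerA belM. Qed.

Lemma b0_expand : \sum_(g : gT) ualg_str B0 (b0 g) * bel hb0 g = 1.
Proof. by rewrite [RHS]block_expand corner_val1. Qed.

Lemma lrho1 m : \sum_(g : gT) ualg_str B0 (b0 g) *: lrho g m = m.
Proof.
under eq_bigr => g _ do rewrite /lrho scalerA.
by rewrite -scaler_suml b0_expand scale1r.
Qed.

Definition ext_scale (x : B1) : ext_tensor M -> ext_tensor M :=
  gact lrho (corner_val x).

Lemma ext_scaleA x y t : ext_scale x (ext_scale y t) = ext_scale (x * y) t.
Proof.
rewrite /ext_scale gactM ?corner_valM //; [exact: lrho_ok | exact: lrhoM].
Qed.

Lemma ext_scale1 : left_id 1 ext_scale.
Proof.
move=> t; rewrite /ext_scale corner_val1.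
by apply: gact_idem; [exact: lrho_ok | exact: lrho1].
Qed.

Lemma ext_scaleDr : right_distributive ext_scale +%R.
Proof. by move=> x; apply: (gactD lrho_ok). Qed.

Lemma ext_scaleDl t : {morph ext_scale^~ t : x y / x + y}.
Proof.
by move=> x y; rewrite /ext_scale corner_valD (gactDx lrho_ok).
Qed.
End Action.

Definition ext_mod (M : lmodType B0) : lmodType B1 :=
  HB.pack (ext_tensor M) (GRing.Zmodule_isLmodule.Build B1 (ext_tensor M)
    (@ext_scaleA M) (@ext_scale1 M) (@ext_scaleDr M) (@ext_scaleDl M)).

Lemma ext_scaleE (M : lmodType B0) (x : B1) r (m : M) :
  x *: (ext_pure r m : ext_mod M)
  = \sum_(g : gT) ext_pure (corner_val x g * r) (bel hb0 g *: m).
Proof. exact: (gactE (lrho_ok M) (corner_val x) r m). Qed.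

Lemma ext_strE (M : lmodType B0) (c : R1) (r : R1) (m : M) :
  ualg_str B1 c *: (ext_pure r m : ext_mod M) = ext_pure (c * r) m.
Proof. by apply: gact_scal; [exact: lrho_ok | exact: lrho1]. Qed.

Section ExtBimod.
Variable M : bimod B0 B0.

Definition rrho (g : gT) (m : M) : M := bm_ract m (bel hb0 g).

Lemma rrho_ok : gact_ok rrho.
Proof. by split=> [g x y|g c m]; [apply: ractDl | apply: ractZ]. Qed.

Lemma rrhoM g h m : rrho g (rrho h m) = rrho (h * g)%g m.
Proof. by rewrite /rrho -ractM belM. Qed.

Lemma rrho1 m : \sum_(g : gT) ualg_str B0 (b0 g) *: rrho g m = m.
Proof.
under eq_bigr => g _ do rewrite /rrho -ractZ bm_central -ractM.
have rD : additivef (bm_ract m : B0 -> M) by move=> x y; apply: ractDr.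
by rewrite -(additivef_sum _ _ rD) b0_expand ract1.
Qed.

Lemma lrrho g h m : lrho g (rrho h m) = rrho h (lrho g m).
Proof. by rewrite /lrho /rrho ractZ. Qed.

Definition ext_ract (t : ext_mod M) (x : B1) : ext_mod M :=
  gact rrho (corner_val x) t.

Lemma ext_ract1 t : ext_ract t 1 = t.
Proof.
by rewrite /ext_ract corner_val1; apply: gact_idem; [exact: rrho_ok | exact: rrho1].
Qed.

Lemma ext_ractM t x y : ext_ract t (x * y) = ext_ract (ext_ract t x) y.
Proof.
rewrite /ext_ract gactMr ?corner_valM //; [exact: rrho_ok | exact: rrhoM].
Qed.

Lemma ext_ractDl t u x : ext_ract (t + u) x = ext_ract t x + ext_ract u x.
Proof. exact: (gactD rrho_ok). Qed.

Lemma ext_ractDr t x y : ext_ract t (x + y) = ext_ract t x + ext_ract t y.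
Proof. by rewrite /ext_ract corner_valD (gactDx rrho_ok). Qed.

Lemma ext_ractZ (a : B1) t x : ext_ract (a *: t) x = a *: ext_ract t x.
Proof.
symmetry; apply: gact_comm; [exact: lrho_ok | exact: rrho_ok | exact: lrrho].
Qed.

Lemma ext_central (c : R1) t : ualg_str B1 c *: t = ext_ract t (ualg_str B1 c).
Proof.
apply: (ext_ext (f := fun t : ext_mod M => ualg_str B1 c *: t)
  (g := ext_ract^~ (ualg_str B1 c))) => [||r m].
- by move=> x y; apply: scalerDr.
- by move=> x y; apply: ext_ractDl.
rewrite ext_strE; symmetry.
by apply: gact_scal; [exact: rrho_ok | exact: rrho1].
Qed.

(* R1 ⊗_{R0} M *)
Definition bimod_ext : bimod B1 B1 :=
  @Bimod R1 B1 B1 (ext_mod M) ext_ract ext_ract1 ext_ractM ext_ractDl ext_ractDr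
    ext_ractZ ext_central.

Lemma ext_ractE (x : B1) r (m : M) :
  ext_ract (ext_pure r m) x
  = \sum_(g : gT) ext_pure (corner_val x g * r) (bm_ract m (bel hb0 g)).
Proof. exact: (gactE rrho_ok (corner_val x) r m). Qed.
End ExtBimod.

Lemma grpalg_mapM (x y : grpalg R0 gT) :
  grpalg_map iota (x * y) = grpalg_map iota x * grpalg_map iota y.
Proof.
apply/ffunP => g; rewrite ffunE !grpalgM rmorph_sum; apply: eq_bigr => h _ /=.
by rewrite rmorphM !ffunE.
Qed.

Definition ext_elt (a : B0) : B1 :=
  corner_proj hb1 (grpalg_map iota (corner_val a)).

Lemma ext_eltE a : corner_val (ext_elt a) = grpalg_map iota (corner_val a).
Proof. by rewrite /= -eqb -grpalg_mapM corner_valE. Qed.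

Lemma ext_eltM a c : ext_elt (a * c) = ext_elt a * ext_elt c.
Proof.
by apply: corner_inj; rewrite corner_valM !ext_eltE corner_valM grpalg_mapM.
Qed.

Lemma ext_eltD : additivef ext_elt.
Proof.
move=> a c; apply: corner_inj; rewrite corner_valD !ext_eltE corner_valD.
by apply/ffunP => g; rewrite !ffunE rmorphD.
Qed.

Lemma ext_elt_bel g : ext_elt (bel hb0 g) = bel hb1 g.
Proof.
apply: corner_inj; rewrite ext_eltE /= grpalg_mapM eqb; congr (_ * _).
by apply/ffunP => h; rewrite !ffunE rmorph_nat.
Qed.

Lemma ext_elt_scale (a : B0) (M : lmodType B0) r (m : M) :
  ext_elt a *: (ext_pure r m : ext_mod M) = ext_pure r (a *: m).
Proof.
rewrite ext_scaleE [in RHS](block_expand a) scaler_suml ext_pure_sumr.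
apply: eq_bigr => g _.
by rewrite ext_eltE ffunE -scalerA -ext_pureA mulrC.
Qed.

Lemma ext_elt_ract (a : B0) (M : bimod B0 B0) r (m : M) :
  @ext_ract M (ext_pure r m) (ext_elt a) = ext_pure r (bm_ract m a).
Proof.
rewrite ext_ractE [in RHS](block_expand a).
have rD : additivef (bm_ract m : B0 -> M) by move=> x y; apply: ractDr.
rewrite (additivef_sum _ _ rD) ext_pure_sumr; apply: eq_bigr => g _.
by rewrite ext_eltE ffunE ractM -bm_central ractZ -ext_pureA mulrC.
Qed.

Section ExtMap.
Variables (M N : bimod B0 B0) (f : {linear M -> N}).

Lemma ext_map_balanced :
  ext_balanced (M := M) (fun r m => ext_pure r (f m) : ext_tensor N).
Proof.
split=> [r s m|r m n|r c m].
- exact: ext_pureDl.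
- by rewrite linearD ext_pureDr.
- by rewrite linearZ ext_pureA.
Qed.

Definition ext_map : ext_mod M -> ext_mod N :=
  ext_lift (fun r m => ext_pure r (f m) : ext_tensor N).

Lemma ext_mapD : additivef ext_map.
Proof. exact/ext_lift_additivef/ext_map_balanced. Qed.

Lemma ext_mapE r m : ext_map (ext_pure r m) = ext_pure r (f m).
Proof. exact/ext_liftE/ext_map_balanced. Qed.

Lemma ext_mapZ x t : ext_map (x *: t) = x *: ext_map t.
Proof.
apply: (ext_ext (f := fun t : ext_mod M => ext_map (x *: t))
  (g := fun t => x *: ext_map t)) => [||r m].
- by move=> s u; rewrite scalerDr ext_mapD.
- by move=> s u; rewrite ext_mapD scalerDr.
rewrite ext_mapE !ext_scaleE (additivef_sum _ _ ext_mapD).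
by apply: eq_bigr => g _; rewrite ext_mapE linearZ.
Qed.

Definition ext_lin : {linear ext_mod M -> ext_mod N} := lin_of ext_mapD ext_mapZ.

Lemma ext_map_ract : (forall m a, f (bm_ract m a) = bm_ract (f m) a) ->
  forall t x, ext_map (ext_ract t x) = ext_ract (ext_map t) x.
Proof.
move=> fr t x.
apply: (ext_ext (f := fun t => ext_map (ext_ract t x))
  (g := fun t => ext_ract (ext_map t) x)) => [||r m].
- by move=> s u; rewrite ext_ractDl ext_mapD.
- by move=> s u; rewrite ext_mapD ext_ractDl.
rewrite ext_mapE !ext_ractE (additivef_sum _ _ ext_mapD).
by apply: eq_bigr => g _; rewrite ext_mapE fr.
Qed.
End ExtMap.

Lemma ext_map_cancel (M N : bimod B0 B0) (f : {linear M -> N})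
    (g : {linear N -> M}) : cancel f g -> cancel (ext_map f) (ext_map g).
Proof.
move=> fK; apply: (ext_ext (f := fun t => ext_map g (ext_map f t))) => // [|r m].
  exact: additivef_comp (ext_mapD g) (ext_mapD f).
by rewrite !ext_mapE fK.
Qed.

Lemma bimod_ext_iso (M N : bimod B0 B0) :
  bimod_iso M N -> bimod_iso (bimod_ext M) (bimod_ext N).
Proof.
case=> f [/lin_bij[g [fK gK]] fr]; exists (ext_lin f); split.
  by exists (ext_map g); apply: ext_map_cancel.
exact: ext_map_ract.
Qed.

Section ExtRegular.
Local Notation reg0 := (bimod_regular B0).
Local Notation reg1 := (bimod_regular B1).

Definition ext_reg : ext_mod reg0 -> reg1 :=
  ext_lift (fun r (a : reg0) => ualg_str B1 r * ext_elt a : reg1).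

Lemma ext_elt_str c : ext_elt (ualg_str B0 c) = ualg_str B1 (iota c).
Proof.
apply: corner_inj; rewrite ext_eltE /= grpalg_mapM eqb; congr (_ * _).
by apply/ffunP => g; rewrite !ffunE rmorphMn.
Qed.

Lemma ext_reg_balanced :
  ext_balanced (fun r (a : reg0) => ualg_str B1 r * ext_elt a : reg1).
Proof.
split=> [r s m|r m n|r c m].
- by rewrite rmorphD mulrDl.
- by rewrite ext_eltD mulrDr.
- by rewrite rmorphM -mulrA -ext_elt_str -ext_eltM.
Qed.

Lemma ext_regD : additivef ext_reg.
Proof. exact/ext_lift_additivef/ext_reg_balanced. Qed.

Lemma ext_regE r (a : reg0) :
  ext_reg (ext_pure r a) = ualg_str B1 r * ext_elt a.
Proof. exact/ext_liftE/ext_reg_balanced. Qed.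

Lemma ext_regZ (x : B1) t : ext_reg (x *: t) = x *: ext_reg t.
Proof.
apply: (ext_ext (f := fun t : ext_mod reg0 => ext_reg (x *: t))
  (g := fun t => x *: ext_reg t)) => [||r m].
- by move=> s u; rewrite scalerDr ext_regD.
- by move=> s u; rewrite ext_regD scalerDr.
rewrite ext_scaleE (additivef_sum _ _ ext_regD).
have -> : x *: ext_reg (ext_pure r m) = x * (ualg_str B1 r * ext_elt m).
  by rewrite ext_regE.
rewrite [in RHS](block_expand x) mulr_suml; apply: eq_bigr => g _.
rewrite ext_regE.
have -> : ext_elt (bel hb0 g *: m) = bel hb1 g * ext_elt m.
  by rewrite -ext_elt_bel -ext_eltM.
by rewrite rmorphM -!mulrA [in RHS](mulrA (bel _ _)) -ualg_central -!mulrA.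
Qed.

Lemma ext_reg_ract t (x : B1) : ext_reg (ext_ract t x) = (ext_reg t : B1) * x.
Proof.
apply: (ext_ext (f := fun t : ext_mod reg0 => ext_reg (ext_ract t x))
  (g := fun t => (ext_reg t : B1) * x : reg1)) => [||r m].
- by move=> s u; rewrite ext_ractDl ext_regD.
- by move=> s u; rewrite ext_regD mulrDl.
rewrite ext_ractE (additivef_sum _ _ ext_regD) ext_regE.
rewrite [in RHS](block_expand x) mulr_sumr; apply: eq_bigr => g _.
rewrite ext_regE.
have -> : ext_elt (@bm_ract _ _ _ reg0 m (bel hb0 g)) = ext_elt m * bel hb1 g.
  by rewrite -ext_elt_bel -ext_eltM.
by rewrite rmorphM [in RHS]mulrA -[in RHS]ualg_central -!mulrA.
Qed.

Lemma ext_reg_bij : bijective ext_reg.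
Proof.
pose h (x : B1) : ext_mod reg0 :=
  \sum_(g : gT) ext_pure (corner_val x g) (bel hb0 g : reg0).
have hD (x y : B1) : h (x + y) = h x + h y.
  rewrite /h -big_split; apply: eq_bigr => g _.
  by rewrite corner_valD ffunE ext_pureDl.
exists h => [|x].
  apply: (ext_ext (f := fun t => h (ext_reg t))) => // [|r a].
    exact: (additivef_comp (g := h : reg1 -> _) hD ext_regD).
  rewrite ext_regE /h [in RHS](block_expand (a : B0)) ext_pure_sumr.
  apply: eq_bigr => g _.
  have -> : corner_val (ualg_str B1 r * ext_elt a) g
      = r * iota (corner_val (a : B0) g).
    rewrite corner_valM ext_eltE /= -mulrA -ext_eltE (proj2 hb1) corner_valE.
    by rewrite gscalMl ext_eltE ffunE.
  by rewrite ext_pureA.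
rewrite /h (additivef_sum _ _ ext_regD) [RHS](block_expand (x : B1)).
by apply: eq_bigr => g _; rewrite ext_regE ext_elt_bel.
Qed.

Lemma bimod_ext_regular : bimod_iso (bimod_ext reg0) reg1.
Proof.
exists (lin_of ext_regD ext_regZ).
by split; [apply: ext_reg_bij | apply: ext_reg_ract].
Qed.
End ExtRegular.

Section ExtTensor.
Variables (M N : bimod B0 B0).
Local Notation MN := (bimod_tensor M N).
Local Notation eM := (bimod_ext M).
Local Notation eN := (bimod_ext N).

Definition et_in (r : R1) (m : M) : ext_mod N -> ext_mod MN :=
  ext_lift (fun q n => ext_pure (r * q) (bmt m n : MN)).

Lemma str_bmt c (m : M) (n : N) :
  ualg_str B0 c *: (bmt m n : MN) = bmt m (ualg_str B0 c *: n).
Proof. by rewrite bmtZ bm_central bmtA. Qed.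

Lemma et_in_balanced r m : ext_balanced (M := N)
  (fun q n => ext_pure (r * q) (bmt m n : MN) : ext_tensor MN).
Proof.
split=> [q q' n|q n n'|q c n].
- by rewrite mulrDr ext_pureDl.
- by rewrite bmtDr ext_pureDr.
- by rewrite mulrA ext_pureA str_bmt.
Qed.

Lemma et_inD r m : additivef (et_in r m).
Proof. exact/ext_lift_additivef/et_in_balanced. Qed.

Lemma et_inE r m q n : et_in r m (ext_pure q n) = ext_pure (r * q) (bmt m n : MN).
Proof. exact/ext_liftE/et_in_balanced. Qed.

Definition et_bil (s : ext_mod M) (t : ext_mod N) : ext_mod MN :=
  ext_lift (fun r m => et_in r m t) s.

Lemma et_bil_balanced t :
  ext_balanced (M := M) (fun r m => et_in r m t : ext_tensor MN).
Proof.
split=> [r s m|r m n|r c m].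
- apply: (ext_ext (f := et_in (r + s) m)
    (g := fun t => et_in r m t + et_in s m t)) => [||q n'].
  + exact: et_inD.
  + by move=> u v; rewrite !et_inD addrACA.
  + by rewrite !et_inE mulrDl ext_pureDl.
- apply: (ext_ext (f := et_in r (m + n))
    (g := fun t => et_in r m t + et_in r n t)) => [||q n'].
  + exact: et_inD.
  + by move=> u v; rewrite !et_inD addrACA.
  + by rewrite !et_inE bmtDl ext_pureDr.
- apply: (ext_ext (f := et_in (r * iota c) m)
    (g := et_in r (ualg_str B0 c *: m))) => [||q n'].
  + exact: et_inD.
  + exact: et_inD.
  + by rewrite !et_inE mulrAC ext_pureA bmtZ.
Qed.

Lemma et_bilDl t : additivef (et_bil^~ t).
Proof. exact/ext_lift_additivef/et_bil_balanced. Qed.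

Lemma et_bil_inE r m t : et_bil (ext_pure r m) t = et_in r m t.
Proof. exact/ext_liftE/et_bil_balanced. Qed.

Lemma et_bilE r m q n :
  et_bil (ext_pure r m) (ext_pure q n) = ext_pure (r * q) (bmt m n : MN).
Proof. by rewrite et_bil_inE et_inE. Qed.

Lemma et_bilDr s : additivef (et_bil s).
Proof.
move=> t u; apply: (ext_ext (f := et_bil^~ (t + u))
  (g := fun s => et_bil s t + et_bil s u)) => [||r m].
- exact: et_bilDl.
- by move=> x y; rewrite !et_bilDl addrACA.
- by rewrite !et_bil_inE et_inD.
Qed.

(* Maps on ext M × ext N that are additive in both variables are determined
   on pairs of pure tensors. *)
Lemma et_ext2 (V : zmodType) (f g : ext_mod M -> ext_mod N -> V) :
  (forall t, additivef (f^~ t)) -> (forall s, additivef (f s)) ->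
  (forall t, additivef (g^~ t)) -> (forall s, additivef (g s)) ->
  (forall r m q n, f (ext_pure r m) (ext_pure q n)
                   = g (ext_pure r m) (ext_pure q n)) ->
  forall s t, f s t = g s t.
Proof.
move=> fl fr gl gr fg s t; apply: (ext_ext (fl t) (gl t)) => r m.
by apply: (ext_ext (fr _) (gr _)) => q n; apply: fg.
Qed.

Lemma et_balanced : bm_balanced (M := eM) (U := eN) (V := ext_mod MN) et_bil.
Proof.
split=> [s s' t|s t t'|s x t].
- exact: et_bilDl.
- exact: et_bilDr.
apply: (et_ext2 (f := fun s t => et_bil (@ext_ract M s x) t)
  (g := fun s t => et_bil s (x *: t))) => [u|u|u|u|r m q n].
- by move=> y z; rewrite ext_ractDl et_bilDl.
- exact: et_bilDr.
- exact: et_bilDl.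
- by move=> y z; rewrite scalerDr et_bilDr.
rewrite ext_ractE ext_scaleE (additivef_sum _ _ (et_bilDl _)).
rewrite (additivef_sum _ _ (et_bilDr _)); apply: eq_bigr => g _.
by rewrite !et_bilE bmtA mulrAC mulrA [r * _]mulrC mulrAC.
Qed.

Definition et_fun : bm_tensor eM eN -> ext_mod MN :=
  bm_lift (M := eM) (U := eN) (V := ext_mod MN) et_bil.

Lemma et_funD : additivef et_fun.
Proof. exact/bm_lift_additivef/et_balanced. Qed.

Lemma et_funE (s : eM) (t : eN) : et_fun (bmt s t) = et_bil s t.
Proof. exact/bm_liftE/et_balanced. Qed.

Lemma et_ext (V : zmodType) (f g : bm_tensor eM eN -> V) :
  additivef f -> additivef g ->
  (forall r m q n, f (bmt (ext_pure r m : eM) (ext_pure q n : eN))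
                   = g (bmt (ext_pure r m : eM) (ext_pure q n : eN))) ->
  f =1 g.
Proof.
move=> fD gD fg; apply: bmt_ext => // s t.
apply: (et_ext2 (f := fun s t => f (bmt (s : eM) (t : eN)))
  (g := fun s t => g (bmt (s : eM) (t : eN)))) => // u x y;
  by rewrite ?bmtDl ?bmtDr ?fD ?gD.
Qed.

Lemma et_funZ (x : B1) t : et_fun (x *: t) = x *: et_fun t.
Proof.
apply: (et_ext (f := fun t => et_fun (x *: t)) (g := fun t => x *: et_fun t)).
- by move=> y z; rewrite scalerDr et_funD.
- by move=> y z; rewrite et_funD scalerDr.
move=> r m q n; rewrite bmtZ !et_funE et_bilE !ext_scaleE.
rewrite (additivef_sum _ _ (et_bilDl _)); apply: eq_bigr => g _.
by rewrite et_bilE bmtZ mulrA.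
Qed.

Lemma et_fun_ract t (x : B1) :
  et_fun (bm_ract (t : bimod_tensor eM eN) x) = @ext_ract MN (et_fun t) x.
Proof.
apply: (et_ext (f := fun t => et_fun (bm_ract (t : bimod_tensor eM eN) x))
  (g := fun t => @ext_ract MN (et_fun t) x)).
- by move=> y z; rewrite ractDl et_funD.
- by move=> y z; rewrite et_funD ext_ractDl.
move=> r m q n; rewrite /= bmt_ractE !et_funE et_bilE /= !ext_ractE.
rewrite (additivef_sum _ _ (et_bilDr _)); apply: eq_bigr => g _.
by rewrite et_bilE /= bmt_ractE mulrCA.
Qed.

Definition te_in (r : R1) : MN -> bm_tensor eM eN :=
  bm_lift (fun m n => bmt (ext_pure r m : eM) (ext_pure 1 n : eN)).

Lemma te_in_balanced r : bm_balanced
  (fun (m : M) (n : N) => bmt (ext_pure r m : eM) (ext_pure 1 n : eN)).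
Proof.
split=> [m m' n|m n n'|m a n].
- by rewrite ext_pureDr bmtDl.
- by rewrite ext_pureDr bmtDr.
- by rewrite -ext_elt_ract -ext_elt_scale -bmtA.
Qed.

Lemma te_inD r : additivef (te_in r).
Proof. exact/bm_lift_additivef/te_in_balanced. Qed.

Lemma te_inE r m n :
  te_in r (bmt m n) = bmt (ext_pure r m : eM) (ext_pure 1 n : eN).
Proof. exact/bm_liftE/te_in_balanced. Qed.

Lemma te_balanced : ext_balanced (M := MN) te_in.
Proof.
split=> [r s y|r y z|r c y].
- apply: (bmt_ext (f := te_in (r + s)) (g := fun y => te_in r y + te_in s y)).
  + exact: te_inD.
  + by move=> u v; rewrite !te_inD addrACA.
  + by move=> m n; rewrite !te_inE ext_pureDl bmtDl.
- exact: te_inD.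
- apply: (bmt_ext (f := te_in (r * iota c))
    (g := fun y => te_in r (ualg_str B0 c *: (y : MN)))).
  + exact: te_inD.
  + by move=> u v; rewrite scalerDr te_inD.
  + by move=> m n; rewrite bmtZ !te_inE ext_pureA.
Qed.

Definition te_fun : ext_mod MN -> bm_tensor eM eN := ext_lift te_in.

Lemma te_funD : additivef te_fun.
Proof. exact/ext_lift_additivef/te_balanced. Qed.

Lemma te_funE r m n : te_fun (ext_pure r (bmt m n : MN))
  = bmt (ext_pure r m : eM) (ext_pure 1 n : eN).
Proof. by rewrite /te_fun ext_liftE ?te_inE //; apply: te_balanced. Qed.

Lemma et_funK : cancel et_fun te_fun.
Proof.
apply: (et_ext (f := fun t => te_fun (et_fun t))) => // [|r m q n].
  exact: additivef_comp te_funD et_funD.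
rewrite et_funE et_bilE te_funE.
have -> : ext_pure q n = ualg_str B1 q *: (ext_pure 1 n : ext_mod N).
  by rewrite ext_strE mulr1.
by rewrite -bmtA -bm_central ext_strE mulrC.
Qed.

Lemma te_funK : cancel te_fun et_fun.
Proof.
move=> t; apply: (ext_ext (f := fun t => et_fun (te_fun t)) (g := id)) => //.
  exact: additivef_comp et_funD te_funD.
move=> r y.
apply: (bmt_ext (f := fun y => et_fun (te_fun (ext_pure r (y : MN))))
  (g := fun y => ext_pure r (y : MN))) => [||m n].
- by move=> u v; rewrite ext_pureDr te_funD et_funD.
- by move=> u v; rewrite ext_pureDr.
- by rewrite te_funE et_funE et_bilE mulr1.
Qed.

Lemma bimod_ext_tensor :
  bimod_iso (bimod_tensor eM eN) (bimod_ext MN).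
Proof.
exists (lin_of et_funD et_funZ); split; last exact: et_fun_ract.
by exists te_fun; [apply: et_funK | apply: te_funK].
Qed.
End ExtTensor.

Lemma morita_ext (M : bimod B0 B0) : morita M -> morita (bimod_ext M).
Proof.
move=> /moritaP[N [h1 h2]]; apply/moritaP; exists (bimod_ext N); split.
  apply: bimod_iso_trans (bimod_ext_tensor _ _) _.
  exact: bimod_iso_trans (bimod_ext_iso h1) bimod_ext_regular.
apply: bimod_iso_trans (bimod_ext_tensor _ _) _.
exact: bimod_iso_trans (bimod_ext_iso h2) bimod_ext_regular.
Qed.

Definition pic_ext_mem (P : Pic B0) (N : bimod B1 B1) : Prop :=
  exists M, P M /\ bimod_iso (bimod_ext M) N.

Lemma pic_ext_subproof (P : Pic B0) :
  exists N, morita N /\ pic_ext_mem P = bimod_iso N.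
Proof.
have [M [hM ->]] := pic_surj P; exists (bimod_ext M).
split; first exact: morita_ext.
apply/funext => N; apply/propext; split=> [[M' [MM' M'N]]|MN].
  exact: bimod_iso_trans (bimod_ext_iso MM') M'N.
by exists M; split=> //; apply: bimod_iso_refl.
Qed.

Definition pic_ext_fun (P : Pic B0) : Pic B1 := PicClass (pic_ext_subproof P).

Lemma pic_ext_funE (M : bimod B0 B0) (hM : morita M) :
  pic_ext_fun (pic_of hM) = pic_of (morita_ext hM).
Proof.
apply: pic_ext => N; split=> [[M' [MM' M'N]]|MN].
  exact: bimod_iso_trans (bimod_ext_iso MM') M'N.
by exists M; split=> //; apply: bimod_iso_refl.
Qed.

Lemma pic_ext_funM (P Q : Pic B0) :
  pic_ext_fun (gmul P Q) = gmul (pic_ext_fun P) (pic_ext_fun Q).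
Proof.
have [M [hM ->]] := pic_surj P; have [N [hN ->]] := pic_surj Q.
rewrite /= pic_mulE !pic_ext_funE pic_mulE; apply/pic_of_eq.
exact: bimod_iso_sym (bimod_ext_tensor M N).
Qed.

(* The class of M is sent to that of R1 ⊗_{R0} M. *)
Definition pic_scalars : ghom (Pic B0) (Pic B1) := Ghom pic_ext_funM.
End Extension.

Section Hypotheses.
Variable O : comNzRingType.

Definition is_ideal (I : set O) : Prop :=
  [/\ I 0, forall x y, I x -> I y -> I (x + y) & forall a x, I x -> I (a * x)].

Definition principal_ideal_ring : Prop :=
  forall I, is_ideal I -> exists a, I = [set x | exists y, x = y * a]%classic.

Definition maximal_ideal (m : set O) : Prop :=
  [/\ is_ideal m, ~ m 1 &
      forall J, is_ideal J -> ~ J 1 -> (m `<=` J)%classic -> J = m].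

Definition local_ring (m : set O) : Prop :=
  maximal_ideal m /\ forall m', maximal_ideal m' -> m' = m.

Definition ideal_mul (I J : set O) : set O :=
  [set x | exists s : seq (O * O),
     (forall z, z \in s -> I z.1 /\ J z.2) /\ x = \sum_(z <- s) z.1 * z.2]%classic.

Definition ideal_exp (I : set O) (n : nat) : set O := iter n (ideal_mul I) [set: O]%classic.

(* The canonical map from O to the inverse limit of the O/m^n is bijective. *)
Definition complete_ring (m : set O) : Prop :=
  forall u : nat -> O, (forall n, ideal_exp m n (u n.+1 - u n)) ->
    exists! l, forall n, ideal_exp m n (l - u n).
End Hypotheses.

Definition residue_field (O : comNzRingType) (m : set O) (k : fieldType)
    (res : {rmorphism O -> k}) : Prop :=
  (forall z, exists x, res x = z) /\ forall x, res x = 0 <-> m x.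

Definition algebraic_closure_Fp (p : nat) (k : fieldType) : Prop :=
  GRing.closed_field_axiom k /\
  exists iota : {rmorphism 'F_p -> k}, forall x, algebraicOver iota x.

Section PadicSubrings.
Variables (p : nat) (O : idomainType).

(* The image of the ring of p-adic integers in O: u represents an element of
   the inverse limit of the Z/p^n, and x is the limit of u. *)
Definition padic_integer : set O :=
  [set x | exists u : nat -> int,
     (forall n, (u n.+1 = u n %[mod p%:Z ^+ n])%Z) /\
     forall n, exists y, x - (u n)%:~R = p%:R ^+ n * y]%classic.

Definition padic_number : set {fraction O} :=
  [set z | exists x y : O,
     [/\ padic_integer x, padic_integer y, y != 0 & z = tofrac x / tofrac y]]%classic.

(* The valuation of the field of fractions of O has O as its valuation ring, so
   the valuation ring of a subfield K0 is the intersection of K0 and O. *)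
Definition is_padic_subring (S : {pred O}) : Prop :=
  exists K0 : {pred {fraction O}},
    [/\ GRing.divring_closed K0,
        forall z, padic_number z -> z \in K0,
        exists e : seq {fraction O}, {subset e <= K0} /\
          forall z, z \in K0 -> exists c : nat -> {fraction O},
            (forall i, padic_number (c i)) /\
            z = \sum_(i < size e) c i * e`_i &
        forall x, (x \in S) = (tofrac x \in K0)].

Record padic_subring := PadicSubring {
  ps_pred :> {pred O};
  ps_padic : is_padic_subring ps_pred
}.

Section Subring.
Variable S : padic_subring.

Lemma ps_subring_closed : GRing.subring_closed (ps_pred S).
Proof.
have [K0 [/GRing.divring_closedBM[K1 KB KM] _ _ SE]] := ps_padic S.
split=> [|x y|x y]; rewrite !SE ?rmorph1 // ?rmorphB ?rmorphM.
- exact: KB.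
- exact: KM.
Qed.

HB.instance Definition _ :=
  GRing.isSubringClosed.Build O (ps_pred S) ps_subring_closed.

Record ps_sort := PsElt { ps_val : O; ps_valP : ps_val \in ps_pred S }.

HB.instance Definition _ := [isSub for ps_val].
HB.instance Definition _ := [Choice of ps_sort by <:].
HB.instance Definition _ := [SubChoice_isSubComNzRing of ps_sort by <:].
HB.instance Definition _ := GRing.RMorphism.copy ps_val (val : ps_sort -> O).
End Subring.

Section Inclusion.
Variables (S T : padic_subring) (ST : {subset S <= T}).

Definition ps_incl (x : ps_sort S) : ps_sort T := PsElt (ST (ps_valP x)).

Lemma ps_incl_zmod : zmod_morphism ps_incl.
Proof.
move=> x y; apply: val_inj.
change (ps_val (x - y) = ps_val (ps_incl x - ps_incl y)).
by rewrite !rmorphB.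
Qed.

Lemma ps_incl_monoid : monoid_morphism ps_incl.
Proof.
split=> [|x y]; apply: val_inj.
  change (ps_val (1 : ps_sort S) = ps_val (1 : ps_sort T)).
  by rewrite !rmorph1.
change (ps_val (x * y) = ps_val (ps_incl x * ps_incl y)).
by rewrite !rmorphM.
Qed.

HB.instance Definition _ :=
  GRing.isZmodMorphism.Build (ps_sort S) (ps_sort T) ps_incl ps_incl_zmod.
HB.instance Definition _ :=
  GRing.isMonoidMorphism.Build (ps_sort S) (ps_sort T) ps_incl ps_incl_monoid.
End Inclusion.
End PadicSubrings.

Section Stages.
Variables (p : nat) (O : idomainType) (gT : finGroupType).
Variables (b : grpalg O gT) (hb : central_idempotent b).

Definition defined_over (S : padic_subring p O) : Prop := forall g, b g \in S.

Section Restriction.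
Variables (S : padic_subring p O) (hS : defined_over S).

(* b as an element of S[gT] *)
Definition restrict : grpalg (ps_sort S) gT := [ffun g => PsElt (hS g)].

Lemma restrictE : grpalg_map (@ps_val p O S) restrict = b.
Proof. by apply/ffunP => g; rewrite !ffunE. Qed.

Lemma grpalg_map_ps_inj :
  injective (@grpalg_map (ps_sort S) O (@ps_val p O S) gT).
Proof.
move=> x y /ffunP xy; apply/ffunP => g; apply: val_inj.
by have := xy g; rewrite !ffunE.
Qed.

Lemma restrict_idem : central_idempotent restrict.
Proof.
split=> [|x]; apply: grpalg_map_ps_inj; rewrite !grpalg_mapM !restrictE.
  exact: (proj1 hb).
exact: (proj2 hb).
Qed.
End Restriction.

Lemma restrict_incl (S T : padic_subring p O) (hS : defined_over S)
    (hT : defined_over T) (ST : {subset S <= T}) :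
  grpalg_map (ps_incl ST) (restrict hS) = restrict hT.
Proof. by apply/ffunP => g; rewrite !ffunE; apply: val_inj. Qed.

(* The index category of the colimit: p-adic subrings S with b in S[gT],
   ordered by inclusion. *)
Record stage := Stage {
  stage_ring :> padic_subring p O;
  stage_def : defined_over stage_ring
}.

Definition stage_le (i j : stage) : Prop := {subset i <= j}.

Definition stage_block (i : stage) : ualg (ps_sort i) :=
  block (restrict_idem (stage_def i)).

(* O ⊗_S M *)
Definition stage_ext (i : stage) (M : bimod (stage_block i) (stage_block i)) :
    bimod (block hb) (block hb) :=
  bimod_ext hb (restrictE (stage_def i)) M.

Definition stage_map (i j : stage) (ij : stage_le i j) :
    ghom (Pic (stage_block i)) (Pic (stage_block j)) :=
  pic_scalars (restrict_idem (stage_def i)) (restrict_idem (stage_def j))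
    (restrict_incl (stage_def i) (stage_def j) ij).

Definition stage_colim_map (i : stage) :
    ghom (Pic (stage_block i)) (Pic (block hb)) :=
  pic_scalars (restrict_idem (stage_def i)) hb (restrictE (stage_def i)).
End Stages.

(* Main.v *)
(* A bimodule M inducing a Morita equivalence on B = OGb is finitely generated
   projective as a left module, so it is the left module of row vectors v over
   OG with v rho(1) = v, for a map rho from G to a matrix ring E over OG which is
   multiplicative but not unital; g acts on the right by rho(g). Everything then
   takes place in the p-adically complete ring E, in which |G| divides a power
   p^s of p up to a unit. Averaging over G shows that two such maps that agree
   modulo p^(s+1) define isomorphic bimodules, and Newton's method shows that a
   map which is multiplicative modulo p^(2s+1) is close to a multiplicative one;
   in both cases, solutions have coefficients in any p-adic subring that contains
   the coefficients of the data.

   The elements of O that lie in some p-adic subring are dense: this follows from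
   Hensel's lemma, applied to X^r - 1 to lift the elements of k and to an
   approximation of a polynomial of minimal size that vanishes at a uniformizer.
   Hence M and its inverse descend to bimodules over a common p-adic subring,
   isomorphisms over O descend after an enlargement of that subring, and the
   descended bimodules are mutually inverse over some p-adic subring.

   Over a p-adic subring, the residue rings modulo p^n are finite. The left
   ideals g(N, m) of the Morita pairing g give a bound on the number of generators
   of an invertible bimodule, independent of the bimodule, so that there are only
   finitely many matrix-valued maps modulo p^(s+1) and the Picard group is
   finite. *)
From HB Require Import structures.
Require Import Defs.
From mathcomp Require Import all_boot all_order all_fingroup all_algebra.
From mathcomp Require Import boolp classical_sets zify ring.

Set Implicit Arguments.
Unset Strict Implicit.
Unset Printing Implicit Defensive.

Import GRing.Theory.
Local Open Scope ring_scope.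

(** The residue field is infinite and a representation over O need not have its coefficients in any
    p-adic subring, so only finitely many coefficients modulo a fixed power of p can be descended.
    This forces rigidity statements with explicit precision. Dividing by |G| costs p^s: an average
    known modulo p^(s+1) leaves a congruence modulo p, just enough for a Neumann series. A defect of
    order c is corrected by a term of order c - s, whose square has order 2c - 2s, and this exceeds
    c exactly when c > 2s. The subring enters as a predicate S on the single complete ring E; purity
    and closedness of S keep quotients by |G| and limits inside it. The maps are not unital because
    a projective module is only cut out of a free one by an idempotent; in return, padding by zeros
    gives two modules the same matrix size, and an isomorphism becomes a pair (P, Q) whose products
    are the two idempotents. Invertibility does not descend along with a bimodule: M and its inverse
    first descend as projective bimodules only, and the two isomorphisms with the regular bimodule
    are then recovered over larger subrings, one after the other. *)

(** * Reflection for abelian groups and p-adic approximation in rings *)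

(* A reflexive decision procedure for equations in abelian groups; the tactic
   [ring] needs commutative rings. *)
Inductive zexpr :=
  | ZZero | ZVar of nat | ZOpp of zexpr | ZAdd of zexpr & zexpr
  | ZMuln of zexpr & nat.

Fixpoint zeval (V : zmodType) (env : seq V) t : V :=
  match t with
  | ZZero => 0
  | ZVar i => nth 0 env i
  | ZOpp t => - zeval env t
  | ZAdd t u => zeval env t + zeval env u
  | ZMuln t n => zeval env t *+ n
  end.

Fixpoint zcoef t (i : nat) : int :=
  match t with
  | ZZero => 0
  | ZVar j => (i == j)%:Z
  | ZOpp t => - zcoef t i
  | ZAdd t u => zcoef t i + zcoef u i
  | ZMuln t n => zcoef t i *+ n
  end.

Lemma zevalE (V : zmodType) (env : seq V) t :
  zeval env t = \sum_(i < size env) nth 0 env i *~ zcoef t i.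
Proof.
elim: t => [|j|t IHt|t IHt u IHu|t IHt n] /=.
- by rewrite big1.
- have [jn|jn] := ltnP j (size env); last first.
    rewrite nth_default // big1 // => i _; rewrite (_ : (i == j :> nat) = false) //.
    by apply/negbTE; rewrite neq_ltn (leq_trans (ltn_ord i) jn).
  rewrite (bigD1 (Ordinal jn)) //= eqxx big1 ?addr0 // => i /negbTE ij.
  by rewrite (_ : (i == j :> nat) = false).
- by rewrite IHt -sumrN; apply: eq_bigr => i _; rewrite mulrNz.
- by rewrite IHt IHu -big_split; apply: eq_bigr => i _; rewrite mulrzDr.
- rewrite IHt -sumrMnl; apply: eq_bigr => i _.
  by rewrite pmulrn -mulrzA -[in RHS]mulr_natr natz.
Qed.

(** Only the integer coefficients of the atoms are compared, by computation, so [abel] closes its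
    goal with [isT]. *)
Lemma zeval_eq (V : zmodType) (env : seq V) t u :
  all (fun i => zcoef t i == zcoef u i) (iota 0 (size env)) ->
  zeval env t = zeval env u.
Proof.
move=> /allP tu; rewrite !zevalE; apply: eq_bigr => i _.
by rewrite (eqP (tu _ _)) // mem_iota /=.
Qed.

Ltac zindex x env := lazymatch env with
  | ?y :: ?env' => match constr:(tt) with
    | _ => let _ := match constr:(tt) with _ => unify x y end in constr:(0%N)
    | _ => let n := zindex x env' in constr:(n.+1)
    end
  | _ => fail
  end.
Ltac zmem x env := match env with
  | _ => let n := zindex x env in env
  | _ => constr:(x :: env)
  end.
Ltac zatoms t env := lazymatch t with
  | Algebra.zero => env
  | Algebra.opp ?u => zatoms u env
  | Algebra.add ?u ?v => let env' := zatoms u env in zatoms v env'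
  | Algebra.natmul ?u (S _) => zatoms u env
  | _ => zmem t env
  end.
Ltac zreify t env := lazymatch t with
  | Algebra.zero => constr:(ZZero)
  | Algebra.opp ?u => let u' := zreify u env in constr:(ZOpp u')
  | Algebra.add ?u ?v =>
      let u' := zreify u env in let v' := zreify v env in constr:(ZAdd u' v')
  | Algebra.natmul ?u (S ?n) => let u' := zreify u env in constr:(ZMuln u' n.+1)
  | _ => let n := zindex t env in constr:(ZVar n)
  end.
Ltac abel := lazymatch goal with |- @eq ?T ?a ?b =>
  let env0 := zatoms a (@nil T) in let env := zatoms b env0 in
  let t := zreify a env in let u := zreify b env in
  exact: (@zeval_eq _ env t u isT)
  end.

(** * Divisibility by powers of p, closed subrings and limits *)

Section PadicTopology.
Variables (p : nat) (E : pzRingType).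
Implicit Types (x y z : E) (a c n : nat).

Definition pmult a x := exists y, x = y *+ p ^ a.

Lemma pmult0 a : pmult a 0.
Proof. by exists 0; rewrite mul0rn. Qed.

Lemma pmult_0 x : pmult 0 x.
Proof. by exists x; rewrite expn0 mulr1n. Qed.

Lemma pmultD a x y : pmult a x -> pmult a y -> pmult a (x + y).
Proof. by move=> [x' ->] [y' ->]; exists (x' + y'); rewrite mulrnDl. Qed.

Lemma pmultN a x : pmult a x -> pmult a (- x).
Proof. by move=> [x' ->]; exists (- x'); rewrite mulNrn. Qed.

Lemma pmultB a x y : pmult a x -> pmult a y -> pmult a (x - y).
Proof. by move=> hx /pmultN; apply: pmultD. Qed.

Lemma pmultBC a x y : pmult a (x - y) -> pmult a (y - x).
Proof. by move=> /pmultN; rewrite opprB. Qed.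

Lemma pmult_trans a y x z : pmult a (x - y) -> pmult a (y - z) -> pmult a (x - z).
Proof. by move=> h /(pmultD h); rewrite addrA subrK. Qed.

Lemma pmult_addr a y x : pmult a (x - y) -> pmult a y -> pmult a x.
Proof. by move=> h /(pmultD h); rewrite subrK. Qed.

Lemma pmult_le c a x : (a <= c)%N -> pmult c x -> pmult a x.
Proof.
move=> ac [y ->]; exists (y *+ p ^ (c - a)).
by rewrite -mulrnA -expnD subnK.
Qed.

Lemma pmultM a c x y : pmult a x -> pmult c y -> pmult (a + c) (x * y).
Proof.
move=> [x' ->] [y' ->]; exists (x' * y').
by rewrite mulrnAl mulrnAr -mulrnA expnD mulnC.
Qed.

Lemma pmultMl a x y : pmult a y -> pmult a (x * y).
Proof. by move=> /(pmultM (pmult_0 x)). Qed.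

Lemma pmultMr a x y : pmult a x -> pmult a (x * y).
Proof. by move=> /pmultM/(_ (pmult_0 y)); rewrite addn0. Qed.

Lemma pmultMn a x n : pmult a x -> pmult a (x *+ n).
Proof. by move=> [y ->]; exists (y *+ n); rewrite -!mulrnA mulnC. Qed.

Lemma pmult_sum a (I : Type) (s : seq I) (F : I -> E) :
  (forall i, pmult a (F i)) -> pmult a (\sum_(i <- s) F i).
Proof.
by move=> hF; elim/big_rec: _ => [|i x _]; [apply: pmult0 | apply: pmultD].
Qed.

Definition padically_separated := forall x, (forall n, pmult n x) -> x = 0.

Definition padically_complete :=
  forall u : nat -> E, (forall n, pmult n (u n.+1 - u n)) ->
    exists l, forall n, pmult n (l - u n).

Definition torsion_free := forall n x, (0 < n)%N -> x *+ n = 0 -> x = 0.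

Lemma torsion_free_inj n x y : torsion_free -> (0 < n)%N -> x *+ n = y *+ n -> x = y.
Proof.
move=> tf n0 xy; apply/eqP; rewrite -subr_eq0; apply/eqP/(tf _ _ n0).
by rewrite mulrnBl xy subrr.
Qed.

(** Purity keeps a quotient by |gT| inside S, and closedness keeps limits inside S. The intended S
    consists of the matrices over the group algebra whose coefficients lie in a p-adic subring. *)
Record closed_subring (S : E -> Prop) : Prop := ClosedSubring {
  csub1 : S 1;
  csubB : forall x y, S x -> S y -> S (x - y);
  csubM : forall x y, S x -> S y -> S (x * y);
  csub_pure : forall n x, (0 < n)%N -> S (x *+ n) -> S x;
  csub_lim : forall x, (forall n, exists y, S y /\ pmult n (x - y)) -> S x
}.

Section ClosedSubring.
Variables (S : E -> Prop) (hS : closed_subring S).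

Lemma csub0 : S 0.
Proof. by rewrite -(subrr 1); apply: csubB => //; apply: csub1. Qed.
Lemma csubN x : S x -> S (- x).
Proof. by move=> Sx; rewrite -sub0r; apply: csubB => //; apply: csub0. Qed.
Lemma csubD x y : S x -> S y -> S (x + y).
Proof. by move=> Sx Sy; rewrite -[y]opprK; apply: csubB => //; apply: csubN. Qed.
Lemma csubMn x n : S x -> S (x *+ n).
Proof.
move=> Sx; elim: n => [|n IHn]; first by rewrite mulr0n; apply: csub0.
by rewrite mulrS; apply: csubD.
Qed.
Lemma csub_sum (I : Type) (s : seq I) (F : I -> E) :
  (forall i, S (F i)) -> S (\sum_(i <- s) F i).
Proof.
by move=> hF; elim/big_rec: _ => [|i x _]; [apply: csub0 | apply: csubD].
Qed.
Lemma csubX x n : S x -> S (x ^+ n).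
Proof.
move=> Sx; elim: n => [|n IHn]; first by rewrite expr0; apply: csub1.
by rewrite exprS; apply: csubM.
Qed.
End ClosedSubring.

Lemma closed_subringT : closed_subring (fun=> True).
Proof. by []. Qed.

Hypothesis E_complete : padically_complete.
Hypothesis E_sep : padically_separated.

Lemma pmult_eq x y : (forall n, pmult n (x - y)) -> x = y.
Proof. by move=> h; apply/eqP; rewrite -subr_eq0; apply/eqP/E_sep. Qed.

Lemma pmult_cauchy (u : nat -> E) : (forall n, pmult n (u n.+1 - u n)) ->
  forall n k, (n <= k)%N -> pmult n (u k - u n).
Proof.
move=> hu n k; elim: k => [|k IHk]; first by rewrite leqn0 => /eqP ->; rewrite subrr; apply: pmult0.
rewrite leq_eqVlt => /orP[/eqP ->|]; first by rewrite subrr; apply: pmult0.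
rewrite ltnS => nk; apply: pmult_trans (IHk nk).
exact: pmult_le (hu k).
Qed.

(** Common form of Newton iterations and digit expansions: a whole family indexed by I converges at
    once. [Inv] need not survive the limit, so the conclusion keeps an approximant satisfying it at
    every level. *)
Lemma approximation_limit (I : Type) (Inv : nat -> (I -> E) -> Prop) (f0 : I -> E) :
  Inv 0%N f0 ->
  (forall k f, Inv k f ->
     exists f', Inv k.+1 f' /\ forall i, pmult k (f' i - f i)) ->
  exists l : I -> E, forall k, exists f, Inv k f /\ forall i, pmult k (l i - f i).
Proof.
move=> h0 step.
(* Choice needs a successor for every pair; f itself is the default where [Inv] fails. *)
have /choice[F hF] : forall kf : nat * (I -> E), exists f',
    Inv kf.1 kf.2 -> Inv kf.1.+1 f' /\ forall i, pmult kf.1 (f' i - kf.2 i).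
  move=> [k f] /=; have [/step[f' hf']|nf] := pselect (Inv k f); first by exists f'.
  by exists f.
pose fix u n := if n is n'.+1 then F (n', u n') else f0.
have uI n : Inv n (u n) by elim: n => //= n IHn; have [] := hF (n, u n) IHn.
have uC n i : pmult n (u n.+1 i - u n i) by have [_] := hF (n, u n) (uI n); apply.
have /choice[l hl] i : exists l, forall n, pmult n (l - u n i).
  exact: E_complete.
by exists l => k; exists (u k); split.
Qed.

(** Neumann series; its partial sums invert 1 - x on both sides up to x^n, so noncommutativity does
    no harm. *)
Lemma geometric_inverse S x : closed_subring S -> S x -> pmult 1 x ->
  exists l, [/\ S l, l * (1 - x) = 1, (1 - x) * l = 1 & pmult 1 (l - 1)].
Proof.
move=> hS Sx px.
have pX n : pmult n (x ^+ n).
  elim: n => [|n IHn]; first exact: pmult_0.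
  by rewrite exprS -add1n; apply: pmultM.
pose u n := \sum_(i < n) x ^+ i.
have uS n : S (u n) by apply: (csub_sum hS) => i; apply: (csubX hS).
have [l hl] : exists l, forall n, pmult n (l - u n).
  by apply: E_complete => n; rewrite /u big_ord_recr /= addrAC subrr add0r.
have ux n : u n * (1 - x) = 1 - x ^+ n.
  rewrite /u; elim: n => [|n IHn]; first by rewrite big_ord0 mul0r expr0 subrr.
  by rewrite big_ord_recr /= mulrDl IHn exprSr mulrBr mulr1; abel.
have xu n : (1 - x) * u n = 1 - x ^+ n.
  rewrite -ux /u mulr_sumr mulr_suml; apply: eq_bigr => i _.
  by rewrite mulrBl mulrBr mul1r mulr1 -exprS -exprSr.
exists l; split.
- by apply: (csub_lim hS) => n; exists (u n); split.
- apply: pmult_eq => n.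
  apply: (@pmult_trans _ (u n * (1 - x))); first by rewrite -mulrBl; apply: pmultMr.
  by rewrite ux addrAC subrr add0r; apply: pmultN.
- apply: pmult_eq => n.
  apply: (@pmult_trans _ ((1 - x) * u n)); first by rewrite -mulrBr; apply: pmultMl.
  by rewrite xu addrAC subrr add0r; apply: pmultN.
- by have := hl 1%N; rewrite /u big_ord1 expr0.
Qed.

Lemma idempotent_pmult_eq0 x : x * x = x -> pmult 1 x -> x = 0.
Proof.
move=> xx px; apply: E_sep; elim=> [|n IHn]; first exact: pmult_0.
by rewrite -xx -add1n; apply: pmultM.
Qed.

(** Commuting idempotents satisfy (x - y)^3 = x - y, so divisibility by p improves itself
    indefinitely. *)
Lemma idempotent_pmult_eq x y : x * x = x -> y * y = y -> x * y = y * x ->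
  pmult 1 (x - y) -> x = y.
Proof.
move=> xx yy xy pxy; apply/eqP; rewrite -subr_eq0; apply/eqP.
have key : (x - y) * (x - y) * (x - y) = x - y.
  have xxy : x * (x * y) = x * y by rewrite mulrA xx.
  have yxy : y * (x * y) = x * y by rewrite mulrA -xy -mulrA yy.
  rewrite !(mulrBl, mulrBr) -!mulrA -!xy !xx !yy -!xy !xxy !yxy.
  by abel.
have : forall n, pmult n (x - y).
  elim=> [|n IHn]; first exact: pmult_0.
  by rewrite -key -[n.+1]addn1; apply: pmultM pxy; apply: pmultMr.
exact: E_sep.
Qed.

(** Newton's method for X^2 - X: y becomes y + d w = 3y^2 - 2y^3, where d = y^2 - y and w = 1 - 2y.
    As w^2 = 1 + 4d, w is its own inverse to first order, and the new defect is d^2 (w^2 - 4). *)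
Lemma idempotent_lift S a x : closed_subring S -> (0 < a)%N -> S x ->
  pmult a (x * x - x) -> exists e, [/\ S e, e * e = e & pmult a (e - x)].
Proof.
move=> hS a0 Sx px.
pose Inv k (f : unit -> E) := [/\ S (f tt), pmult (a + k) (f tt * f tt - f tt)
  & pmult a (f tt - x)].
have [] := @approximation_limit unit Inv (fun=> x).
- by split; rewrite ?addn0 ?subrr //; apply: pmult0.
- move=> k f [Sf]; set y := f tt in Sf *.
  have [d dE] : exists d, d = y * y - y by eexists.
  have [w wE] : exists w, w = 1 - y *+ 2 by eexists.
  rewrite -dE => pd pyx.
  have yd : y * d = d * y by rewrite dE mulrBr mulrBl mulrA.
  have yw : y * w = w * y by rewrite wE mulrBr mulrBl mul1r mulr1 mulrnAr mulrnAl.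
  have wd : w * d = d * w.
    by rewrite wE mulrBr mulrBl mul1r mulr1 mulrnAr mulrnAl yd.
  have ww : w * w = 1 + d *+ 4.
    rewrite {1}wE mulrBl mul1r mulrnAl wE mulrBr mulr1 mulrnAr dE; abel.
  have dS : S d by rewrite dE; apply: (csubB hS) => //; apply: (csubM hS).
  have key : (y + d * w) * (y + d * w) - (y + d * w) = d * d * (w * w - 4%:R).
    have -> : (y + d * w) * (y + d * w) = y * y + d * (y *+ 2 * w) + d * d * (w * w).
      rewrite mulrDl !mulrDr -!addrA; congr (_ + _).
      rewrite !addrA -!mulrA; congr (_ + _).
        by rewrite mulrA yd -mulrA -mulrDr -yw mulrnAl mulr2n.
      by rewrite [w * (d * w)]mulrA wd -!mulrA.
    have -> : y *+ 2 = 1 - w by rewrite wE; abel.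
    rewrite mulrBl mul1r ww !mulrBr !mulrDr !mulr1.
    by rewrite (_ : y * y = y + d); [abel | rewrite dE; abel].
  exists (fun=> y + d * w); split; last first.
    move=> []; rewrite -/y addrAC subrr add0r; apply: pmultMr.
    exact: pmult_le (leq_addl _ _) pd.
  split=> /=.
  - apply: (csubD hS) => //; apply: (csubM hS) => //.
    by rewrite wE; apply: (csubB hS); [apply: csub1 hS | apply: csubMn hS _ _ _].
  (* Since a > 0, twice a + k is at least a + k + 1. *)
  - rewrite key; apply: pmultMr; apply: pmult_le (pmultM pd pd).
    by rewrite addnS -addn1 leq_add // ltn_addr.
  - rewrite addrAC; apply: pmultD => //; apply: pmultMr.
    exact: pmult_le (leq_addr _ _) pd.
move=> l hl; set e := l tt.
exists e; split.
- apply: (csub_lim hS) => n; have [f [[Sf _ _] hf]] := hl n.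
  by exists (f tt); split=> //; apply: hf.
- apply: pmult_eq => n; have [f [[_ pf _] hf]] := hl n.
  apply: (@pmult_trans _ (f tt * f tt)).
    apply: (@pmult_trans _ (f tt * e)); first by rewrite -mulrBl; apply/pmultMr/hf.
    by rewrite -mulrBr; apply/pmultMl/hf.
  apply: (@pmult_trans _ (f tt)); last by apply/pmultBC/hf.
  by apply: pmult_le pf; apply: leq_addl.
- have [f [[_ _ pf] hf]] := hl a; exact: pmult_trans (hf tt) pf.
Qed.

End PadicTopology.

(** * Rigidity and lifting of representations modulo powers of p *)

Section Representations.
Variables (p : nat) (E : pzRingType) (gT : finGroupType) (s : nat).
Hypothesis E_complete : padically_complete p E.
Hypothesis E_sep : padically_separated p E.
Hypothesis E_tf : torsion_free E.
(* |gT| divides p^s up to a unit. *)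
Hypothesis E_div : forall x : E, exists y, y *+ #|gT| = x *+ p ^ s.
Implicit Types (rho sigma : gT -> E) (S : E -> Prop).

Local Notation pmult := (@pmult p E).

(* rho need not be unital: rho 1 is an idempotent of E. *)
Definition is_rep rho : Prop :=
  forall g h, rho g * rho h = rho (g * h)%g.

(* P and Q are mutually inverse isomorphisms between the direct summands cut
   out by rho 1 and sigma 1. *)
Definition rep_equiv S rho sigma : Prop := exists P Q : E,
  [/\ S P, S Q, P * Q = rho 1%g, Q * P = sigma 1%g &
      forall g, rho g * P = P * sigma g].


Lemma card_gT : (0 < #|gT|)%N.
Proof. by rewrite -cardsT cardG_gt0. Qed.

(** Division by |gT| costs s factors of p; the quotient stays in S by purity. *)
Lemma divide_card S a x : closed_subring p S -> S x -> pmult (a + s) x ->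
  exists y, [/\ S y, y *+ #|gT| = x & pmult a y].
Proof.
move=> hS Sx [y xE]; have [z zE] := E_div y.
have E1 : (z *+ p ^ a) *+ #|gT| = x by rewrite mulrnAC zE xE -mulrnA mulnC -expnD.
exists (z *+ p ^ a); split=> //; last by exists z.
by apply: (csub_pure hS card_gT); rewrite E1.
Qed.

Section Multiplicative.
Variables (rho : gT -> E).
Hypothesis rhoM : is_rep rho.

Lemma rho1l g : rho 1%g * rho g = rho g. Proof. by rewrite rhoM mul1g. Qed.
Lemma rho1r g : rho g * rho 1%g = rho g. Proof. by rewrite rhoM mulg1. Qed.
Lemma rhoVr g : rho g * rho g^-1%g = rho 1%g. Proof. by rewrite rhoM mulgV. Qed.
End Multiplicative.

(** The average of A over gT intertwines exactly. It is known to be |gT| P modulo p^(s+1), so its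
    quotient by |gT| exists and is P modulo p. A lies in S while P need not: A may be a mere
    approximation of P. *)
Lemma average_intertwiner S rho sigma A P : closed_subring p S ->
  is_rep rho -> is_rep sigma ->
  (forall g, S (rho g)) -> (forall g, S (sigma g)) -> S A ->
  pmult s.+1 (\sum_h rho h * A * sigma h^-1%g - P *+ #|gT|) ->
  exists P', [/\ S P', forall g, rho g * P' = P' * sigma g, rho 1%g * P' = P',
    P' * sigma 1%g = P' & pmult 1 (P' - P)].
Proof.
move=> hS rM sM Sr Ss SA; set X := \sum_h _ => hX.
have SX : S X.
  by apply: (csub_sum hS) => h; apply: (csubM hS) => //; apply: (csubM hS).
(* The division takes place in all of E because P may lie outside S; purity puts P + y back into
   S. *)
have [y [_ yE py]] := divide_card (closed_subringT p E) I
  (pmult_le (leqnn _) (hX : pmult (1 + s) _)).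
pose P' := P + y.
have P'E : P' *+ #|gT| = X by rewrite mulrnDl yE addrC subrK.
have inter g : rho g * X = X * sigma g.
  rewrite mulr_sumr mulr_suml (reindex_inj (mulgI g^-1%g)) /=.
  apply: eq_bigr => h _.
  by rewrite invMg invgK !mulrA rM mulKVg -!mulrA sM.
have X1 : rho 1%g * X = X.
  by rewrite mulr_sumr; apply: eq_bigr => h _; rewrite !mulrA rho1l.
exists P'; split.
- by apply: (csub_pure hS card_gT); rewrite P'E.
- by move=> g; apply: (torsion_free_inj E_tf card_gT); rewrite -mulrnAr -mulrnAl P'E.
- by apply: (torsion_free_inj E_tf card_gT); rewrite -mulrnAr P'E.
- by apply: (torsion_free_inj E_tf card_gT); rewrite -mulrnAl P'E -inter.
- by rewrite /P' addrAC subrr add0r.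
Qed.

(** P Q = rho(1)(1 - x) with x divisible by p, so correcting Q by the Neumann inverse of 1 - x makes
    it an exact right inverse of P. *)
Lemma rep_equiv_approx S rho sigma P Q : closed_subring p S ->
  is_rep rho -> is_rep sigma -> S P -> S Q ->
  S (rho 1%g) -> S (sigma 1%g) ->
  (forall g, rho g * P = P * sigma g) -> (forall g, sigma g * Q = Q * rho g) ->
  pmult 1 (P * Q - rho 1%g) -> pmult 1 (Q * P - sigma 1%g) ->
  rho 1%g * P = P -> sigma 1%g * Q = Q -> rep_equiv S rho sigma.
Proof.
move=> hS rM sM SP SQ Sr Ss PE QE hPQ hQP rP sQ.
set x := rho 1%g - P * Q.
have Sx : S x by apply: (csubB hS) => //; apply: (csubM hS).
have [l [Sl lx xl pl]] := geometric_inverse E_complete E_sep hS Sx (pmultBC hPQ).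
have rx : rho 1%g * (1 - x) = P * Q.
  by rewrite mulrBr mulr1 /x mulrBr mulrA rP rho1l // opprB addrCA subrr addr0.
have P1 : P * sigma 1%g = P by rewrite -PE.
pose Q' := Q * l * rho 1%g.
have PQ' : P * Q' = rho 1%g.
  by rewrite /Q' !mulrA -rx -(mulrA (rho 1%g)) xl mulr1 rho1l.
have SQ' : S Q' by apply: (csubM hS) => //; apply: (csubM hS).
exists P, Q'; split=> //.
(* The failure of Q' to be a left inverse is an idempotent divisible by p, hence zero. *)
have ff : (sigma 1%g - Q' * P) * (sigma 1%g - Q' * P) = sigma 1%g - Q' * P.
  have sQ' : sigma 1%g * Q' = Q' by rewrite /Q' !mulrA sQ.
  rewrite mulrBr !mulrBl rho1l // mulrA sQ' -[Q' * P * sigma _]mulrA P1.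
  have -> : Q' * P * (Q' * P) = Q' * P.
    by rewrite mulrA -(mulrA Q') PQ' /Q' -!mulrA (mulrA (rho _)) rho1l.
  by abel.
apply/esym/subr0_eq; apply: (idempotent_pmult_eq0 E_sep ff).
apply: (@pmult_trans _ _ _ (Q * P)).
  exact: pmultBC.
rewrite /Q' -!mulrA rP -mulrBr -[P in P - _]mul1r -mulrBl.
exact/pmultMl/pmultMr/pmultBC.
Qed.

(** Used with A = B = 1 in [maranda], and with approximations in S of a given isomorphism in
    [rep_equiv_descend]. *)
Lemma rep_equiv_spread S rho sigma A P B Q : closed_subring p S ->
  is_rep rho -> is_rep sigma ->
  (forall g, S (rho g)) -> (forall g, S (sigma g)) -> S A -> S B ->
  pmult s.+1 (\sum_h rho h * A * sigma h^-1%g - P *+ #|gT|) ->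
  pmult s.+1 (\sum_h sigma h * B * rho h^-1%g - Q *+ #|gT|) ->
  pmult 1 (P * Q - rho 1%g) -> pmult 1 (Q * P - sigma 1%g) ->
  rep_equiv S rho sigma.
Proof.
move=> hS rM sM Sr Ss SA SB hA hB hPQ hQP.
have [P' [SP' P'E rP' _ hP']] := average_intertwiner hS rM sM Sr Ss SA hA.
have [Q' [SQ' Q'E sQ' _ hQ']] := average_intertwiner hS sM rM Ss Sr SB hB.
have cM x x' y y' : pmult 1 (x - x') -> pmult 1 (y - y') -> pmult 1 (x * y - x' * y').
  move=> hx hy; apply: (@pmult_trans _ _ _ (x' * y)).
    by rewrite -mulrBl; apply: pmultMr.
  by rewrite -mulrBr; apply: pmultMl.
by apply: (rep_equiv_approx (P := P') (Q := Q')) => //;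
  [apply: pmult_trans hPQ | apply: pmult_trans hQP]; apply: cM.
Qed.

(** The average of 1 is the sum of rho(h) sigma(h^-1), which is |gT| rho(1) modulo p^(s+1) because
    sigma may be replaced by rho. *)
Lemma maranda S rho sigma : closed_subring p S ->
  is_rep rho -> is_rep sigma ->
  (forall g, S (rho g)) -> (forall g, S (sigma g)) ->
  (forall g, pmult s.+1 (sigma g - rho g)) -> rep_equiv S rho sigma.
Proof.
move=> hS rM sM Sr Ss hrs.
have key r1 s1 : is_rep r1 -> (forall g, pmult s.+1 (s1 g - r1 g)) ->
    pmult s.+1 (\sum_h r1 h * 1 * s1 h^-1%g - r1 1%g *+ #|gT|).
  move=> r1M h1; rewrite -sumr_const -sumrB; apply: pmult_sum => h.
  by rewrite mulr1 -(rhoVr r1M h) -mulrBr; apply: pmultMl.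
have h1 g : pmult 1 (sigma g - rho g) by apply: pmult_le (hrs g).
apply: (rep_equiv_spread (A := 1) (B := 1) hS rM sM Sr Ss (csub1 hS) (csub1 hS)).
- exact: key.
- by apply: key => // g; apply: pmultBC.
- by rewrite -[X in _ - X](rho1l rM) -mulrBr; apply: pmultMl.
- rewrite -[X in _ - X](rho1l sM) -mulrBr; exact/pmultMl/pmultBC.
Qed.

Lemma intertwiner_inverse rho sigma P Q : is_rep rho -> is_rep sigma ->
  P * Q = rho 1%g -> Q * P = sigma 1%g -> (forall g, rho g * P = P * sigma g) ->
  forall g, sigma g * Q = Q * rho g.
Proof.
move=> rM sM PQ QP PE g.
by rewrite -(rho1l sM) -QP -!mulrA (mulrA P) -PE -!mulrA PQ rho1r.
Qed.

(** Averaging multiplies an exact intertwiner by |gT|, so averaging an approximation of it in S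
    gives an intertwiner over S congruent to it modulo p. *)
Lemma rep_equiv_descend S rho sigma P Q A B : closed_subring p S ->
  is_rep rho -> is_rep sigma ->
  (forall g, S (rho g)) -> (forall g, S (sigma g)) -> S A -> S B ->
  P * Q = rho 1%g -> Q * P = sigma 1%g -> (forall g, rho g * P = P * sigma g) ->
  pmult s.+1 (A - P) -> pmult s.+1 (B - Q) ->
  rep_equiv S rho sigma.
Proof.
move=> hS rM sM Sr Ss SA SB PQ QP PE hA hB.
have QE := intertwiner_inverse rM sM PQ QP PE.
have avg r1 s1 X : is_rep r1 -> is_rep s1 ->
    (forall g, r1 g * X = X * s1 g) ->
    \sum_h r1 h * X * s1 h^-1%g = X * s1 1%g *+ #|gT|.
  move=> r1M s1M XE; rewrite -sumr_const; apply: eq_bigr => h _.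
  by rewrite XE -mulrA rhoVr.
have diff r1 s1 X Y : pmult s.+1 (X - Y) ->
    pmult s.+1 (\sum_h (r1 : gT -> E) h * X * s1 h^-1%g - \sum_h r1 h * Y * s1 h^-1%g).
  move=> hXY; rewrite -sumrB; apply: pmult_sum => h.
  by rewrite -mulrBl -mulrBr; apply/pmultMr/pmultMl.
(* As sigma is not unital, the average of P is |gT| P sigma(1) rather than |gT| P. *)
apply: (rep_equiv_spread (P := P * sigma 1%g) (Q := Q * rho 1%g) hS rM sM Sr Ss SA SB).
- by rewrite -(avg rho sigma) //; apply: diff.
- by rewrite -(avg sigma rho) //; apply: diff.
- rewrite -PE -mulrA (mulrA P) PQ rho1l // rM mulg1 subrr; exact: pmult0.
- rewrite -QE -mulrA (mulrA Q) QP rho1l // sM mulg1 subrr; exact: pmult0.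
Qed.

(** * One Newton step towards multiplicativity *)

Section Newton.
Variables (S : E -> Prop) (r : gT -> E) (c : nat).
Hypotheses (hS : closed_subring p S) (rS : forall g, S (r g)).
Hypothesis r1l : forall g, r 1%g * r g = r g.
Hypothesis r1r : forall g, r g * r 1%g = r g.
Hypothesis cs : (2 * s < c)%N.

Local Definition defect g h := r g * r h - r (g * h)%g.
Local Notation d := defect.
Hypothesis small_defect : forall g h, pmult c (d g h).

(* The defect d is a 2-cocycle up to terms of second order, so that the average
   over k of d g k * r k^-1 splits it. *)
Lemma newton_step : exists r' : gT -> E,
  [/\ forall g, S (r' g), r' 1%g = r 1%g,
      forall g, r 1%g * r' g = r' g /\ r' g * r 1%g = r' g,
      forall g, pmult (c - s) (r' g - r g) &
      forall g h, pmult c.+1 (r' g * r' h - r' (g * h)%g)].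
Proof.
have sc : (s <= c)%N by lia.
have dS g h : S (d g h) by apply: (csubB hS) => //; apply: (csubM hS).
have dr g h : d g h * r 1%g = d g h by rewrite mulrBl -mulrA !r1r.
have dl g h : r 1%g * d g h = d g h by rewrite mulrBr mulrA !r1l.
have d1 g : d 1%g g = 0 by rewrite /d mul1g r1l subrr.
have /choice[m hm] g : exists m, [/\ S m, m *+ #|gT| = \sum_k d g k * r k^-1%g
    & pmult (c - s) m].
  apply: (divide_card hS); first by apply: (csub_sum hS) => k; apply: (csubM hS).
  by rewrite subnK //; apply: pmult_sum => k; apply: pmultMr.
have mS g : S (m g) by case: (hm g).
have mN g : m g *+ #|gT| = \sum_k d g k * r k^-1%g by case: (hm g).
have mp g : pmult (c - s) (m g) by case: (hm g).
exists (fun g => r g - m g); split=> [g||g|g|g h].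
- exact: (csubB hS).
- rewrite -[RHS]subr0; congr (_ - _); apply: (E_tf card_gT).
  by rewrite mN big1 // => k _; rewrite d1 mul0r.
- split.
    rewrite mulrBr r1l; congr (_ - _); apply: (torsion_free_inj E_tf card_gT).
    by rewrite -mulrnAr mN mulr_sumr; apply: eq_bigr => k _; rewrite mulrA dl.
  rewrite mulrBl r1r; congr (_ - _); apply: (torsion_free_inj E_tf card_gT).
  rewrite -mulrnAl mN mulr_suml; apply: eq_bigr => k _.
  by rewrite -mulrA r1r.
- by rewrite addrAC subrr add0r; apply: pmultN.
(* X gathers products of two defects, so its quotient y by |gT| is divisible by p^(2c-s), while m g
   * m h is divisible by p^(2c-2s). Both exponents are at least c + 1 since c > 2s. *)
pose X := \sum_k (d g h * d k k^-1%g + d g (h * k)%g * d (h * k)^-1%g h).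
have [y [_ yN py]] : exists y, [/\ True, y *+ #|gT| = X & pmult (c + c - s) y].
  apply: (divide_card (closed_subringT p E)) => //.
  rewrite subnK; last by lia.
  by apply: pmult_sum => k; apply: pmultD; apply: pmultM.
suff -> : (r g - m g) * (r h - m h) - (r (g * h)%g - m (g * h)%g) = m g * m h - y.
  apply: pmultB; last by apply: pmult_le py; lia.
  by apply: pmult_le (pmultM (mp g) (mp h)); lia.
(* Shifting k to hk in the second sum allows the exact identity r(g) d(h,k) - d(gh,k) + d(g,hk) =
   d(g,h) r(k). Replacing r(k) r(k^-1) and r((hk)^-1) r(h) by single values of r produces the terms
   of X. *)
have lin : (r g * m h + m g * r h - m (g * h)%g) *+ #|gT| = d g h *+ #|gT| + X.
  rewrite mulrnBl mulrnDl -mulrnAr -mulrnAl !mN mulr_sumr mulr_suml.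
  rewrite [X in _ + X - _](reindex_inj (mulgI h)) /=.
  rewrite -big_split -sumrB -sumr_const -big_split; apply: eq_bigr => k _ /=.
  have hk : ((h * k)^-1 * h = k^-1)%g by rewrite invMg mulgKV.
  rewrite /d mulgV hk -!mulgA !(mulrBl, mulrBr) -!mulrA !r1r; abel.
apply: (torsion_free_inj E_tf card_gT); rewrite [RHS]mulrnBl yN.
have -> : (r g - m g) * (r h - m h) - (r (g * h)%g - m (g * h)%g)
    = d g h - (r g * m h + m g * r h - m (g * h)%g) + m g * m h.
  rewrite mulrBl !mulrBr /d; abel.
rewrite mulrnDl mulrnBl lin; abel.
Qed.
End Newton.

(** Starting from c = 2s+1, the k-th correction is divisible by p^(s+1+k); the limit thus stays
    within p^(s+1) of r, the precision that [maranda] requires. *)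
Lemma multiplicative_lift S (r : gT -> E) : closed_subring p S ->
  (forall g, S (r g)) -> r 1%g * r 1%g = r 1%g ->
  (forall g, r 1%g * r g = r g /\ r g * r 1%g = r g) ->
  (forall g h, pmult (2 * s).+1 (r g * r h - r (g * h)%g)) ->
  exists rho, [/\ is_rep rho, forall g, S (rho g) &
    forall g, pmult s.+1 (rho g - r g)].
Proof.
move=> hS rS r1 re rd; set e := r 1%g in r1 re.
pose Inv k (f : gT -> E) :=
  [/\ forall g, S (f g), f 1%g = e, forall g, e * f g = f g /\ f g * e = f g,
      forall g, pmult s.+1 (f g - r g) &
      forall g h, pmult ((2 * s).+1 + k) (f g * f h - f (g * h)%g)].
have [] := @approximation_limit p E E_complete gT Inv r.
- split=> // [g|g h]; first by rewrite subrr; apply: pmult0.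
  by rewrite addn0; apply: rd.
- move=> k f [fS f1 fe fr fd].
  have f1l g : f 1%g * f g = f g by rewrite f1; case: (fe g).
  have f1r g : f g * f 1%g = f g by rewrite f1; case: (fe g).
  have cs : (2 * s < (2 * s).+1 + k)%N by lia.
  have [f' [f'S f'1 f'e f'f f'd]] := newton_step hS fS f1l f1r cs fd.
  exists f'; split; last by move=> g; apply: pmult_le (f'f g); lia.
  split=> // [|g|g|g h].
  + by rewrite f'1.
  + by rewrite -f1; apply: f'e.
  + by apply: pmult_trans (fr g); apply: pmult_le (f'f g); lia.
  + by apply: pmult_le (f'd g h); lia.
move=> l hl; exists l; split=> [g h|g|g].
- apply: (pmult_eq E_sep) => n; have [f [[_ _ _ _ fd] hf]] := hl n.
  apply: (@pmult_trans _ _ _ (f g * f h)).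
    apply: (@pmult_trans _ _ _ (f g * l h)).
      by rewrite -mulrBl; apply/pmultMr/hf.
    by rewrite -mulrBr; apply/pmultMl/hf.
  apply: (@pmult_trans _ _ _ (f (g * h)%g)); last exact/pmultBC/hf.
  by apply: pmult_le (fd g h); lia.
- apply: (csub_lim hS) => n; have [f [[fS _ _ _ _] hf]] := hl n.
  by exists (f g); split.
- have [f [[_ _ _ fr _] hf]] := hl s.+1; exact: pmult_trans (hf g) (fr g).
Qed.

(** An approximation of rho in S has no exact unit, which Newton's method presupposes. So r(1) is
    first lifted to an idempotent e of S and r is compressed to e r e. *)
Lemma multiplicative_descend S (rho r : gT -> E) : closed_subring p S ->
  is_rep rho -> (forall g, S (r g)) ->
  (forall g, pmult (2 * s).+1 (r g - rho g)) ->
  exists rho0, [/\ is_rep rho0, forall g, S (rho0 g) &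
    rep_equiv (fun=> True) rho rho0].
Proof.
move=> hS rM rS hr; set a := (2 * s).+1 in hr.
have cM x x' y y' : pmult a (x - x') -> pmult a (y - y') -> pmult a (x * y - x' * y').
  move=> hx hy; apply: (@pmult_trans _ _ _ (x' * y)).
    by rewrite -mulrBl; apply: pmultMr.
  by rewrite -mulrBr; apply: pmultMl.
have [e [Se ee he]] : exists e, [/\ S e, e * e = e & pmult a (e - r 1%g)].
  apply: (idempotent_lift E_complete E_sep) => //.
  apply: (pmult_trans (y := rho 1%g * rho 1%g)); first exact: (cM).
  by rewrite rho1l //; apply/pmultBC.
have her : pmult a (e - rho 1%g) by apply: pmult_trans he (hr _).
pose r' g := e * r g * e.
have hr' g : pmult a (r' g - rho g).
  by rewrite -(rho1r rM g) -(rho1l rM g); apply: (cM) => //; apply: (cM).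
(* e r(1) e is only close to e, hence the value at 1 is reset. *)
pose r2 g := if g == 1%g then e else r' g.
have hr2 g : pmult a (r2 g - rho g) by rewrite /r2; case: eqP => [->|].
have [|||g h|rho0 [r0M r0S hr0]] := @multiplicative_lift S r2 hS.
- by move=> g; rewrite /r2; case: ifP => // _; apply: (csubM hS) => //; apply: (csubM hS).
- by rewrite /r2 eqxx.
- move=> g; rewrite /r2 eqxx; case: ifP => // _; rewrite /r' !mulrA ee.
  by rewrite -!mulrA ee.
- apply: (pmult_trans (y := rho g * rho h)); first exact: (cM).
  by rewrite rM; apply/pmultBC.
exists rho0; split=> //; apply: maranda => // g.
apply: pmult_trans (hr0 g) _; apply: pmult_le (hr2 g); rewrite /a; lia.
Qed.

End Representations.

(** * Complete local principal ideal domains *)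

Section LocalRing.
Variables (p : nat) (O : idomainType) (m : set O) (k : fieldType).
Variable res : {rmorphism O -> k}.
Hypotheses (p_prime : prime p) (O_pid : principal_ideal_ring O).
Hypotheses (O_local : local_ring m) (O_complete : complete_ring m).
Hypotheses (O_char0 : [pchar O] =i pred0) (O_residue : residue_field m res).
Hypothesis k_char : p%:R = 0 :> k.

Lemma maximal_generator : exists pi, forall x, m x <-> exists y, x = y * pi.
Proof.
have [[mI _ _] _] := O_local; have [pi ->] := O_pid mI.
by exists pi => x; split.
Qed.

Lemma char0_natr_neq0 n : (0 < n)%N -> n%:R != 0 :> O.
Proof. by have /pcharf0P -> := O_char0; case: n. Qed.

Lemma idomain_torsion_free : torsion_free O.
Proof.
move=> n x n0 /eqP; rewrite -mulr_natr mulf_eq0 (negbTE (char0_natr_neq0 n0)) orbF.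
by move/eqP.
Qed.

Variable pi : O.
Hypothesis piP : forall x, m x <-> exists y, x = y * pi.

Lemma ideal_expP n x : ideal_exp m n x <-> exists y, x = y * pi ^+ n.
Proof.
elim: n x => [|n IHn] x.
  by split=> // _; exists x; rewrite expr0 mulr1.
split=> [[s [hs ->]]|[y ->]].
  elim: s hs => [|z s IHs] hs; first by exists 0; rewrite big_nil mul0r.
  have [|y yE] := IHs; first by move=> w ws; apply: hs; rewrite inE ws orbT.
  have [/piP[a aE] /IHn[c cE]] := hs z (mem_head _ _).
  exists (a * c + y); rewrite big_cons yE aE cE mulrDl; congr (_ + _).
  by rewrite exprS mulrACA.
exists [:: (pi, y * pi ^+ n)]; split=> [z|].
  rewrite inE => /eqP -> /=; split; first by apply/piP; exists 1; rewrite mul1r.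
  by apply/IHn; exists y.
by rewrite big_seq1 /= exprS mulrCA.
Qed.

Lemma pi_separated x : (forall n, exists y, x = y * pi ^+ n) -> x = 0.
Proof.
move=> hx; have [|l [hl lU]] := O_complete (u := fun=> 0).
  by move=> n; apply/ideal_expP; exists 0; rewrite subrr mul0r.
rewrite -(lU x) ?(lU 0) // => n; apply/ideal_expP; rewrite subr0 //.
by exists 0; rewrite mul0r.
Qed.

(** Polynomial maps do not decrease pi-adic closeness, so w -> t + pi q(w) is a contraction. It
    yields both the inverses in [local_unit] and Hensel's lemma. *)
Lemma contraction_fixpoint (q : {poly O}) t : exists w, w = t + pi * q.[w].
Proof.
pose u := fix u n := if n is n'.+1 then t + pi * q.[u n'] else t.
have dvq x y n z : x - y = z * pi ^+ n -> exists z', q.[x] - q.[y] = z' * pi ^+ n.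
  move=> xy; have [c cE] : exists c, q.[x] - q.[y] = c * (x - y).
    have /factor_theorem[c cE] : root (q - q.[y]%:P) y by rewrite /root !hornerE subrr.
    exists c.[x]; have := congr1 (horner^~ x) cE.
    by rewrite /= !hornerE.
  by exists (c * z); rewrite cE xy mulrA.
have hu n : exists z, u n.+1 - u n = z * pi ^+ n.
  elim: n => [|n [z IHn]]; first by eexists; rewrite expr0 mulr1.
  have [z' hz'] := dvq _ _ _ _ IHn; exists z'.
  rewrite -[LHS]/(t + pi * q.[u n.+1] - (t + pi * q.[u n])).
  rewrite (_ : _ - _ = pi * (q.[u n.+1] - q.[u n])); last by rewrite mulrBr; abel.
  by rewrite hz' exprS mulrCA.
have [|l [hl _]] := O_complete (u := u); first by move=> n; apply/ideal_expP.
exists l; apply/subr0_eq/pi_separated => n.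
have /ideal_expP[a aE] := hl n.+1; have /ideal_expP[c cE] := hl n.
have [z' hz'] := dvq _ _ _ _ cE.
exists (a * pi - pi * z').
have -> : l - (t + pi * q.[l]) = (l - u n.+1) - pi * (q.[l] - q.[u n]).
  rewrite -[u n.+1]/(t + pi * q.[u n]) mulrBr; abel.
by rewrite aE hz' mulrBl exprS !mulrA.
Qed.

(** Maximality gives 1 = a pi + c x, and 1 - a pi is inverted by the fixed point w = 1 + pi a w. *)
Lemma local_unit x : ~ m x -> x \is a GRing.unit.
Proof.
move=> mx; have [[mI m1 mmax] _] := O_local.
pose J := [set z | exists a c, z = a * pi + c * x]%classic.
have JI : is_ideal J.
  split=> [|y z [a [c ->]] [a' [c' ->]]|d y [a [c ->]]].
  - by exists 0, 0; rewrite !mul0r addr0.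
  - by exists (a + a'), (c + c'); rewrite !mulrDl; abel.
  - by exists (d * a), (d * c); rewrite mulrDr !mulrA.
have [J1|J1] := pselect (J 1); last first.
  case: mx; rewrite -(mmax J JI J1); first by exists 0, 1; rewrite mul0r add0r mul1r.
  by move=> y /piP[a ->]; exists a, 0; rewrite mul0r addr0.
have [a [c E]] := J1; have [w wE] := contraction_fixpoint ('X * a%:P) 1.
apply/unitrP; exists (w * c).
have : w * c * x = 1.
  have -> : w * c * x = w - w * a * pi.
    rewrite -mulrA (_ : c * x = 1 - a * pi); first by rewrite mulrBr mulr1 mulrA.
    rewrite E; abel.
  by rewrite {1}wE hornerM hornerX hornerC; ring.
by move=> h; split=> //; rewrite mulrC.
Qed.

Lemma natr_in_maximal : m p%:R.
Proof. by apply/O_residue.2; rewrite rmorph_nat. Qed.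

Lemma maximal_natr (n : nat) : m n%:R -> (p %| n)%N.
Proof.
have [[[_ mD mM] m1 _] _] := O_local.
move=> mn; apply: contrapT => /negP; rewrite -prime_coprime // => /eqP pn.
case: m1; have [u v uv _] := egcdnP n (prime_gt0 p_prime).
have : (u * p)%:R = (v * n + 1)%:R :> O by rewrite uv pn.
rewrite natrD !natrM => E.
have -> : 1 = u%:R * p%:R + (- v%:R) * n%:R :> O by rewrite E; ring.
apply: mD; apply: mM => //; exact: natr_in_maximal.
Qed.

Lemma prime_to_unit n : ~~ (p %| n)%N -> n%:R \is a @GRing.unit O.
Proof. by move=> pn; apply: local_unit => /maximal_natr; apply/negP. Qed.

(** If no largest power of pi divided x, then x would be zero by separatedness. *)
Lemma pi_factor x : x != 0 -> exists e u, u \is a GRing.unit /\ x = u * pi ^+ e.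
Proof.
move=> x0; have [e [y xE nx]] : exists e, exists2 y, x = y * pi ^+ e &
    ~ exists z, x = z * pi ^+ e.+1.
  apply: contrapT => hx; case/eqP: x0; apply: pi_separated; elim=> [|n [y IHn]].
    by exists x; rewrite expr0 mulr1.
  by apply: contrapT => h; apply: hx; exists n, y.
exists e, y; split=> //; apply: local_unit => /piP[z zE]; apply: nx; exists z.
by rewrite xE zE exprS mulrA.
Qed.

Lemma pi_neq0 : pi != 0.
Proof.
apply: contraTneq (char0_natr_neq0 (prime_gt0 p_prime)) => pi0.
by have /piP[y ->] := natr_in_maximal; rewrite pi0 mulr0 eqxx.
Qed.

Lemma natr_ramification : exists e u,
  [/\ (0 < e)%N, u \is a GRing.unit & p%:R = u * pi ^+ e :> O].
Proof.
have [e [u [uU E]]] := pi_factor (char0_natr_neq0 (prime_gt0 p_prime)).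
exists e, u; split=> //; case: e E => // E.
have [[[_ _ mM] m1 _] _] := O_local; case: m1.
rewrite -(mulVr uU); have := mM u^-1 _ natr_in_maximal.
by rewrite E expr0 mulr1.
Qed.

Lemma pmult_natr a (x : O) : pmult p a x <-> exists y, x = y * p%:R ^+ a.
Proof.
by split=> [[y ->]|[y ->]]; exists y; rewrite -natrX mulr_natr.
Qed.

(** As p is a unit times pi^e, the p-adic and pi-adic topologies agree; this and [pi_pmult] are the
    two comparisons. *)
Lemma pmult_pi a : exists n, forall x, (exists y, x = y * pi ^+ n) -> pmult p a x.
Proof.
have [e [u [e0 uU pE]]] := natr_ramification.
exists (e * a)%N => x [y ->]; apply/pmult_natr; exists (y * u ^- a).
by rewrite pE exprMn -exprM -mulrA mulKr // unitrX.
Qed.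

Lemma pi_pmult a x : pmult p a x -> exists y, x = y * pi ^+ a.
Proof.
have [e [u [e0 uU pE]]] := natr_ramification.
move=> /pmult_natr[y ->]; exists (y * u ^+ a * pi ^+ (e * a - a)).
rewrite pE exprMn -exprM -!mulrA -exprD subnK //.
by rewrite leq_pmull.
Qed.

Lemma local_separated : padically_separated p O.
Proof. by move=> x hx; apply: pi_separated => n; apply: pi_pmult. Qed.

Lemma local_complete : padically_complete p O.
Proof.
move=> u hu; have [|l [hl _]] := O_complete (u := u).
  by move=> n; apply/ideal_expP/pi_pmult.
exists l => n; have [a ha] := pmult_pi n.
(* A pi-adic limit is p^n-close only to late terms; the Cauchy property leads back from such a term
   to u n. *)
apply: (@pmult_trans _ _ _ (u (maxn a n))).
  apply: ha; have /ideal_expP[y ->] := hl (maxn a n).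
  exists (y * pi ^+ (maxn a n - a)).
  by rewrite -mulrA -exprD subnK // leq_maxl.
exact: pmult_cauchy (leq_maxr _ _).
Qed.

Lemma divide_natr n : (0 < n)%N ->
  exists s, forall x : O, exists y, y *+ n = x *+ p ^ s.
Proof.
move=> n0; exists (logn p n) => x; have [q pq nE] := pfactor_coprime p_prime n0.
have qU : q%:R \is a @GRing.unit O by apply: prime_to_unit; rewrite -prime_coprime.
exists (x / q%:R).
rewrite {1}nE mulrnA -[_ *+ q]mulr_natr divrK //.
Qed.

End LocalRing.

(** * p-adic subrings *)

Record subfield (F : fieldType) := Subfield {
  sf_pred :> {pred F};
  sf_closed : GRing.divring_closed sf_pred
}.

Section Subfield.
Variables (F : fieldType) (Q : subfield F).

HB.instance Definition _ := GRing.isDivringClosed.Build F (sf_pred Q) (sf_closed Q).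

Record sf_type := SfElt { sf_val : F; sf_valP : sf_val \in sf_pred Q }.
HB.instance Definition _ := [isSub for sf_val].
HB.instance Definition _ := [Choice of sf_type by <:].
HB.instance Definition _ := [SubChoice_isSubIntegralDomain of sf_type by <:].
HB.instance Definition _ := [SubIntegralDomain_isSubField of sf_type by <:].

(** The relation must have its coefficients in Q, so the kernel is computed over the field
    [sf_type]. *)
Lemma subfield_dependent d n (C : 'I_d -> 'I_n -> F) : (n < d)%N ->
  (forall i j, C i j \in Q) ->
  exists c : 'I_d -> F, [/\ forall i, c i \in Q, exists i, c i != 0 &
    forall j, \sum_i c i * C i j = 0].
Proof.
move=> nd CQ; pose A : 'M[sf_type]_(d, n) := \matrix_(i, j) SfElt (CQ i j).
have : kermx A != 0.
  rewrite kermx_eq0; apply/negP => /eqP rA; have := rank_leq_col A.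
  by rewrite rA leqNgt nd.
case/rowV0Pn => v /sub_kermxP vA v0.
exists (fun i => sf_val (v 0 i)); split=> [i||j].
- exact: sf_valP.
- apply: contrapT => h; case/negP: v0; apply/eqP/matrixP => i0 i; rewrite ord1 mxE.
  by apply: val_inj; apply: contrapT => /eqP h'; apply: h; exists i.
- have := congr1 (fun M : 'M_(1, n) => (val (M 0 j) : F)) vA; rewrite !mxE raddf_sum /= => E.
  rewrite -[RHS]E; apply: eq_bigr => i _.
  by rewrite -[RHS]/(val (v 0 i * A i j)) (rmorphM (val : sf_type -> F)) mxE.
Qed.

End Subfield.

Section PadicSubrings.
Variables (p : nat) (O : idomainType).
Hypothesis p_prime : prime p.
Hypotheses (O_sep : padically_separated p O) (O_tf : torsion_free O).
Hypothesis O_nat : forall n : nat, pmult p 1 (n%:R : O) -> (p %| n)%N.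

Local Notation pmult := (@pmult p O).
Local Notation F := {fraction O}.
Local Notation iota := (@tofrac O).

Lemma p_gt0 : (0 < p)%N. Proof. exact: prime_gt0. Qed.

Lemma pmultS a (x : O) : pmult a.+1 (x *+ p) -> pmult a x.
Proof.
move=> [y yE]; exists y; apply/(torsion_free_inj O_tf p_gt0).
by rewrite yE expnSr mulrnA.
Qed.

Lemma natr_neq0 n : (0 < n)%N -> n%:R != 0 :> O.
Proof.
by move=> n0; apply/eqP => n1; have /eqP := O_tf n0 n1; rewrite oner_eq0.
Qed.

Lemma pmult_int a (z : int) : pmult a (z%:~R) -> (p%:Z ^+ a %| z)%Z.
Proof.
elim: a z => [|a IHa] z pz; first by rewrite expr0 dvd1z.
have /dvdzP[y yE] : (p%:Z %| z)%Z.
  rewrite dvdzE /=; apply: O_nat; have := pmult_le (ltn0Sn a) pz.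
  by case: z {pz} => n; rewrite ?NegzE // mulrNz => /pmultN; rewrite opprK.
have {}/IHa/dvdzP[x xE] : pmult a (y%:~R).
  by apply: pmultS; rewrite -mulr_natr -(intrM _ y p) -yE.
by apply/dvdzP; exists x; rewrite yE xE exprSr mulrA.
Qed.

(** The closure of the integers in O. The coherence of the approximations demanded by
    [padic_integer] is automatic by [pmult_int]. *)
Definition zp (x : O) : Prop := forall n, exists z : int, pmult n (x - z%:~R).

Lemma padic_integerP x : padic_integer p x <-> zp x.
Proof.
split=> [[u [_ hu]] n|/choice[u hu]].
  by exists (u n); have [y ->] := hu n; exists y; rewrite mulrC -natrX mulr_natr.
exists u; split=> n; last first.
  by have [y ->] := hu n; exists y; rewrite mulrC -natrX mulr_natr.
apply/eqP; rewrite eqz_mod_dvd; apply: pmult_int; rewrite rmorphB /=.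
apply: pmult_trans (hu n); apply: pmultBC; exact: pmult_le (hu n.+1).
Qed.

Lemma zp_int (z : int) : zp z%:~R.
Proof. by move=> n; exists z; rewrite subrr; apply: pmult0. Qed.

Lemma zp_nat (n : nat) : zp n%:R.
Proof. exact: (zp_int n). Qed.

Lemma zpB x y : zp x -> zp y -> zp (x - y).
Proof.
move=> hx hy n; have [a ha] := hx n; have [c hc] := hy n.
exists (a - c); rewrite rmorphB /= (_ : _ - _ = (x - a%:~R) - (y - c%:~R)); last by abel.
exact: pmultB.
Qed.

Lemma zpM x y : zp x -> zp y -> zp (x * y).
Proof.
move=> hx hy n; have [a ha] := hx n; have [c hc] := hy n.
exists (a * c); rewrite rmorphM /=; apply: (@pmult_trans _ _ _ (a%:~R * y)).
  by rewrite -mulrBl; apply: pmultMr.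
by rewrite -mulrBr; apply: pmultMl.
Qed.

Lemma zp_pure x : zp (x *+ p) -> zp x.
Proof.
move=> hx n; have [z hz] := hx n.+1.
have /dvdzP[y yE] : (p%:Z ^+ 1 %| z)%Z.
  apply: pmult_int; apply: (@pmult_addr _ _ _ (x *+ p)).
    by apply: pmultBC; apply: pmult_le hz.
  by exists x.
exists y; apply: pmultS; rewrite mulrnBl -[_%:~R *+ p]mulr_natr -(intrM _ y p).
by rewrite -[p : int]expr1 -yE.
Qed.

Lemma zp_digit x : zp x -> exists u : nat, pmult 1 (x - u%:R).
Proof.
move=> hx; have [z hz] := hx 1%N.
have p0 : p%:Z != 0 by rewrite eqz_nat -lt0n p_gt0.
exists `|(z %% p)%Z|%N; apply: pmult_trans hz _.
rewrite -[_%:R]/(Posz _)%:~R gez0_abs ?modz_ge0 // -rmorphB /=.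
rewrite {1}(divz_eq z p) addrK; exists (z %/ p)%Z%:~R.
by rewrite expn1 -mulr_natr intrM.
Qed.

Lemma padic_number_int x : zp x -> padic_number p (iota x).
Proof.
move=> hx; exists x, 1; rewrite oner_eq0 rmorph1 divr1.
by split=> //; apply/padic_integerP => //; apply: (zp_nat 1).
Qed.

Lemma padic_number_closed : GRing.divring_closed [pred z : F | `[< padic_number p z >]].
Proof.
split=> [|z w|z w].
- by apply/asboolP; rewrite -(rmorph1 iota); apply: padic_number_int; apply: (zp_nat 1).
- move=> /asboolP[x [y [/padic_integerP hx /padic_integerP hy y0 ->]]].
  move=> /asboolP[x' [y' [/padic_integerP hx' /padic_integerP hy' y'0 ->]]].
  apply/asboolP; exists (x * y' - x' * y), (y * y'); split.
  + by apply/padic_integerP/zpB; apply: zpM.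
  + by apply/padic_integerP/zpM.
  + by rewrite mulf_neq0.
  + by rewrite rmorphB !rmorphM /= -[X in _ + X = _]mulNr addf_div ?tofrac_eq0 // mulNr.
- move=> /asboolP[x [y [/padic_integerP hx /padic_integerP hy y0 ->]]].
  move=> /asboolP[x' [y' [/padic_integerP hx' /padic_integerP hy' y'0 ->]]].
  apply/asboolP; have [->|x'0] := eqVneq x' 0.
    rewrite rmorph0 mul0r invr0 mulr0 -(rmorph0 iota).
    by apply: padic_number_int; apply: (zp_nat 0).
  exists (x * y'), (y * x'); split.
  + by apply/padic_integerP/zpM.
  + by apply/padic_integerP/zpM.
  + by rewrite mulf_neq0.
  + by rewrite invf_div mulf_div !rmorphM.
Qed.

Definition Qp : subfield F := Subfield padic_number_closed.

Lemma QpP z : reflect (padic_number p z) (z \in sf_pred Qp).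
Proof. exact: asboolP. Qed.

Lemma Qp_zp x : zp x -> iota x \in sf_pred Qp.
Proof. by move=> /padic_number_int/QpP. Qed.

Lemma zp_prod (I : Type) (s : seq I) (f : I -> O) :
  (forall i, zp (f i)) -> zp (\prod_(i <- s) f i).
Proof.
by move=> hf; elim/big_rec: _ => [|i x _]; [apply: (zp_nat 1) | apply: zpM].
Qed.

(** A common denominator is cleared and p is divided out while it divides every term; this stops
    because some x j is nonzero and O is separated. Such a relation stays nontrivial modulo p. *)
Lemma Qp_primitive d (c : 'I_d -> F) : (forall i, c i \in sf_pred Qp) ->
  (exists i, c i != 0) ->
  exists (l : F) (x : 'I_d -> O), [/\ forall i, zp (x i),
    forall i, c i = l * iota (x i) & exists i, ~ pmult 1 (x i)].
Proof.
move=> cQ [j cj].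
have [l [x [xz cE]]] : exists (l : F) (x : 'I_d -> O),
    (forall i, zp (x i)) /\ forall i, c i = l * iota (x i).
  have /choice[xy hxy] i : exists xy : O * O, [/\ zp xy.1, zp xy.2, xy.2 != 0 &
      c i = iota xy.1 / iota xy.2].
    have /QpP[x [y [hx hy y0 E]]] := cQ i; exists (x, y).
    by split=> //; apply/padic_integerP.
  pose D := \prod_i (xy i).2.
  have D0 : D != 0 by apply/prodf_neq0 => i _; case: (hxy i).
  exists (iota D)^-1, (fun i => (xy i).1 * \prod_(k | k != i) (xy k).2).
  split=> i; have [hx hy y0 E] := hxy i.
    apply: zpM => //; rewrite -big_filter; apply: zp_prod => k.
    by case: (hxy k).
  have -> : D = (xy i).2 * \prod_(k | k != i) (xy k).2 by rewrite /D (bigD1 i).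
  have P0 : \prod_(k | k != i) (xy k).2 != 0.
    by apply/prodf_neq0 => k _; case: (hxy k).
  rewrite E !rmorphM /= invfM mulrACA [_^-1 * iota (xy i).1]mulrC.
  by rewrite mulVf ?mulr1 // tofrac_eq0.
have [n hn] : exists n, ~ pmult n (x j).
  apply: contrapT => h; case/eqP: cj; rewrite cE.
  rewrite (_ : x j = 0) ?rmorph0 ?mulr0 //; apply: O_sep => n.
  by apply: contrapT => hn; apply: h; exists n.
elim: n l x xz cE hn => [|n IHn] l x xz cE hn; first by case: hn; apply: pmult_0.
have [h|h] := pselect (exists i, ~ pmult 1 (x i)); first by exists l, x.
have /choice[y yE] i : exists y, x i = y *+ p.
  have [y ->] : pmult 1 (x i) by apply: contrapT => h'; apply: h; exists i.
  by exists y; rewrite expn1.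
apply: (IHn (l * p%:R) y) => [i|i|[z zE]].
- by apply: zp_pure; rewrite -yE.
- by rewrite cE yE rmorphMn /= -mulrA mulr_natl.
- by apply: hn; exists z; rewrite yE zE expnSr mulrnA.
Qed.

Definition qspan (e : seq F) (z : F) : Prop := exists c : nat -> F,
  (forall i, padic_number p (c i)) /\ z = \sum_(i < size e) c i * e`_i.

Section Span.
Variable e : seq F.

Lemma qspan_add y z : qspan e y -> qspan e z -> qspan e (y + z).
Proof.
move=> [c [hc ->]] [d [hd ->]]; exists (fun i => c i + d i); split=> [i|].
  by apply/QpP; apply: (rpredD (S := sf_pred Qp)); apply/QpP.
by rewrite -big_split; apply: eq_bigr => i _; rewrite mulrDl.
Qed.

Lemma qspan0 : qspan e 0.
Proof.
exists (fun=> 0); split=> [i|]; first by apply/QpP; apply: (rpred0 (sf_pred Qp)).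
by rewrite big1 // => i _; rewrite mul0r.
Qed.

Lemma qspan_scale c z : c \in sf_pred Qp -> qspan e z -> qspan e (c * z).
Proof.
move=> hc [d [hd ->]]; exists (fun i => c * d i); split=> [i|].
  by apply/QpP; apply: (rpredM (s := sf_pred Qp)) => //; apply/QpP.
by rewrite mulr_sumr; apply: eq_bigr => i _; rewrite mulrA.
Qed.

Lemma qspan_sum (I : Type) (s : seq I) (f : I -> F) :
  (forall i, qspan e (f i)) -> qspan e (\sum_(i <- s) f i).
Proof.
by move=> hf; elim/big_rec: _ => [|i x _]; [apply: qspan0 | apply: qspan_add].
Qed.

Lemma qspan_opp z : qspan e z -> qspan e (- z).
Proof.
by rewrite -mulN1r; apply: qspan_scale; rewrite (rpredN1 (sf_pred Qp)).
Qed.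

Lemma qspan_mem x : x \in e -> qspan e x.
Proof.
move=> /(nthP 0)[i ie <-]; exists (fun j => (j == i)%:R); split=> [j|].
  by apply/QpP; apply: (rpred_nat (sf_pred Qp)).
rewrite (bigD1 (Ordinal ie)) //= eqxx mul1r big1 ?addr0 // => j ji.
by rewrite (_ : (j == i :> nat) = false) ?mul0r //; apply/negbTE.
Qed.

Lemma qspan_ind (P : F -> Prop) : P 0 -> (forall y z, P y -> P z -> P (y + z)) ->
  (forall c x, c \in sf_pred Qp -> x \in e -> P (c * x)) ->
  forall z, qspan e z -> P z.
Proof.
move=> P0 PD Pc z [c [hc ->]]; elim/big_rec: _ => [//|i x _]; apply: PD.
by apply: Pc; [apply/QpP | apply: mem_nth].
Qed.

Definition ring_span : Prop :=
  qspan e 1 /\ forall y z, qspan e y -> qspan e z -> qspan e (y * z).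

Hypothesis e_ring : ring_span.

Lemma qspanX z n : qspan e z -> qspan e (z ^+ n).
Proof.
case: e_ring => e1 eM hz; elim: n => [|n IHn]; first by rewrite expr0.
by rewrite exprS; apply: eM.
Qed.

Lemma qspan_Qp c : c \in sf_pred Qp -> qspan e c.
Proof. by move=> hc; rewrite -[c]mulr1; apply: qspan_scale => //; case: e_ring. Qed.

(** A finite-dimensional algebra inside a field is a field: more powers of z than the span has
    generators satisfy a linear relation over Q_p. *)
Lemma qspan_inv z : qspan e z -> qspan e z^-1.
Proof.
move=> hz; have [->|z0] := eqVneq z 0; first by rewrite invr0; apply: qspan0.
have /choice[C hC] (i : 'I_(size e).+1) := qspanX i hz.
have [||c [cQ [j cj] cE]] := @subfield_dependent F Qp (size e).+1 (size e)
    (fun i j => C i j) => //.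
  by move=> i j; apply/QpP; case: (hC i).
pose q := \poly_(i < (size e).+1) c (inord i).
have : q.[z] = 0.
  rewrite horner_poly (eq_bigr (fun i : 'I__ => \sum_(j < size e) c i * C i j * e`_j)).
    rewrite exchange_big big1 // => k _ /=.
    by rewrite -mulr_suml cE mul0r.
  move=> i _; rewrite inord_val; have [_ ->] := hC i.
  by rewrite mulr_sumr; apply: eq_bigr => k _; rewrite mulrA.
have : q != 0.
  apply: contraNneq cj => q0; have := congr1 (fun f : {poly F} => f`_j) q0.
  by rewrite coef_poly ltn_ord inord_val coef0 => ->.
have : q \is a polyOver (sf_pred Qp).
  by apply/polyOverP => i; rewrite coef_poly; case: ifP => // _; apply: (rpred0 (sf_pred Qp)).
(* z is cancelled while the constant coefficient a vanishes; once a is nonzero, q(z) z + a = 0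
   exhibits z^-1. *)
elim/poly_ind: q => [|q a IHq]; first by rewrite eqxx.
move=> /polyOverP qQ q0; rewrite !hornerE => E.
have qQ' : q \is a polyOver (sf_pred Qp).
  by apply/polyOverP => i; have := qQ i.+1; rewrite coefD coefMX coefC /= addr0.
have aQ : a \in sf_pred Qp by have := qQ 0%N; rewrite coefD coefMX coefC /= add0r.
have [a0|a0] := eqVneq a 0.
  apply: IHq => //; first by apply: contraNneq q0 => ->; rewrite a0 mul0r add0r.
  by move: E; rewrite a0 addr0 => /eqP; rewrite mulf_eq0 (negbTE z0) orbF => /eqP.
have -> : z^-1 = - a^-1 * q.[z].
  apply: (mulIf z0); rewrite mulVf // -mulrA -[_ * z](addrK a) E sub0r mulrNN.
  by rewrite mulVf.
apply: qspan_scale; first by rewrite (rpredN (sf_pred Qp)) (rpredV (sf_pred Qp)).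
rewrite horner_coef; apply: qspan_sum => i; apply: qspan_scale; last exact: qspanX.
by move/polyOverP: qQ'; apply.
Qed.

Lemma span_padic_subring : exists S : padic_subring p O,
  forall x, x \in ps_pred S <-> qspan e (iota x).
Proof.
case: e_ring => e1 eM.
suff hS : is_padic_subring p [pred x | `[< qspan e (iota x) >]].
  by exists (PadicSubring hS) => x; split=> /asboolP.
exists ((fun z => `[< qspan e z >]) : {pred F}); split=> //.
- split=> [|x y|x y]; first exact/asboolP.
    move=> /asboolP hx /asboolP hy; apply/asboolP/qspan_add => //; exact: qspan_opp.
  by move=> /asboolP hx /asboolP hy; apply/asboolP/eM => //; apply: qspan_inv.
- by move=> z /QpP hz; apply/asboolP/qspan_Qp.
- exists e; split=> [x xe|z]; first exact/asboolP/qspan_mem.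
  by move/asboolP.
Qed.

End Span.

Lemma padic_subring_span (S : padic_subring p O) : exists e, ring_span e /\
  forall x, x \in ps_pred S <-> qspan e (iota x).
Proof.
have [K0 [KD KQ [e [eK Ke]] SK]] := ps_padic S.
have [K1 KB KV] := KD; have [_ _ KM] := GRing.divring_closedBM KD.
have K0' : 0 \in K0 by rewrite -(subrr 1); apply: KB.
have KDD x y : x \in K0 -> y \in K0 -> x + y \in K0.
  by move=> hx hy; rewrite -[y]opprK; apply: (KB) => //; rewrite -sub0r; apply: (KB).
have spanK z : z \in K0 <-> qspan e z.
  split=> [/Ke//|]; apply: (qspan_ind (P := fun z => z \in K0)) => // c x /QpP hc xe.
  by apply: KM; [apply: KQ | apply: eK].
exists e; split=> [|x]; last by rewrite SK.
by split=> [|y z /spanK hy /spanK hz]; apply/spanK => //; apply: KM.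
Qed.

End PadicSubrings.

(** * Composites, adjunction of roots and residues of p-adic subrings *)

Section PadicSubringTheory.
Variables (p : nat) (O : idomainType).
Hypotheses (p_prime : prime p) (O_complete : padically_complete p O).
Hypotheses (O_sep : padically_separated p O) (O_tf : torsion_free O).
Hypothesis O_nat : forall n : nat, pmult p 1 (n%:R : O) -> (p %| n)%N.

Local Notation pmult := (@pmult p O).
Local Notation F := {fraction O}.
Local Notation iota := (@tofrac O).
Local Notation Qp := (Qp p_prime O_tf O_nat).
Local Notation qspan := (@qspan p O).
Local Notation ring_span := (@ring_span p O).
Local Notation qind := (@qspan_ind p O p_prime O_tf O_nat _ _).
Local Notation prodspan e f := [seq x * y | x <- e, y <- f].

Lemma qspan_prod e f y z : qspan e y -> qspan f z -> qspan (prodspan e f) (y * z).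
Proof.
move=> hy hz; move: y hy; apply: qind.
- by rewrite mul0r; apply: (qspan0 p_prime O_tf O_nat).
- by move=> y y'; rewrite mulrDl; apply: (qspan_add p_prime O_tf O_nat).
move=> c x cQ xe; move: z hz; apply: qind.
- by rewrite mulr0; apply: (qspan0 p_prime O_tf O_nat).
- by move=> y y'; rewrite mulrDr; apply: (qspan_add p_prime O_tf O_nat).
move=> d w dQ wf; rewrite mulrACA; apply: (@qspan_scale p O p_prime O_tf O_nat).
  exact: (rpredM (s := sf_pred Qp)).
by apply: (qspan_mem p_prime O_tf O_nat) => //; apply/allpairsP; exists (x, w).
Qed.

Lemma ring_span_prod e f : ring_span e -> ring_span f -> ring_span (prodspan e f).
Proof.
move=> [e1 eM] [f1 fM]; split; first by rewrite -[1]mulr1; apply: qspan_prod.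
move=> y z hy hz; move: y hy; apply: qind.
- by rewrite mul0r; apply: (qspan0 p_prime O_tf O_nat).
- by move=> y y'; rewrite mulrDl; apply: (qspan_add p_prime O_tf O_nat).
move=> c x cQ /allpairsP[[a a'] /= [ae a'f ->]].
move: z hz; apply: qind.
- by rewrite mulr0; apply: (qspan0 p_prime O_tf O_nat).
- by move=> y y'; rewrite mulrDr; apply: (qspan_add p_prime O_tf O_nat).
move=> d w dQ /allpairsP[[b b'] /= [be b'f ->]]; rewrite mulrACA.
apply: (@qspan_scale p O p_prime O_tf O_nat); first exact: (rpredM (s := sf_pred Qp)).
by rewrite mulrACA; apply: qspan_prod; [apply: eM | apply: fM];
  apply: (qspan_mem p_prime O_tf O_nat).
Qed.

(** The products of generators span a ring over Q_p, and this ring is automatically a field. *)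
Lemma padic_subring_compositum (S T : padic_subring p O) :
  exists U : padic_subring p O, {subset S <= U} /\ {subset T <= U}.
Proof.
have [e [eR eS]] := padic_subring_span p_prime O_tf O_nat S.
have [f [fR fT]] := padic_subring_span p_prime O_tf O_nat T.
have [U hU] := span_padic_subring p_prime O_tf O_nat (ring_span_prod eR fR).
exists U; split=> x.
  by move/eS => hx; apply/hU; rewrite -[iota x]mulr1; apply: qspan_prod => //; case: fR.
by move/fT => hx; apply/hU; rewrite -[iota x]mul1r; apply: qspan_prod => //; case: eR.
Qed.

Lemma padic_subring_exists : exists S : padic_subring p O, True.
Proof.
have [|S _] := @span_padic_subring p O p_prime O_tf O_nat [:: 1]; last by exists S.
have one : qspan [:: 1] 1 by apply: (qspan_mem p_prime O_tf O_nat) => //; rewrite mem_head.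
split=> // y z hy hz; move: y hy; apply: qind.
- by rewrite mul0r; apply: (qspan0 p_prime O_tf O_nat).
- by move=> y y'; rewrite mulrDl; apply: (qspan_add p_prime O_tf O_nat).
move=> c x cQ; rewrite inE => /eqP ->; rewrite mulr1.
exact: (@qspan_scale p O p_prime O_tf O_nat).
Qed.

(** The span of the products of generators with z^j for j < n is stable under z. The polynomial need
    not be monic: its leading coefficient is inverted in the field spanned by e, not in S. *)
Lemma padic_subring_adjoin (S : padic_subring p O) (y : O) (q : {poly O}) :
  q \is a polyOver (ps_pred S) -> q != 0 -> root q y ->
  exists T : padic_subring p O, {subset S <= T} /\ y \in ps_pred T.
Proof.
move=> /polyOverP qS q0 /rootP qy.
have [e [eR eS]] := padic_subring_span p_prime O_tf O_nat S.
have [e1 eM] := eR.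
pose n := (size q).-1; pose z := iota y.
have sq : size q = n.+1 by rewrite /n prednK // size_poly_gt0.
pose f := prodspan e [seq z ^+ j | j <- seq.iota 0 n].
have fE a j : qspan e a -> (j < n)%N -> qspan f (a * z ^+ j).
  move=> ha jn; apply: qspan_prod => //; apply: (qspan_mem p_prime O_tf O_nat) => //.
  by apply/mapP; exists j; rewrite ?mem_iota.
have n0 : (0 < n)%N.
  rewrite lt0n; apply: contra_eq_neq qy => n0; rewrite horner_coef sq n0 big_ord1.
  by rewrite expr0 mulr1; move: q0; rewrite -lead_coef_eq0 lead_coefE sq n0.
have fsum (I : Type) := @qspan_sum p O p_prime O_tf O_nat f I.
have fn a : qspan e a -> qspan f (a * z ^+ n).
  move=> ha; have ln0 : iota q`_n != 0.
    by rewrite tofrac_eq0; move: q0; rewrite -lead_coef_eq0 lead_coefE sq.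
  have -> : z ^+ n = - \sum_(j < n) (iota q`_j / iota q`_n) * z ^+ j.
    apply: (mulfI ln0); have := congr1 iota qy.
    rewrite horner_coef sq big_ord_recr /= rmorph0 rmorphD rmorph_sum /= rmorphM rmorphXn /=.
    move=> /eqP; rewrite addrC addr_eq0 => /eqP ->; rewrite mulrN mulr_sumr; congr (- _).
    apply: eq_bigr => j _; rewrite rmorphM rmorphXn /= mulrA; congr (_ * _).
    by rewrite mulrCA divff // mulr1.
  rewrite mulrN mulr_sumr; apply: (qspan_opp p_prime O_tf O_nat); apply: fsum => j.
  rewrite mulrA; apply: fE => //; apply: (eM) => //; apply: (eM); first exact/eS.
  by apply: (qspan_inv p_prime O_tf O_nat eR); apply/eS.
have fle a j : qspan e a -> (j <= n)%N -> qspan f (a * z ^+ j).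
  by move=> ha; rewrite leq_eqVlt => /orP[/eqP ->|]; [apply: fn | apply: fE].
have fgen w c x : c \in sf_pred Qp -> x \in f ->
    (forall a j, qspan e a -> (j < n)%N -> qspan f (w * (a * z ^+ j))) ->
    qspan f (w * (c * x)).
  move=> cQ /allpairsP[[a t] /= [ae /mapP[j]]]; rewrite mem_iota /= add0n => jn -> ->.
  move=> hw; rewrite mulrCA; apply: (@qspan_scale p O p_prime O_tf O_nat) => //.
  by apply: hw => //; apply: (qspan_mem p_prime O_tf O_nat).
have find w : (forall a j, qspan e a -> (j < n)%N -> qspan f (w * (a * z ^+ j))) ->
    forall x, qspan f x -> qspan f (w * x).
  move=> hw; apply: qind.
  - by rewrite mulr0; apply: (qspan0 p_prime O_tf O_nat).
  - by move=> x x'; rewrite mulrDr; apply: (qspan_add p_prime O_tf O_nat).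
  - by move=> c x cQ xf; apply: fgen.
have fe a : qspan e a -> forall x, qspan f x -> qspan f (a * x).
  by move=> ha; apply: find => a' j ha' jn; rewrite mulrA; apply: fE => //; apply: eM.
have fz : forall x, qspan f x -> qspan f (z * x).
  by apply: find => a j ha jn; rewrite mulrCA -exprS; apply: fle.
have fX j : forall x, qspan f x -> qspan f (z ^+ j * x).
  elim: j => [|j IHj] x hx; first by rewrite expr0 mul1r.
  by rewrite exprS -mulrA; apply/fz/IHj.
have f1 : qspan f 1 by rewrite -[1]mulr1 -(expr0 z); apply: fE.
have fR : ring_span f.
  split=> // x w hx; apply: find => a j ha jn.
  by rewrite mulrCA; apply: fe => //; rewrite mulrC; apply: fX.
have [T hT] := span_padic_subring p_prime O_tf O_nat fR.
exists T; split=> [x /eS hx|]; apply/hT.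
  by rewrite -[iota x]mulr1; apply: fe.
by rewrite -[iota y]mulr1; apply: fz.
Qed.

Section OneSubring.
Variable S : padic_subring p O.

Local Notation in_S := (fun x => x \in ps_pred S).

Lemma ps_divn n x : (0 < n)%N -> x *+ n \in ps_pred S -> x \in ps_pred S.
Proof.
have [e [eR eS]] := padic_subring_span p_prime O_tf O_nat S.
move=> n0 /eS hx; apply/eS.
have nn : n%:R != 0 :> F by rewrite -(rmorph_nat iota) tofrac_eq0 (natr_neq0 O_tf).
have -> : iota x = n%:R^-1 * iota (x *+ n).
  by rewrite rmorphMn /= -[iota x *+ n]mulr_natl mulKf.
apply: (@qspan_scale p O p_prime O_tf O_nat) => //.
by rewrite (rpredV (sf_pred Qp)) (rpred_nat (sf_pred Qp)).
Qed.

Lemma ps_zp x : zp p x -> x \in ps_pred S.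
Proof.
have [e [eR eS]] := padic_subring_span p_prime O_tf O_nat S.
by move=> hx; apply/eS; apply: (@qspan_Qp p O p_prime O_tf O_nat) => //; apply: Qp_zp.
Qed.

(** Linear independence over F_p of the classes modulo p O, with natural numbers as coefficients. *)
Definition mod_independent d (s : 'I_d -> O) : Prop :=
  forall u : 'I_d -> nat, pmult 1 (\sum_i s i *+ u i) -> forall i, (p %| u i)%N.

(** More elements than generators are dependent over Q_p; a primitive relation reduces to a
    nontrivial one over F_p. So the residue dimension is at most the number of generators. *)
Lemma mod_independent_bound : exists n, forall d (s : 'I_d -> O),
  (forall i, s i \in ps_pred S) -> mod_independent s -> (d <= n)%N.
Proof.
have [e [eR eS]] := padic_subring_span p_prime O_tf O_nat S.
exists (size e) => d s sS ind; rewrite leqNgt; apply/negP => nd.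
have /choice[C hC] i : qspan e (iota (s i)) by apply/eS.
have [i j|c [cQ c0 cE]] := @subfield_dependent F Qp d (size e) (fun i j => C i j) nd.
  by apply/(QpP p_prime O_tf O_nat); case: (hC i).
have [l [x [xz xE [j nj]]]] := Qp_primitive O_sep cQ c0.
have l0 : l != 0.
  by have [i] := c0; apply: contraNneq => l0; rewrite xE l0 mul0r.
have rel : \sum_i x i * s i = 0.
  apply/eqP; rewrite -tofrac_eq0; apply/eqP/(mulfI l0); rewrite mulr0.
  rewrite rmorph_sum mulr_sumr /=.
  rewrite (eq_bigr (fun i => \sum_(k < size e) c i * C i k * e`_k)).
    by rewrite exchange_big big1 // => k _; rewrite -mulr_suml cE mul0r.
  move=> i _; rewrite rmorphM mulrA /= -xE; have [_ ->] := hC i.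
  by rewrite mulr_sumr; apply: eq_bigr => k _; rewrite mulrA.
have /choice[u hu] i := zp_digit p_prime (xz i).
apply: nj; apply: pmult_addr (hu j) _.
have hu1 : pmult 1 (\sum_i s i *+ u i).
  rewrite (_ : \sum_i _ = \sum_i (s i *+ u i - x i * s i)); last by rewrite sumrB rel subr0.
  apply: pmult_sum => i.
  by rewrite -mulr_natl -mulrBl; apply/pmultMr/pmultBC.
by have /dvdnP[v ->] := ind u hu1 j; exists v%:R; rewrite expn1 natrM mulr_natr.
Qed.

(** A maximal independent family spans S modulo p: adjoining x creates a relation in which x has a
    coefficient prime to p. *)
Lemma ps_residues : exists d (s : 'I_d -> O), (forall i, s i \in ps_pred S) /\
  forall x, x \in ps_pred S -> exists u : 'I_d -> nat,
    (forall i, (u i < p)%N) /\ pmult 1 (x - \sum_i s i *+ u i).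
Proof.
have p0 := prime_gt0 p_prime.
pose P d := `[< exists s : 'I_d -> O,
  (forall i, s i \in ps_pred S) /\ mod_independent s >].
have P0 : exists d, P d by exists 0%N; apply/asboolP; exists (fun=> 0); split=> [[]|u _ []].
have [n hn] := mod_independent_bound.
have Pn d : P d -> (d <= n)%N by move=> /asboolP[s [sS ind]]; apply: hn ind.
case: (ex_maxnP P0 Pn) => d /asboolP[s [sS ind]] dmax.
exists d, s; split=> // x xS.
pose s' (i : 'I_d.+1) := if unlift ord0 i is Some j then s j else x.
have [u [hu [i0 ui0]]] : exists u : 'I_d.+1 -> nat,
    pmult 1 (\sum_i s' i *+ u i) /\ exists i, ~ (p %| u i)%N.
  apply: contrapT => h; suff /dmax : P d.+1 by rewrite ltnn.
  apply/asboolP; exists s'; split=> [i|u hu i]; first by rewrite /s'; case: unlift.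
  by apply: contrapT => h'; apply: h; exists u; split=> //; exists i.
move: hu; rewrite big_ord_recl {1}/s' unlift_none.
rewrite (eq_bigr (fun i => s i *+ u (lift ord0 i))) => [hu|i _]; last by rewrite /s' liftK.
have u0 : ~~ (p %| u ord0)%N.
  apply/negP => /dvdnP[a aE]; apply: ui0.
  have hind : forall i, (p %| u (lift ord0 i))%N.
    apply: ind; apply: (@pmult_addr _ _ _ (- (x *+ u ord0))).
      by rewrite opprK addrC.
    by apply: pmultN; rewrite aE mulrnA; exists (x *+ a); rewrite expn1.
  by case: (unliftP ord0 i0) => [j|] ->; rewrite ?hind // aE dvdn_mull.
have [a [v av]] : exists a v, (a * u ord0 = v * p + 1)%N.
  have /eqP c1 : coprime (u ord0) p by rewrite coprime_sym prime_coprime.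
  have u00 : (0 < u ord0)%N by case: (u ord0) u0; rewrite ?dvdn0.
  by have [a v E _] := egcdnP p u00; exists a, v; rewrite E c1.
(* a inverts u ord0 modulo p, and p.-1 stands for -1, so that the coefficients remain natural
   numbers. *)
exists (fun i => (a * p.-1 * u (lift ord0 i)) %% p)%N; split=> [i|]; first exact: ltn_pmod.
apply: (@pmult_trans _ _ _ (\sum_i s i *+ (a * p.-1 * u (lift ord0 i)))); last first.
  rewrite -sumrB; apply: pmult_sum => i; set w := (a * _ * _)%N.
  by rewrite {1}(divn_eq w p) mulrnDr addrK mulrnA; exists (s i *+ (w %/ p)); rewrite expn1.
have -> : \sum_i s i *+ (a * p.-1 * u (lift ord0 i))
    = (\sum_i s i *+ u (lift ord0 i)) *+ (a * p.-1).
  by rewrite -sumrMnl; apply: eq_bigr => i _; rewrite -mulrnA mulnC.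
set X := \sum_i _ in hu *.
have -> : x - X *+ (a * p.-1) = (x *+ u ord0 + X) *+ a - (x *+ v + X *+ a) *+ p.
  have key (A U V Q Y : O) : A * U = V * (Q + 1) + 1 ->
      x - Y * (A * Q) = (x * U + Y) * A - (x * V + Y * A) * (Q + 1).
    move=> E; have -> : (x * U + Y) * A = x * (A * U) + Y * A by ring.
    by rewrite E; ring.
  have E z c : z *+ c = z * c%:R :> O by rewrite mulr_natr.
  rewrite (E X) (E x) (E _ a) (E x) (E X) (E _ p) natrM.
  rewrite (_ : p%:R = p.-1%:R + 1); last by rewrite natr1 prednK.
  by apply: key; rewrite natr1 prednK // -!natrM av natrD.
apply: pmultB; first exact: pmultMn.
by exists (x *+ v + X *+ a); rewrite expn1.
Qed.

(** Expanding x digit by digit along the s i makes each coordinate converge to a p-adic integer, so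
    x is a combination of the s i with coefficients in S. *)
Lemma ps_closed x : (forall n, exists y, y \in ps_pred S /\ pmult n (x - y)) ->
  x \in ps_pred S.
Proof.
move=> hx; have [d [s [sS sE]]] := ps_residues.
pose cl z := forall n, exists y, y \in ps_pred S /\ pmult n (z - y).
pose Inv k (f : 'I_d -> O) := (forall i, exists u : nat, f i = u%:R) /\
  exists z, x = \sum_i s i * f i + z *+ p ^ k /\ cl z.
have S_B y z : y \in ps_pred S -> z \in ps_pred S -> y - z \in ps_pred S.
  by have [_ SB _] := ps_subring_closed S; apply: SB.
have [||l hl] := @approximation_limit p O O_complete 'I_d Inv (fun=> 0).
- split=> [i|]; first by exists 0%N.
  by exists x; split=> //; rewrite big1 ?add0r ?mulr1n // => i _; rewrite mulr0.
- move=> k f [/choice[w wE] [z [xE clz]]].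
  have [y [yS zy]] := clz 1%N; have [u [_ yu]] := sE y yS.
  set Y := \sum_i s i *+ u i in yu.
  have YS : Y \in ps_pred S.
    rewrite /Y; elim/big_rec: _ => [|i a _ ha]; first by rewrite (rpred0 (ps_pred S)).
    by rewrite (rpredD (S := ps_pred S)) // rpredMn.
  have zY := pmult_trans zy yu; have [z'] := zY; rewrite expn1 => z'E.
  exists (fun i => f i + (u i)%:R *+ p ^ k); split; last first.
    by move=> i; rewrite addrAC subrr add0r; exists (u i)%:R.
  split=> [i|]; first by exists (w i + u i * p ^ k)%N; rewrite wE natrD natrM mulr_natr.
  exists z'; split.
    rewrite xE (_ : z = Y + z' *+ p); last by rewrite -z'E; abel.
    rewrite mulrnDl addrA -mulrnA -expnS; congr (_ + _).
    rewrite /Y -sumrMnl -big_split; apply: eq_bigr => i _.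
    by rewrite mulrDr mulrnAr mulr_natr.
  move=> n; have [y' [y'S zy']] := clz n.+1.
  (* y' approximates z one digit further than required, so that (y' - Y)/p, which is in S by purity,
     approximates z' to order n. *)
  have [y''] : pmult 1 (y' - Y).
    apply: pmult_trans zY; apply: pmultBC; exact: pmult_le zy'.
  rewrite expn1 => y''E; exists y''; split.
    by apply: (@ps_divn p); rewrite ?prime_gt0 // -y''E; apply: S_B.
  apply: (pmultS p_prime O_tf); rewrite mulrnBl.
  by rewrite -z'E -y''E opprB addrA subrK.
have lz i : zp p (l i).
  move=> n; have [f [[/(_ i)[u fE] _] hf]] := hl n.
  by exists u; rewrite -[u%:~R]/(u%:R) -fE.
have -> : x = \sum_i s i * l i.
  apply: (pmult_eq O_sep) => n; have [f [[_ [z [-> _]]] hf]] := hl n.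
  rewrite addrAC -sumrB; apply: pmultD; last by exists z.
  by apply: pmult_sum => i; rewrite -mulrBr; apply/pmultMl/pmultBC.
elim/big_rec: _ => [|i a _ ha]; first by rewrite (rpred0 (ps_pred S)).
rewrite (rpredD (S := ps_pred S)) // (rpredM (s := ps_pred S)) //.
exact: ps_zp.
Qed.

Lemma ps_closed_subring : closed_subring p in_S.
Proof.
have [S1 SB SM] := ps_subring_closed S.
split=> // [n x|x]; [exact: ps_divn | exact: ps_closed].
Qed.

Lemma ps_finite_residues n : exists L : seq O, {subset L <= ps_pred S} /\
  forall x, x \in ps_pred S -> exists2 r, r \in L & pmult n (x - r).
Proof.
have [S1 SB SM] := ps_subring_closed S.
have [d [s [sS sE]]] := ps_residues.
elim: n => [|n [L [LS LE]]].
  exists [:: 0]; split=> [x|x _]; first by rewrite inE => /eqP ->; rewrite -(subrr 1) SB.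
  by exists 0; [rewrite mem_head | apply: pmult_0].
pose L1 := [seq \sum_i s i *+ (u i : nat) | u : {ffun 'I_d -> 'I_p}].
have L1S x : x \in L1 -> x \in ps_pred S.
  move=> /mapP[u _ ->]; elim/big_rec: _ => [|i a _ ha]; first by rewrite (rpred0 (ps_pred S)).
  by rewrite (rpredD (S := ps_pred S)) // rpredMn.
exists [seq r1 + r *+ p | r1 <- L1, r <- L]; split=> x.
  move=> /allpairsP[[r1 r] /= [/L1S r1S /LS rS ->]].
  by rewrite (rpredD (S := ps_pred S)) // rpredMn.
move=> xS; have [u [up ux]] := sE x xS.
set r1 := \sum_i _ in ux.
have r1L : r1 \in L1.
  apply/mapP; exists [ffun i => Ordinal (up i)]; first by rewrite mem_enum.
  by apply: eq_bigr => i _; rewrite ffunE.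
have [y] := ux; rewrite expn1 => yE; have yS : y \in ps_pred S.
  by apply: (@ps_divn p); rewrite ?prime_gt0 // -yE SB // L1S.
have [r rL [z zE]] := LE y yS; exists (r1 + r *+ p).
  by apply/allpairsP; exists (r1, r).
by exists z; rewrite opprD addrA yE -mulrnBl zE expnSr mulrnA.
Qed.

End OneSubring.

End PadicSubringTheory.

(** * Density of the elements that are algebraic over the p-adic numbers *)

(* The order of z is finite, and its p-part is trivial in characteristic p. *)
Lemma algebraic_closure_Fp_root (p : nat) (k : fieldType) (z : k) : prime p ->
  algebraic_closure_Fp p k -> z != 0 ->
  p%:R = 0 :> k /\ exists r, [/\ (0 < r)%N, coprime p r & z ^+ r = 1].
Proof.
move=> p_prime [_ [iota /(_ z)[q q0 qz]]] z0.
have pk : p%:R = 0 :> k.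
  by rewrite -(rmorph_nat iota) (_ : p%:R = 0) ?rmorph0 //; apply: pchar_Fp_0.
split=> //.
have zE i : z ^+ i = (map_poly iota ('X^i %% q)).[z].
  have := congr1 (fun f => (map_poly iota f).[z]) (divp_eq 'X^i q).
  by rewrite rmorphD rmorphM /= map_polyXn hornerXn !hornerE (rootP qz) mulr0 add0r.
pose T := {ffun 'I_(size q) -> 'F_p}.
(* There is one more power of X than there are remainders modulo q over F_p, so two powers of z
   coincide. *)
pose c (i : 'I_#|T|.+1) : T := [ffun j : 'I_(size q) => ('X^i %% q)`_j].
have /injectivePn[i [j ij cij]] : ~~ injectiveb c.
  apply/negP => /injectiveP/leq_card; by rewrite card_ord ltnn.
have {}cij : 'X^i %% q = 'X^j %% q.
  apply/polyP => a; have [aq|qa] := ltnP a (size q).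
    by have /ffunP/(_ (Ordinal aq)) := cij; rewrite !ffunE.
  by rewrite !nth_default // (leq_trans _ qa) // ltnW // ltn_modp.
have zz : z ^+ i = z ^+ j by rewrite !zE cij.
have [t t0 zt] : exists2 t, (0 < t)%N & z ^+ t = 1.
  wlog ltij : i j ij cij zz / (i < j)%N.
    move=> wl; have [|ji|/val_inj eij] := ltngtP i j; first exact: wl.
      by apply: (wl j i) => //; rewrite eq_sym.
    by rewrite eij eqxx in ij.
  exists (j - i)%N; first by rewrite subn_gt0.
  apply: (mulfI (expf_neq0 i z0)).
  by rewrite -exprD subnKC ?mulr1 // ltnW.
have [r pr tE] := pfactor_coprime p_prime t0.
have r0 : (0 < r)%N by move: t0; rewrite tE; case: r {pr tE}.
exists r; split=> //.
have pch : p \in [pchar k] by rewrite inE p_prime pk eqxx.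
have pn : [pchar k].-nat (p ^ logn p t)%N.
  by rewrite pnatX pnatE // pch.
apply/eqP; rewrite -subr_eq0; apply/eqP.
(* By Frobenius this power is z^t - 1, where t is r times a power of p. *)
have : (z ^+ r - 1) ^+ (p ^ logn p t) = 0.
  rewrite exprDn_pchar // exprNn_pchar // expr1n -exprM -tE zt subrr //.
by move/eqP; rewrite expf_eq0 => /andP[_ /eqP].
Qed.

Section Density.
Variables (p : nat) (O : idomainType) (m : set O) (k : fieldType).
Variable res : {rmorphism O -> k}.
Hypothesis p_prime : prime p.
Hypotheses (O_local : local_ring m) (O_complete : complete_ring m).
Hypotheses (O_char0 : [pchar O] =i pred0) (O_residue : residue_field m res).
Hypothesis k_closure : algebraic_closure_Fp p k.

Lemma residue_char : p%:R = 0 :> k.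
Proof.
by have [] := algebraic_closure_Fp_root p_prime k_closure (oner_neq0 k).
Qed.

Variable pi : O.
Hypothesis piP : forall x, m x <-> exists y, x = y * pi.

Let O_tf : torsion_free O := idomain_torsion_free O_char0.
Let pO_complete : padically_complete p O :=
  local_complete p_prime O_local O_complete O_char0 O_residue residue_char piP.
Let O_sep : padically_separated p O :=
  local_separated p_prime O_local O_complete O_char0 O_residue residue_char piP.

Lemma pmult_natr_dvd n : pmult p 1 (n%:R : O) -> (p %| n)%N.
Proof.
move=> [y yE]; apply: (maximal_natr p_prime O_local O_residue residue_char).
have [[_ _ mM] _ _] := O_local.1; rewrite yE expn1 -mulr_natr.
apply: mM; exact: (natr_in_maximal O_residue residue_char).
Qed.

Definition padic_algebraic (x : O) : Prop :=
  exists S : padic_subring p O, x \in ps_pred S.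

Lemma padic_algebraic_family (S : padic_subring p O) (s : seq O) :
  (forall x, x \in s -> padic_algebraic x) ->
  exists T : padic_subring p O, {subset S <= T} /\ {subset s <= ps_pred T}.
Proof.
elim: s => [|x s IHs] hs; first by exists S; split.
have [|T [ST sT]] := IHs; first by move=> y ys; apply: hs; rewrite inE ys orbT.
have [T' xT'] := hs x (mem_head _ _).
have [U [TU T'U]] := padic_subring_compositum p_prime O_tf pmult_natr_dvd T T'.
exists U; split=> [y /ST/TU//|y]; rewrite inE => /orP[/eqP ->|/sT/TU//].
exact: T'U.
Qed.

Lemma padic_algebraic2 x y : padic_algebraic x -> padic_algebraic y ->
  exists S : padic_subring p O, x \in ps_pred S /\ y \in ps_pred S.
Proof.
move=> [S xS] hy; have [|T [ST yT]] := @padic_algebraic_family S [:: y].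
  by move=> z; rewrite inE => /eqP ->.
by exists T; split; [apply: ST | apply: yT; rewrite mem_head].
Qed.

Lemma padic_algebraic_root (q : {poly O}) x : (forall i, padic_algebraic q`_i) ->
  q != 0 -> root q x -> padic_algebraic x.
Proof.
move=> hq q0 qx.
have [S0 _] := padic_subring_exists p_prime O_tf pmult_natr_dvd.
have [|S [_ sS]] := @padic_algebraic_family S0 q.
  by move=> c /(nthP 0)[i _ <-].
have qS : q \is a polyOver (ps_pred S).
  apply/polyOverP => i; have [iq|qi] := ltnP i (size q); first exact/sS/mem_nth.
  by rewrite nth_default // (rpred0 (ps_pred S)).
by have [T [_ xT]] := padic_subring_adjoin p_prime O_tf pmult_natr_dvd qS q0 qx; exists T.
Qed.

(** Strong form, with f'(x0) possibly a nonunit. In the Taylor expansion at x0, the increment f'(x0)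
    pi^(K+1) w lets f'(x0)^2 pi^(K+1) factor out, leaving a contraction for w. *)
Lemma hensel (f : {poly O}) x0 t K : f.[x0] = f^`().[x0] ^+ 2 * pi ^+ K.+1 * t ->
  exists w, root f (x0 + f^`().[x0] * pi ^+ K.+1 * w).
Proof.
set d := f^`().[x0] => fx0.
pose g := f \Po ('X + x0%:P); pose h := drop_poly 2 g.
pose c := d * pi ^+ K.+1.
have g0 : g`_0 = f.[x0] by rewrite -horner_coef0 horner_comp !hornerE.
have g1 : g`_1 = d.
  have -> : g`_1 = g^`()`_0 by rewrite coef_deriv.
  by rewrite -horner_coef0 deriv_comp !derivE addr0 mulr1 horner_comp !hornerE.
have fE z : f.[x0 + z] = f.[x0] + d * z + z ^+ 2 * h.[z].
  have -> : f.[x0 + z] = g.[z] by rewrite horner_comp !hornerE addrC.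
  rewrite -[g in LHS](poly_take_drop 2) hornerD hornerM hornerXn -/h [h.[z] * _]mulrC.
  congr (_ + _); rewrite horner_poly /take_poly !big_ord_recl big_ord0 /=.
  by rewrite g0 g1; ring.
have [w wE] := contraction_fixpoint O_complete piP
  (- (pi ^+ K *: ('X^2 * (h \Po (c *: 'X))))) (- t).
exists w; rewrite /root fE fx0 -/d -/c; apply/eqP.
have -> : d ^+ 2 * pi ^+ K.+1 * t + d * (c * w) + (c * w) ^+ 2 * h.[c * w]
    = d ^+ 2 * pi ^+ K.+1 * (t + w + pi * (pi ^+ K * (w ^+ 2 * h.[c * w]))).
  by rewrite /c [pi ^+ K.+1]exprS; ring.
rewrite [X in t + X + _]wE hornerN hornerZ hornerM hornerXn horner_comp hornerZ hornerX.
by rewrite mulrN addrA subrr add0r addNr mulr0.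
Qed.

(** Outside m, the residue of x is a root of unity of order r prime to p, hence a simple root of X^r
    - 1; inside m, 0 serves. *)
Lemma teichmuller x : exists z, padic_algebraic z /\ exists y, x - z = y * pi.
Proof.
have [S0 _] := padic_subring_exists p_prime O_tf pmult_natr_dvd.
have S0_1 : 1 \in ps_pred S0 by rewrite (rpred1 (ps_pred S0)).
have S0_0 : 0 \in ps_pred S0 by rewrite (rpred0 (ps_pred S0)).
have [mx|mx] := pselect (m x).
  by have /piP[y yE] := mx; exists 0; split; [exists S0 | exists y; rewrite subr0].
have resx : res x != 0 by apply/eqP => /O_residue.2.
have [_ [r [r0 pr rx]]] := algebraic_closure_Fp_root p_prime k_closure resx.
have xU : x \is a GRing.unit.
  exact: (local_unit O_local O_complete piP).
pose f : {poly O} := 'X^r - 1.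
have fS i : padic_algebraic f`_i.
  exists S0; rewrite coefB coefXn coef1.
  by rewrite (rpredB (S := ps_pred S0)) // (rpred_nat (ps_pred S0)).
have f0 : f != 0 by rewrite -size_poly_eq0 size_XnsubC.
pose d := f^`().[x].
have dU : d \is a GRing.unit.
  rewrite /d derivB derivXn derivC subr0 hornerMn hornerXn -mulr_natl unitrM unitrX // andbT.
  by apply: (prime_to_unit p_prime O_local O_complete O_residue residue_char piP);
    rewrite -prime_coprime.
have [s sE] : exists s, f.[x] = s * pi.
  by apply/piP/O_residue.2; rewrite /f hornerD hornerN hornerXn hornerC
    rmorphB rmorphXn /= rx rmorph1 subrr.
have [|w hw] := @hensel f x (s / d ^+ 2) 0.
  rewrite sE -/d expr1; have dd : d ^+ 2 * d ^- 2 = 1 by rewrite divrr ?unitrX.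
  move: (d ^- 2) dd => e dd; have -> : d ^+ 2 * pi * (s * e) = s * pi * (d ^+ 2 * e) by ring.
  by rewrite dd mulr1.
exists (x + d * pi ^+ 1 * w); split; first exact: padic_algebraic_root hw.
by exists (- (d * w)); rewrite opprD addrA subrr sub0r expr1; ring.
Qed.

Definition approximable (x : O) : Prop :=
  forall n, exists y, padic_algebraic y /\ pmult p n (x - y).

Lemma padic_algebraicB x y : padic_algebraic x -> padic_algebraic y ->
  padic_algebraic (x - y).
Proof.
move=> hx hy; have [S [xS yS]] := padic_algebraic2 hx hy.
by exists S; rewrite (rpredB (S := ps_pred S)).
Qed.

Lemma padic_algebraicM x y : padic_algebraic x -> padic_algebraic y ->
  padic_algebraic (x * y).
Proof.
move=> hx hy; have [S [xS yS]] := padic_algebraic2 hx hy.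
by exists S; rewrite (rpredM (s := ps_pred S)).
Qed.

Lemma padic_algebraic_nat n : padic_algebraic n%:R.
Proof.
have [S _] := padic_subring_exists p_prime O_tf pmult_natr_dvd.
by exists S; rewrite (rpred_nat (ps_pred S)).
Qed.

Lemma padic_algebraicD x y : padic_algebraic x -> padic_algebraic y ->
  padic_algebraic (x + y).
Proof.
move=> hx hy; rewrite -[y]opprK -[- y]sub0r; apply: padic_algebraicB => //.
exact/padic_algebraicB/hy/(padic_algebraic_nat 0).
Qed.

Lemma approximable_algebraic x : padic_algebraic x -> approximable x.
Proof. by move=> hx n; exists x; rewrite subrr; split=> //; apply: pmult0. Qed.

Lemma approximableD x y : approximable x -> approximable y -> approximable (x + y).
Proof.
move=> hx hy n; have [x' [ax xx']] := hx n; have [y' [ay yy']] := hy n.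
exists (x' + y'); split; first exact: padic_algebraicD.
by rewrite opprD addrACA; apply: pmultD.
Qed.

Lemma approximableM x y : approximable x -> approximable y -> approximable (x * y).
Proof.
move=> hx hy n; have [x' [ax xx']] := hx n; have [y' [ay yy']] := hy n.
exists (x' * y'); split; first exact: padic_algebraicM.
apply: (@pmult_trans _ _ _ (x' * y)).
  by rewrite -mulrBl; apply: pmultMr.
by rewrite -mulrBr; apply: pmultMl.
Qed.

Lemma approximable_sum (I : Type) (s : seq I) (F : I -> O) :
  (forall i, approximable (F i)) -> approximable (\sum_(i <- s) F i).
Proof.
move=> hF; elim/big_rec: _ => [|i x _]; last exact: approximableD.
exact/approximable_algebraic/(padic_algebraic_nat 0).
Qed.

Lemma approximableX x n : approximable x -> approximable (x ^+ n).
Proof.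
move=> hx; elim: n => [|n IHn]; last by rewrite exprS; apply: approximableM.
exact/approximable_algebraic/(padic_algebraic_nat 1).
Qed.

(** Digits are taken e at a time and pi^e is traded for p, so powers of pi beyond e - 1 never occur
    and the coefficients converge p-adically. This gives information on pi before pi itself is known
    to be approximable. *)
Lemma uniformizer_expansion : exists e, forall x, exists c : 'I_e -> O,
  (forall i, approximable (c i)) /\ x = \sum_i c i * pi ^+ i.
Proof.
have [e [u [e0 uU pE]]] :=
  natr_ramification p_prime O_local O_complete O_char0 O_residue residue_char piP.
have digits n x : exists (c : nat -> O) y, (forall i, padic_algebraic (c i)) /\
    x = \sum_(i < n) c i * pi ^+ i + y * pi ^+ n.
  elim: n => [|n [c [y [hc xE]]]].
    exists (fun=> 0), x; split=> [_|]; first exact: (padic_algebraic_nat 0).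
    by rewrite big_ord0 add0r expr0 mulr1.
  have [z [hz [y' yE]]] := teichmuller y.
  exists (fun i => if (i < n)%N then c i else z), y'; split=> [i|]; first by case: ifP.
  rewrite big_ord_recr /= ltnn xE -addrA; congr (_ + _).
    by apply: eq_bigr => i _; rewrite ltn_ord.
  by rewrite exprS mulrA -yE -mulrDl addrC subrK.
exists e => x.
pose Inv n (f : 'I_e -> O) := (forall i, padic_algebraic (f i)) /\
  exists y, x = \sum_i f i * pi ^+ i + y *+ p ^ n.
have [||l hl] := @approximation_limit p O pO_complete 'I_e Inv (fun=> 0).
- split=> [_|]; first exact: (padic_algebraic_nat 0).
  by exists x; rewrite big1 ?add0r ?mulr1n // => i _; rewrite mul0r.
- move=> n f [fA [y xE]]; have [c [z [hc yE]]] := digits e y.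
  exists (fun i => f i + c i *+ p ^ n); split; last first.
    by move=> i; rewrite addrAC subrr add0r; exists (c i).
  split=> [i|].
    apply: padic_algebraicD => //; rewrite -mulr_natr; apply: padic_algebraicM => //.
    exact: padic_algebraic_nat.
  (* The remainder z pi^e equals (z / u) p because p = u pi^e. *)
  exists (z / u); rewrite xE yE mulrnDl addrA; congr (_ + _).
    rewrite -sumrMnl -big_split; apply: eq_bigr => i _ /=.
    by rewrite mulrDl mulrnAl.
  by rewrite expnS mulrnA -[_ *+ p]mulr_natr pE mulrA divrK.
exists l; split=> [i n|].
  have [f [[fA _] hf]] := hl n; exists (f i); split=> //; exact: hf.
apply: (pmult_eq O_sep) => n; have [f [[_ [y ->]] hf]] := hl n.
rewrite addrAC -sumrB; apply: pmultD; last by exists y.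
by apply: pmult_sum => i; rewrite -mulrBl; apply/pmultMr/pmultBC.
Qed.

Lemma pmult_horner n (q r : {poly O}) x :
  (forall i, pmult p n (q`_i - r`_i)) -> pmult p n (q.[x] - r.[x]).
Proof.
move=> qr; rewrite -hornerN -hornerD horner_coef; apply: pmult_sum => i.
by rewrite coefB; apply: pmultMr.
Qed.

(** Krasner-type argument: minimality and characteristic 0 make f'(pi) nonzero, so a polynomial g
    with algebraic coefficients close to those of f has a root near pi. The expansion of pi^e
    supplies some f to start from. *)
Lemma approximable_uniformizer : approximable pi.
Proof.
have pi0 : pi != 0 := pi_neq0 p_prime O_char0 O_residue residue_char piP.
pose P n := `[< exists q : {poly O},
  [/\ forall i, approximable q`_i, q != 0, root q pi & size q = n] >].
have Pex : exists n, P n.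
  have [e /(_ (pi ^+ e))[c [hc piE]]] := uniformizer_expansion.
  pose q := 'X^e - \sum_i (c i *: 'X^i).
  have q0 : q != 0.
    apply/eqP => /(congr1 (fun f : {poly O} => f`_e)) /eqP.
    rewrite coefB coefXn eqxx coef_sum big1 ?subr0 ?coef0 ?oner_eq0 // => i _.
    by rewrite coefZ coefXn gtn_eqF ?mulr0.
  exists (size q); apply/asboolP; exists q; split=> // [i|].
    have -> : q`_i = (i == e)%:R + (-1) * \sum_(j < e) c j * (i == j)%:R.
      rewrite coefB coefXn coef_sum mulN1r; congr (_ - _).
      by apply: eq_bigr => j _; rewrite coefZ coefXn.
    apply: approximableD; first exact/approximable_algebraic/padic_algebraic_nat.
    apply: approximableM; last first.
      apply: approximable_sum => j; apply: approximableM => //.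
      exact/approximable_algebraic/padic_algebraic_nat.
    apply: approximable_algebraic; rewrite -sub0r; apply: padic_algebraicB.
      exact: (padic_algebraic_nat 0).
    exact: (padic_algebraic_nat 1).
  rewrite /root hornerD hornerN hornerXn horner_sum subr_eq0 {1}piE; apply/eqP.
  by apply: eq_bigr => i _; rewrite hornerZ hornerXn.
case: (ex_minnP Pex) => n /asboolP[f [fW f0 fpi fn]] nmin.
pose d := f^`().[pi].
have d0 : d != 0.
  apply/negP => df.
  have n1 : (1 < size f)%N.
    rewrite ltnNge; apply/negP => /size1_polyC fC; move: fpi f0.
    by rewrite fC /root hornerC polyC_eq0 => /eqP ->; rewrite eqxx.
  suff : P (size f^`()).
    by move=> /nmin; rewrite -fn leqNgt lt_size_deriv.
  apply/asboolP; exists f^`(); split=> // [i|].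
    rewrite coef_deriv -mulr_natr; apply: approximableM => //.
    exact/approximable_algebraic/padic_algebraic_nat.
  apply: contraNneq f0 => f'0; rewrite -lead_coef_eq0 lead_coefE.
  have := congr1 (fun g : {poly O} => g`_(size f).-2) f'0.
  rewrite coef_deriv coef0 (_ : (size f).-2.+1 = (size f).-1); last by lia.
  by move/O_tf => -> //; lia.
have [c [u [uU dE]]] := pi_factor O_local O_complete piP d0.
move=> N.
have [K hK] := pmult_pi p_prime O_local O_complete O_char0 O_residue residue_char piP N.
(* c is the valuation of f'(pi). As M > c, g'(pi) has the same valuation, and 2c + K + 1 is what
   [hensel] asks of g(pi) for a root within pi^K of pi. *)
pose M := (2 * c + K.+1)%N.
have /choice[a ha] i : exists y, padic_algebraic y /\ pmult p M (f`_i - y) by apply: fW.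
pose g := \poly_(i < size f) a i.
have fg i : pmult p M (f`_i - g`_i).
  rewrite coef_poly; case: ltnP => fi; first by case: (ha i).
  by rewrite nth_default // subrr; apply: pmult0.
have toPi j x : pmult p j x -> exists y, x = y * pi ^+ j :=
  @pi_pmult p O m k res p_prime O_local O_complete O_char0 O_residue residue_char pi piP j x.
have [s gs] : exists s, g.[pi] = s * pi ^+ M.
  apply: toPi; rewrite -[g.[pi]]subr0 -(rootP fpi).
  by apply: pmult_horner => i; apply: pmultBC.
have [v [vU gv]] : exists v, v \is a GRing.unit /\ g^`().[pi] = v * pi ^+ c.
  have [t tE] : exists t, d - g^`().[pi] = t * pi ^+ M.
    apply: toPi; apply: pmult_horner => i; rewrite !coef_deriv -mulrnBl.
    exact: pmultMn.
  exists (u - t * pi ^+ (M - c)); split; last first.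
    rewrite mulrBl -dE -mulrA -exprD subnK; last by rewrite /M; lia.
    by rewrite -tE subKr.
  apply: (local_unit O_local O_complete piP) => mu.
  have [[[_ mD mM] m1 _] _] := O_local; case: m1.
  rewrite -(mulVr uU); apply: (mM); rewrite -[u](subrK (t * pi ^+ (M - c))).
  apply: mD => //; apply/piP; exists (t * pi ^+ (M - c).-1).
  by rewrite -mulrA -exprSr prednK // /M; lia.
have [|w hw] := @hensel g pi (s / v ^+ 2) K.
  rewrite gs gv /M exprD mulnC exprM; have vv : v ^+ 2 * v ^- 2 = 1 by rewrite divrr ?unitrX.
  move: (v ^- 2) vv => t vv.
  have -> : (v * pi ^+ c) ^+ 2 * pi ^+ K.+1 * (s * t)
      = s * ((pi ^+ c) ^+ 2 * pi ^+ K.+1) * (v ^+ 2 * t) by ring.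
  by rewrite vv mulr1.
eexists; split; first apply: padic_algebraic_root hw.
- move=> i; rewrite coef_poly; case: ifP => _; first by case: (ha i).
  exact: (padic_algebraic_nat 0).
- apply: contraTneq vU => g0; move: gv; rewrite g0 deriv0 horner0 => /esym/eqP.
  by rewrite mulf_eq0 expf_eq0 (negbTE pi0) andbF orbF => /eqP ->; rewrite unitr0.
apply: hK; exists (- (v * pi ^+ c * pi * w)).
by rewrite gv opprD addrA subrr sub0r exprS; ring.
Qed.

Theorem padic_algebraic_dense x n :
  exists y, padic_algebraic y /\ pmult p n (x - y).
Proof.
suff : approximable x by apply.
have [e /(_ x)[c [hc ->]]] := uniformizer_expansion.
apply: approximable_sum => i; apply: approximableM => //.
exact/approximableX/approximable_uniformizer.
Qed.

End Density.

(** * Bimodules as idempotent representations over the group algebra *)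

HB.instance Definition _ (R : comPzRingType) (gT : finGroupType) :=
  GRing.PzRing.on (grpalg R gT).

Section GroupAlgebraMap.
Variables (R0 R1 : comPzRingType) (iota : {rmorphism R0 -> R1}) (gT : finGroupType).

Lemma grpalg_map_zmod : zmod_morphism (@grpalg_map R0 R1 iota gT).
Proof. by move=> x y; apply/ffunP => g; rewrite !ffunE rmorphB. Qed.

Lemma grpalg_map_monoid : monoid_morphism (@grpalg_map R0 R1 iota gT).
Proof.
split=> [|x y]; last exact: grpalg_mapM.
by apply/ffunP => g; rewrite !ffunE rmorph_nat.
Qed.

HB.instance Definition _ := GRing.isZmodMorphism.Build (grpalg R0 gT) (grpalg R1 gT)
  (@grpalg_map R0 R1 iota gT) grpalg_map_zmod.
HB.instance Definition _ := GRing.isMonoidMorphism.Build (grpalg R0 gT) (grpalg R1 gT)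
  (@grpalg_map R0 R1 iota gT) grpalg_map_monoid.

Lemma grpalg_map_gscal c : grpalg_map iota (gscal gT c) = gscal gT (iota c).
Proof. by apply/ffunP => g; rewrite !ffunE rmorphMn. Qed.
End GroupAlgebraMap.

Section Represents.
Variables (R : comPzRingType) (gT : finGroupType) (b : grpalg R gT).
Variable hb : central_idempotent b.
Local Notation A := (grpalg R gT).
Local Notation B := (block hb).

(* M is the left ideal A^D rho(1) of row vectors, on which g acts on the right
   by rho g. *)
Definition represents D (rho : gT -> 'M[A]_D) (M : bimod B B) : Prop :=
  is_rep rho /\ exists Phi : M -> 'rV[A]_D,
  [/\ additivef Phi /\ injective Phi,
      forall (a : B) x, Phi (a *: x) = corner_val a *: Phi x,
      forall g x, Phi (bm_ract x (bel hb g)) = Phi x *m rho g &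
      forall v, v *m rho 1%g = v -> exists x, Phi x = v].

Lemma block_strE c : corner_val (ualg_str B c) = gscal gT c * b.
Proof. by []. Qed.

Section RepresentsTheory.
Variables (D : nat) (rho : gT -> 'M[A]_D) (M : bimod B B) (Phi : M -> 'rV[A]_D).
Hypotheses (rhoM : is_rep rho) (PhiD : additivef Phi) (PhiI : injective Phi).
Hypothesis PhiZ : forall (a : B) x, Phi (a *: x) = corner_val a *: Phi x.
Hypothesis PhiG : forall g x, Phi (bm_ract x (bel hb g)) = Phi x *m rho g.
Hypothesis PhiS : forall v, v *m rho 1%g = v -> exists x, Phi x = v.

Lemma represents_unit x : Phi x *m rho 1%g = Phi x.
Proof. by rewrite -PhiG bel1 ract1. Qed.

Lemma represents_b x : b *: Phi x = Phi x.
Proof. by rewrite -[in RHS](scale1r x) PhiZ corner_val1. Qed.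

Lemma represents_bE x j : Phi x 0 j * b = Phi x 0 j.
Proof. by rewrite -(proj2 hb) -[in RHS]represents_b mxE. Qed.

Lemma represents_ract x (a : B) :
  Phi (bm_ract x a) = \sum_g gscal gT (corner_val a g) *: (Phi x *m rho g).
Proof.
have rD : additivef (bm_ract x : B -> M) by move=> y z; apply: ractDr.
rewrite {1}[a]block_expand (additivef_sum _ _ rD) (additivef_sum _ _ PhiD).
apply: eq_bigr => g _; rewrite ractM -bm_central PhiG PhiZ block_strE.
by rewrite -scalerA represents_b scalemxAl.
Qed.

(** The rows of rho(1) are fixed by rho(1), so they come from M; expanding Phi x = Phi x rho(1)
    along them gives the coefficients. *)
Lemma represents_generators : exists m : 'I_D -> M,
  (forall i, Phi (m i) = row i (rho 1%g)) /\
  forall x, x = \sum_i corner_proj hb (Phi x 0 i) *: m i.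
Proof.
have /choice[m hm] i : exists y, Phi y = row i (rho 1%g).
  by apply: PhiS; rewrite -row_mul mulmxE rhoM mulg1.
exists m; split=> // x; apply: PhiI; rewrite (additivef_sum _ _ PhiD).
rewrite -[LHS]represents_unit mulmx_sum_row; apply: eq_bigr => i _.
by rewrite PhiZ hm /= represents_bE.
Qed.

Lemma represents_b_rho : b *: rho 1%g = rho 1%g.
Proof.
have [m [hm _]] := represents_generators.
by apply/row_matrixP => i; rewrite linearZ /= -hm represents_b.
Qed.

(** b acts on the right as the identity of M. With [represents_b_rho] on the left, these are the
    conditions under which [rep_bimod] turns a representation back into a bimodule. *)
Lemma represents_b_sum : \sum_g gscal gT (b g) *: rho g = rho 1%g.
Proof.
have [m [hm _]] := represents_generators.
apply/row_matrixP => i; rewrite -hm.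
have := represents_ract (m i) 1; rewrite ract1 corner_val1 => ->.
rewrite linear_sum; apply: eq_bigr => g _ /=.
by rewrite linearZ /= hm -row_mul mulmxE rhoM mul1g.
Qed.

End RepresentsTheory.

Lemma represents_rep_equiv D (rho sigma : gT -> 'M[A]_D) (M N : bimod B B) :
  represents rho M -> represents sigma N -> bimod_iso M N ->
  rep_equiv (fun=> True) rho sigma.
Proof.
move=> [rM [Phi [[PD PI] PZ PG PS]]] [sM [Psi [[QD QI] QZ QG QS]]].
case=> f [/lin_bij[f' [fK f'K]] fr].
have [m [hm mE]] := represents_generators rM PD PI PZ PG PS.
have [n [hn nE]] := represents_generators sM QD QI QZ QG QS.
pose P := \matrix_i Psi (f (m i)); pose Q := \matrix_i Phi (f' (n i)).
have PE x : Phi x *m P = Psi (f x).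
  rewrite {2}(mE x) linear_sum (additivef_sum _ _ QD) mulmx_sum_row.
  apply: eq_bigr => i _; rewrite linearZ QZ rowK /=.
  by rewrite (represents_bE PZ).
have QE y : Psi y *m Q = Phi (f' y).
  rewrite {2}(nE y) linear_sum (additivef_sum _ _ PD) mulmx_sum_row.
  apply: eq_bigr => i _; rewrite linearZ PZ rowK /=.
  by rewrite (represents_bE QZ).
exists P, Q; split=> //.
- by apply/row_matrixP => i; rewrite row_mul rowK QE fK hm.
- by apply/row_matrixP => i; rewrite row_mul rowK PE f'K hn.
- move=> g; apply/row_matrixP => i.
  rewrite !row_mul rowK -QG -fr -PE PG hm.
  by rewrite -[rho g in LHS](rho1l rM) row_mul.
Qed.

Lemma rep_equiv_iso D (rho sigma : gT -> 'M[A]_D) (M N : bimod B B) :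
  represents rho M -> represents sigma N ->
  rep_equiv (fun=> True) rho sigma -> bimod_iso M N.
Proof.
move=> [rM [Phi [[PD PI] PZ PG PS]]] [sM [Psi [[QD QI] QZ QG QS]]].
move=> [P [Q [_ _ PQ QP PE]]].
have QE := intertwiner_inverse rM sM PQ QP PE.
have /choice[f fE] x : exists y, Psi y = Phi x *m P.
  apply: QS; rewrite -mulmxA -[P *m _]/(P * _) -PE mulmxA.
  by rewrite (represents_unit PG).
have /choice[f' f'E] y : exists x, Phi x = Psi y *m Q.
  apply: PS; rewrite -mulmxA -[Q *m _]/(Q * _) -QE mulmxA.
  by rewrite (represents_unit QG).
have fD : additivef f by move=> x y; apply: QI; rewrite QD !fE PD mulmxDl.
have fZ a x : f (a *: x) = a *: f x by apply: QI; rewrite QZ !fE PZ scalemxAl.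
exists (lin_of fD fZ); split.
  exists f' => x; [apply: PI | apply: QI]; rewrite lin_ofE ?f'E ?fE ?f'E ?fE -mulmxA mulmxE.
    by rewrite PQ (represents_unit PG).
  by rewrite QP (represents_unit QG).
move=> x a; apply: QI; rewrite lin_ofE (represents_ract QD QZ QG).
rewrite !fE (represents_ract PD PZ PG) mulmx_suml; apply: eq_bigr => g _.
by rewrite -scalemxAl -!mulmxA !mulmxE PE.
Qed.
End Represents.

(** * Dual bases and Morita pairings *)

Section DualBases.
Variables (A : pzRingType) (M : lmodType A).

Definition dual_basis (s : seq (M * {linear M -> A^o})) : Prop :=
  forall x, x = \sum_(z <- s) (z.2 x : A) *: z.1.

Definition fg_projective : Prop := exists s, dual_basis s.

Definition zero_form : {linear M -> A^o} :=
  lin_of (f := fun _ : M => 0 : A^o) (fun x y => esym (addr0 0))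
    (fun a x => esym (scaler0 _ a)).

(** Padding allows two modules to be represented by matrices of the same size. *)
Lemma dual_basis_pad s n : dual_basis s -> dual_basis (s ++ nseq n (0, zero_form)).
Proof.
move=> hs x; rewrite big_cat /= -hs; elim: n => [|n IHn].
  by rewrite big_nil addr0.
by rewrite big_cons /= scaler0 add0r.
Qed.
End DualBases.

Section TensorPure.
Variables (R : comPzRingType) (A B : ualg R) (M : bimod A B) (U : lmodType B).

Lemma bm_tensor_sum (t : bm_tensor M U) :
  exists s : seq (M * U), t = \sum_(z <- s) bmt z.1 z.2.
Proof.
rewrite -[t]reprK; elim: (generic_quotient.repr t) => [|z s [s' IHs]].
  by exists [::]; rewrite big_nil.
exists (z :: s'); rewrite -cat1s (@pi_tensor_cat _ _ _ _ _ [:: z] s) big_cons -IHs.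
by case: z.
Qed.
End TensorPure.

Section MoritaPairing.
Variables (R : comPzRingType) (A : ualg R) (M : bimod A A).

(* The two pairings of a Morita context need not be associative for arbitrary
   choices of the isomorphisms; theta measures the failure. *)
Record morita_pairing (N : bimod A A) (f : M -> N -> A) (g : N -> M -> A)
    (theta : M -> M) : Prop := MoritaPairing {
  mp_fDl : forall n, additivef (fun m => f m n);
  mp_fDr : forall m, additivef (f m);
  mp_fZ : forall a m n, f (a *: m) n = a * f m n;
  mp_gDl : forall m, additivef (fun n => g n m);
  mp_thetaD : additivef theta;
  mp_thetaZ : forall a m, theta (a *: m) = a *: theta m;
  mp_thetaI : bijective theta;
  mp_assoc : forall m n m', theta (f m n *: m') = bm_ract m (g n m');
  mp_f1 : exists s, \sum_(z <- s) f z.1 z.2 = 1;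
  mp_g1 : exists s, \sum_(z <- s) g z.1 z.2 = 1
}.

(** theta is the composite M = A ⊗ M = (M ⊗ N) ⊗ M = M ⊗ (N ⊗ M) = M ⊗ A = M of the chosen
    isomorphisms, hence bijective. *)
Lemma morita_pairingP : morita M -> exists N f g theta, @morita_pairing N f g theta.
Proof.
move=> /moritaP[N [[f [fb fr]] [g [gb gr]]]].
have [f' [fK f'K]] := lin_bij fb; have [g' [gK g'K]] := lin_bij gb.
have f'r x a : f' (bm_ract x a) = bm_ract (f' x) a by rewrite -{1}[x]f'K -fr fK.
have [l' [lK l'K]] := lin_bij (@lunit_bij R A M).
have [c [cK c'K]] := lin_bij (asc_bij M N M).
pose F' y := tmapl M f'r (l' y).
pose G := runit M \o tmap M g.
pose theta y := G (c (F' y)).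
have thD : additivef theta.
  by move=> y z; rewrite /theta /F' /G /= !linearD.
have thZ a y : theta (a *: y) = a *: theta y.
  by rewrite /theta /F' /G /= !linearZ.
have fff y : tmapl M f'r (tmapl M fr y) = y.
  apply: (bmt_ext (f := fun x => tmapl M f'r (tmapl M fr x)) (g := id)) => // [|m u].
    exact: additivef_comp (lin_additivef _) (lin_additivef _).
  by rewrite !tmaplE fK.
have fff' y : tmapl M fr (tmapl M f'r y) = y.
  apply: (bmt_ext (f := fun x => tmapl M fr (tmapl M f'r x)) (g := id)) => // [|m u].
    exact: additivef_comp (lin_additivef _) (lin_additivef _).
  by rewrite !tmaplE f'K.
have ru_bij : bijective (runit M).
  exists (fun m => bmt m (1 : bimod_regular A)) => [|m]; last by rewrite runitE ract1.
  apply: (bmt_ext (f := fun x => bmt (runit M x) (1 : bimod_regular A))) => //.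
    exact: additivef_comp (@additivef_bmtl _ _ _ _ _ _) (lin_additivef _).
  by move=> m b; rewrite runitE bmtA; congr bmt; apply: mulr1.
exists N, (fun m n => f (bmt m n)), (fun n m => g (bmt n m)), theta; split=> //.
- by move=> n x y; rewrite bmtDl linearD.
- by move=> m x y; rewrite bmtDr linearD.
- by move=> a m n; rewrite -bmtZ; apply: (linearZZ f).
- by move=> m x y; rewrite bmtDl linearD.
- apply: (bij_comp (f := G \o c)).
    apply: bij_comp; last by exists (asc M N M).
    by apply: bij_comp => //; exists (tmap M g'); apply: tmap_cancel.
  apply: bij_comp; last by exists (lunit M).
  by exists (tmapl M fr).
- move=> m n m'; rewrite /theta /F'.
  have -> : f (bmt m n) *: m' = lunit M (tmapl M fr (bmt (bmt m n : bimod_tensor M N) m')).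
    by rewrite tmaplE lunitE.
  by rewrite lK fff -ascE cK /G /= tmapE runitE.
- have [s sE] := bm_tensor_sum (f' 1); exists s.
  by rewrite -[RHS]f'K sE linear_sum.
- have [s sE] := bm_tensor_sum (g' 1); exists s.
  by rewrite -[RHS]g'K sE linear_sum.
Qed.

(** Writing 1 as a sum of values g(n, m), x is the sum of the x g(n, m) = theta(f(x, n) m) = f(x, n)
    theta(m). *)
Lemma morita_fg_projective : morita M -> fg_projective M.
Proof.
move=> /morita_pairingP[N [f [g [th [fDl fDr fZ gDl thD thZ _ thA _ [s sE]]]]]].
exists [seq (th z.2, @lin_of A M A^o (f^~ z.1) (fDl z.1) (fun a m => fZ a m z.1))
  | z <- s] => x.
rewrite big_map -[LHS]ract1 -sE.
have rD : additivef (bm_ract x : A -> M) by move=> y z; apply: ractDr.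
by rewrite (additivef_sum _ _ rD); apply: eq_bigr => z _ /=; rewrite -thA thZ.
Qed.
End MoritaPairing.

Section TensorProjective.
Variables (R : comPzRingType) (A : ualg R) (M N : bimod A A).

Section Form.
Variables (phi : {linear M -> A^o}) (psi : {linear N -> A^o}).

Lemma tensor_form_balanced :
  bm_balanced (fun (x : M) (y : N) => phi (bm_ract x (psi y : A)) : A^o).
Proof.
split=> [m m' u|m u u'|m a u].
- by rewrite ractDl linearD.
- by rewrite linearD ractDr linearD.
- by rewrite -ractM; congr (phi (bm_ract _ _)); apply/esym/(linearZZ psi).
Qed.

Definition tensor_form_fun : bm_tensor M N -> A^o :=
  bm_lift (fun x y => phi (bm_ract x (psi y : A)) : A^o).

Lemma tensor_form_funD : additivef tensor_form_fun.
Proof. exact/bm_lift_additivef/tensor_form_balanced. Qed.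

Lemma tensor_form_funE x y : tensor_form_fun (bmt x y) = phi (bm_ract x (psi y : A)).
Proof. exact/bm_liftE/tensor_form_balanced. Qed.

Lemma tensor_form_funZ a t : tensor_form_fun (a *: t) = a *: tensor_form_fun t.
Proof.
apply: (bmt_ext (f := fun t => tensor_form_fun (a *: t))
  (g := fun t => a *: tensor_form_fun t)) => [||x y].
- by move=> v w; rewrite scalerDr tensor_form_funD.
- by move=> v w; rewrite tensor_form_funD scalerDr.
- by rewrite bmtZ !tensor_form_funE ractZ linearZ.
Qed.

Definition tensor_form : {linear bm_tensor M N -> A^o} :=
  lin_of tensor_form_funD tensor_form_funZ.

Lemma tensor_formE x y : tensor_form (bmt x y) = phi (bm_ract x (psi y : A)).
Proof. exact: tensor_form_funE. Qed.
End Form.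

(** The forms are x ⊗ y -> phi(x psi(y)). In [morita_descend] the factors are not yet known to be
    invertible, so projectivity of their product needs this direct argument. *)
Lemma fg_projective_tensor : fg_projective M -> fg_projective N ->
  fg_projective (bimod_tensor M N).
Proof.
move=> [s hs] [t ht].
exists [seq (bmt z.1 w.1, tensor_form z.2 w.2) | z <- s, w <- t].
apply: (bmt_ext (f := id)) => // [|x y].
  move=> u v; rewrite -big_split; apply: eq_bigr => z _ /=.
  by rewrite linearD scalerDl.
rewrite big_flatten big_map.
under eq_bigr => z _ do rewrite big_map.
rewrite exchange_big /= {1}(ht y).
rewrite (additivef_sum _ _ (@additivef_bmtr _ _ _ M N x)); apply: eq_bigr => w _.
rewrite -bmtA {1}(hs (bm_ract x (w.2 y : A))).
rewrite (additivef_sum _ _ (@additivef_bmtl _ _ _ M N w.1)); apply: eq_bigr => z _.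
by rewrite bmtZ tensor_formE.
Qed.
End TensorProjective.

Lemma fg_projective_regular (R : comPzRingType) (A : ualg R) :
  fg_projective (bimod_regular A).
Proof.
exists [:: (1 : A, lin_of (f := @id A^o) (fun x y => erefl) (fun a x => erefl))] => x.
by rewrite big_seq1 /=; apply/esym/mulr1.
Qed.

Section RepresentsExistence.
Variables (R : comPzRingType) (gT : finGroupType) (b : grpalg R gT).
Variable hb : central_idempotent b.
Local Notation A := (grpalg R gT).
Local Notation B := (block hb).

Lemma represents_fg_projective D (rho : gT -> 'M[A]_D) (M : bimod B B) :
  represents rho M -> fg_projective M.
Proof.
move=> [rM [Phi [[PD PI] PZ PG PS]]].
have [m [hm mE]] := represents_generators rM PD PI PZ PG PS.
have phiD i : additivef (fun x => corner_proj hb (Phi x 0 i) : B^o).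
  move=> x y; apply: corner_inj; rewrite corner_valD /= PD mxE mulrDl //.
have phiZ i (a : B) x : corner_proj hb (Phi (a *: x) 0 i) = a *: (corner_proj hb (Phi x 0 i) : B^o).
  apply: corner_inj; rewrite /= PZ mxE.
  rewrite -[RHS]/(corner_val (a * corner_proj hb (Phi x 0 i))) corner_valM /= mulrA //.
exists [seq (m i, lin_of (phiD i) (phiZ i)) | i <- enum 'I_D] => x.
by rewrite big_map big_enum; apply: mE.
Qed.

(** rho(g) is the matrix of right multiplication by g on the m i. These are not a basis in general,
    so rho(1) is only idempotent. *)
Lemma dual_basis_represents (M : bimod B B) s : dual_basis (M := M) s ->
  exists rho : gT -> 'M[A]_(size s), represents rho M.
Proof.
move=> hs; pose d0 : M * {linear M -> B^o} := (0, zero_form M).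
pose m (i : 'I_(size s)) := (nth d0 s i).1.
pose phi (i : 'I_(size s)) x : B := (nth d0 s i).2 x.
have sE x : x = \sum_i phi i x *: m i by rewrite {1}(hs x) (big_nth d0) big_mkord.
have phiD i : additivef (phi i) by move=> x y; rewrite /phi linearD.
have phiZ i a x : phi i (a *: x) = a * phi i x by apply: (linearZZ (nth d0 s i).2).
have phiE x i g : phi i (bm_ract x g) = \sum_j phi j x * phi i (bm_ract (m j) g).
  have rD : additivef (fun x : M => bm_ract x g) by move=> y z; apply: ractDl.
  rewrite {1}(sE x) (additivef_sum _ _ rD) (additivef_sum _ _ (phiD i)).
  by apply: eq_bigr => j _; rewrite ractZ phiZ.
pose rho g : 'M[A]_(size s) := \matrix_(i, j) corner_val (phi j (bm_ract (m i) (bel hb g))).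
exists rho; split.
  move=> g h; apply/matrixP => i j; rewrite mxE (mxE _ _ i j) -belM ractM phiE corner_val_sum.
  by apply: eq_bigr => l _; rewrite corner_valM !mxE.
exists (fun x => \row_j corner_val (phi j x)); split.
- split=> [x y|x y /rowP xy].
    by apply/rowP => j; rewrite !mxE phiD corner_valD.
  rewrite (sE x) (sE y); apply: eq_bigr => j _; congr (_ *: _).
  by apply: corner_inj; have := xy j; rewrite !mxE.
- by move=> a x; apply/rowP => j; rewrite !mxE phiZ corner_valM.
- move=> g x; apply/rowP => j; rewrite !mxE phiE corner_val_sum.
  by apply: eq_bigr => l _; rewrite corner_valM !mxE.
move=> v vE; exists (\sum_i corner_proj hb (v 0 i) *: m i); apply/rowP => j.
rewrite mxE (additivef_sum _ _ (phiD j)) corner_val_sum -[in RHS]vE mxE.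
apply: eq_bigr => i _; rewrite phiZ corner_valM mxE bel1 ract1 /=.
by rewrite -mulrA (proj2 hb) corner_valE.
Qed.

Lemma fg_projective_represents (M : bimod B B) : fg_projective M ->
  exists D0, forall D, (D0 <= D)%N -> exists rho : gT -> 'M[A]_D, represents rho M.
Proof.
move=> [s hs]; exists (size s) => D sD.
have [rho hrho] := dual_basis_represents (dual_basis_pad (D - size s) hs).
have szE : size (s ++ nseq (D - size s) (0, zero_form M)) = D.
  by rewrite size_cat size_nseq subnKC.
by move: rho hrho; rewrite szE => rho hrho; exists rho.
Qed.

(** * The bimodule of a given representation *)

Section Construction.
Variables (D : nat) (rho : gT -> 'M[A]_D).
Hypotheses (rhoM : is_rep rho) (rho_b : b *: rho 1%g = rho 1%g).
Hypothesis rho_bsum : \sum_g gscal gT (b g) *: rho g = rho 1%g.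

Definition rep_pred : {pred 'rV[A]_D} := [pred v | v *m rho 1%g == v].

Lemma rep_zmod_closed : zmod_closed rep_pred.
Proof.
split=> [|x y]; first by rewrite inE mul0mx.
by rewrite !inE => /eqP xb /eqP yb; rewrite mulmxBl xb yb.
Qed.

HB.instance Definition _ :=
  GRing.isZmodClosed.Build 'rV[A]_D rep_pred rep_zmod_closed.

Record rep_type := RepElt { rep_val : 'rV[A]_D; rep_valP : rep_val \in rep_pred }.
HB.instance Definition _ := [isSub for rep_val].
HB.instance Definition _ := [Choice of rep_type by <:].
HB.instance Definition _ := [SubChoice_isSubZmodule of rep_type by <:].

Lemma rep_valD x y : rep_val (x + y) = rep_val x + rep_val y.
Proof. exact: (raddfD (val : rep_type -> 'rV[A]_D)). Qed.

Lemma rep_val1 x : rep_val x *m rho 1%g = rep_val x.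
Proof. exact/eqP/(rep_valP x). Qed.

Lemma rep_inj : injective rep_val.
Proof. exact: val_inj. Qed.

Lemma rep_scale_in (a : B) x : corner_val a *: rep_val x \in rep_pred.
Proof. by rewrite inE -scalemxAl rep_val1. Qed.

Definition rep_scale (a : B) x := RepElt (rep_scale_in a x).

Lemma rep_scaleA a c x : rep_scale a (rep_scale c x) = rep_scale (a * c) x.
Proof.
apply: rep_inj; rewrite -[RHS]/(corner_val (a * c) *: rep_val x).
by rewrite corner_valM -scalerA.
Qed.

Lemma rep_b x : b *: rep_val x = rep_val x.
Proof.
rewrite -rep_val1 -[in RHS]rho_b mulmx_sum_row scaler_sumr [RHS]mulmx_sum_row.
apply: eq_bigr => i _; rewrite linearZ /= !scalerA; congr (_ *: _).
exact: (proj2 hb).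
Qed.

Lemma rep_scale1 : left_id 1 rep_scale.
Proof.
move=> x; apply: rep_inj; rewrite -[LHS]/(corner_val 1 *: rep_val x).
by rewrite corner_val1 rep_b.
Qed.

Lemma rep_scaleDr : right_distributive rep_scale +%R.
Proof.
move=> a x y; apply: rep_inj; rewrite [RHS]rep_valD.
by rewrite -[LHS]/(corner_val a *: rep_val (x + y)) rep_valD scalerDr.
Qed.

Lemma rep_scaleDl x : {morph rep_scale^~ x : a c / a + c}.
Proof.
move=> a c; apply: rep_inj; rewrite rep_valD.
by rewrite -[LHS]/(corner_val (a + c) *: rep_val x) corner_valD scalerDl.
Qed.

HB.instance Definition _ := GRing.Zmodule_isLmodule.Build B rep_type
  rep_scaleA rep_scale1 rep_scaleDr rep_scaleDl.

Lemma rep_valZ (a : B) x : rep_val (a *: x) = corner_val a *: rep_val x.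
Proof. by []. Qed.

Definition rep_sum (a : A) : 'M[A]_D := \sum_g gscal gT (a g) *: rho g.

Lemma gscal_mulmx c (X : 'M[A]_D) n (v : 'M[A]_(n, D)) :
  v *m (gscal gT c *: X) = gscal gT c *: (v *m X).
Proof.
apply/matrixP => i j; rewrite !mxE mulr_sumr; apply: eq_bigr => l _.
by rewrite mxE !mulrA gscal_central.
Qed.

Lemma rep_sumM a c : rep_sum (a * c) = rep_sum a *m rep_sum c.
Proof.
rewrite /rep_sum mulmx_suml.
under eq_bigr => g _ do rewrite grpalgM.
under [RHS]eq_bigr => h _ do rewrite mulmx_sumr (reindex_inj (mulgI h^-1%g)) /=.
rewrite [RHS]exchange_big /=; apply: eq_bigr => g _.
rewrite (big_morph (gscal gT) (@gscalD R gT) (id1 := 0)); last first.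
  by apply/ffunP => h; rewrite !ffunE mul0rn.
rewrite scaler_suml; apply: eq_bigr => h _.
rewrite -scalemxAl gscal_mulmx mulmxE rhoM mulKVg scalerA.
by rewrite -gscalM.
Qed.

Lemma rep_sumD a c : rep_sum (a + c) = rep_sum a + rep_sum c.
Proof.
by rewrite -big_split; apply: eq_bigr => g _; rewrite ffunE gscalD scalerDl.
Qed.

Lemma rep_sum_r a : rep_sum a *m rho 1%g = rep_sum a.
Proof.
rewrite mulmx_suml; apply: eq_bigr => g _.
by rewrite -scalemxAl mulmxE rhoM mulg1.
Qed.

Lemma rep_ract_in (a : B) x : rep_val x *m rep_sum (corner_val a) \in rep_pred.
Proof. by rewrite inE -mulmxA rep_sum_r. Qed.

Definition rep_ract x (a : B) := RepElt (rep_ract_in a x).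

Lemma rep_ract1 x : rep_ract x 1 = x.
Proof.
apply: rep_inj; rewrite -[RHS]rep_val1 -rho_bsum.
by rewrite -[LHS]/(rep_val x *m rep_sum (corner_val 1)) corner_val1.
Qed.

Lemma rep_ractM x a c : rep_ract x (a * c) = rep_ract (rep_ract x a) c.
Proof.
apply: rep_inj; rewrite -[LHS]/(rep_val x *m rep_sum (corner_val (a * c))).
by rewrite corner_valM rep_sumM mulmxA.
Qed.

Lemma rep_ractDl x y a : rep_ract (x + y) a = rep_ract x a + rep_ract y a.
Proof.
apply: rep_inj; rewrite [RHS]rep_valD.
by rewrite -[LHS]/(rep_val (x + y) *m rep_sum (corner_val a)) rep_valD mulmxDl.
Qed.

Lemma rep_ractDr x a c : rep_ract x (a + c) = rep_ract x a + rep_ract x c.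
Proof.
apply: rep_inj; rewrite rep_valD.
by rewrite -[LHS]/(rep_val x *m rep_sum (corner_val (a + c))) corner_valD rep_sumD mulmxDr.
Qed.

Lemma rep_ractZ (a : B) x c : rep_ract (a *: x) c = a *: rep_ract x c.
Proof. by apply: rep_inj; rewrite /= scalemxAl. Qed.

Lemma rep_sum_scal c : rep_sum (gscal gT c) = gscal gT c *: rho 1%g.
Proof.
rewrite /rep_sum (bigD1 1%g) //= big1 ?addr0 => [|g /negbTE g1].
  by rewrite ffunE eqxx.
rewrite ffunE g1 mulr0n (_ : gscal gT 0 = 0) ?scale0r //.
by apply/ffunP => h; rewrite !ffunE mul0rn.
Qed.

Lemma rep_central (c : R) x : ualg_str B c *: x = rep_ract x (ualg_str B c).
Proof.
apply: rep_inj; rewrite rep_valZ -[RHS]/(rep_val x *m rep_sum (gscal gT c * b)).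
rewrite rep_sumM rep_sum_scal -scalerA rep_b -scalemxAl gscal_mulmx; congr (_ *: _).
by rewrite /rep_sum rho_bsum mulmxE rhoM mul1g rep_val1.
Qed.

Definition rep_bimod : bimod B B := @Bimod R B B rep_type rep_ract
  rep_ract1 rep_ractM rep_ractDl rep_ractDr rep_ractZ rep_central.

Lemma rep_bimod_represents : represents rho rep_bimod.
Proof.
split=> //; exists rep_val; split=> //.
- by split; [exact: rep_valD | exact: rep_inj].
- move=> g x; rewrite -[LHS]/(rep_val x *m rep_sum (gel R g * b)) rep_sumM.
  rewrite {2}/rep_sum rho_bsum rep_sum_r; congr (_ *m _).
  rewrite /rep_sum (bigD1 g) //= big1 ?addr0 => [|h /negbTE hg].
    by rewrite ffunE eqxx scale1r.
  rewrite ffunE hg (_ : gscal gT 0 = 0) ?scale0r //.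
  by apply/ffunP => l; rewrite !ffunE mul0rn.
- by move=> v /eqP hv; exists (RepElt hv).
Qed.

End Construction.
End RepresentsExistence.

(** * Extension of scalars on matrices *)

Section RepresentsExtension.
Variables (R0 R1 : comPzRingType) (iota : {rmorphism R0 -> R1}).
Variables (gT : finGroupType) (b0 : grpalg R0 gT) (b1 : grpalg R1 gT).
Variables (hb0 : central_idempotent b0) (hb1 : central_idempotent b1).
Hypothesis eqb : grpalg_map iota b0 = b1.
Local Notation gmap := (@grpalg_map R0 R1 iota gT).

Lemma represents_ext D (rho : gT -> 'M[grpalg R0 gT]_D) (M : bimod (block hb0) (block hb0)) :
  represents rho M ->
  represents (fun g => map_mx gmap (rho g)) (bimod_ext hb1 eqb M).
Proof.
move=> [rM [Phi [[PD PI] PZ PG PS]]].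
have [m [hm mE]] := represents_generators rM PD PI PZ PG PS.
have mapM : is_rep (fun g => map_mx gmap (rho g)).
  by move=> g h; rewrite -rM /GRing.mul /= map_mxM.
split=> //.
pose f (r : R1) (x : M) : 'rV[grpalg R1 gT]_D := gscal gT r *: map_mx gmap (Phi x).
have fb : ext_balanced iota (M := M) f.
  split=> [r q x|r x y|r c x].
  - by rewrite /f gscalD scalerDl.
  - by rewrite /f PD map_mxD scalerDr.
  - rewrite /f gscalM PZ block_strE -scalerA; congr (_ *: _).
    rewrite -scalerA (represents_b PZ); apply/matrixP => i j.
    by rewrite !mxE rmorphM /= grpalg_map_gscal.
pose Psi := ext_lift (iota := iota) f : ext_mod hb1 eqb M -> 'rV[grpalg R1 gT]_D.
have PsiD : additivef Psi by apply: ext_lift_additivef.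
have PsiE r x : Psi (ext_pure iota r x) = gscal gT r *: map_mx gmap (Phi x).
  exact: ext_liftE.
have mapZ a (v : 'rV[grpalg R0 gT]_D) : map_mx gmap (a *: v) = gmap a *: map_mx gmap v.
  by apply/matrixP => i j; rewrite !mxE rmorphM.
have gelZ g x : gel R1 g *: map_mx gmap (Phi x) = map_mx gmap (Phi (bel hb0 g *: x)).
  rewrite PZ mapZ /= rmorphM /= -scalerA -mapZ (represents_b PZ); congr (_ *: _).
  by apply/ffunP => h; rewrite !ffunE rmorph_nat.
have gscalZ r (a : grpalg R1 gT) (v : 'rV[grpalg R1 gT]_D) :
    a *: (gscal gT r *: v) = gscal gT r *: (a *: v).
  by rewrite !scalerA gscal_central.
have PsiZ (a : block hb1) t : Psi (a *: t) = corner_val a *: Psi t.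
  apply: (ext_ext (f := fun t : ext_mod hb1 eqb M => Psi (a *: t))
    (g := fun t => corner_val a *: Psi t)) => [||r x].
  - by move=> u v; rewrite scalerDr PsiD.
  - by move=> u v; rewrite PsiD scalerDr.
  rewrite ext_scaleE (additivef_sum _ _ PsiD) PsiE [in RHS](grpalg_expand (corner_val a)).
  rewrite scaler_suml; apply: eq_bigr => g _.
  by rewrite PsiE -gelZ gscalZ gscalM !scalerA mulrA -gscalM mulrC gscalM.
have PsiG g t : Psi (ext_ract t (bel hb1 g)) = Psi t *m map_mx gmap (rho g).
  apply: (ext_ext (f := fun t : ext_mod hb1 eqb M => Psi (ext_ract t (bel hb1 g)))
    (g := fun t => Psi t *m map_mx gmap (rho g))) => [||r x].
  - by move=> u v; rewrite ext_ractDl PsiD.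
  - by move=> u v; rewrite PsiD mulmxDl.
  by rewrite -(ext_elt_bel hb0 hb1 eqb) ext_elt_ract !PsiE PG map_mxM scalemxAl.
(* A left inverse of Psi, written on the generators; it replaces a flatness argument for
   injectivity. *)
pose h (v : 'rV[grpalg R1 gT]_D) : ext_mod hb1 eqb M :=
  \sum_i corner_proj hb1 (v 0 i) *: (ext_pure iota 1 (m i) : ext_mod hb1 eqb M).
have hK t : h (Psi t) = t.
  apply: (ext_ext (f := fun t => h (Psi t)) (g := id)) => //.
    move=> u v; rewrite /h -big_split; apply: eq_bigr => i _ /=.
    have -> : corner_proj hb1 (Psi (u + v) 0 i)
        = corner_proj hb1 (Psi u 0 i) + corner_proj hb1 (Psi v 0 i) :> block hb1.
      by apply: corner_inj; rewrite corner_valD /= PsiD mxE mulrDl.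
    by rewrite scalerDl.
  move=> r x; rewrite {2}(mE x) ext_pure_sumr; apply: eq_bigr => i _.
  rewrite PsiE -(ext_elt_scale hb1 eqb).
  have -> : (ext_pure iota r (m i) : ext_mod hb1 eqb M)
      = ualg_str (block hb1) r *: (ext_pure iota 1 (m i) : ext_mod hb1 eqb M).
    by rewrite ext_strE mulr1.
  rewrite scalerA -ualg_central; congr (_ *: _); apply: corner_inj.
  have -> : (gscal gT r *: map_mx gmap (Phi x)) 0 i = gscal gT r * gmap (Phi x 0 i).
    by rewrite !mxE.
  have E : corner_val (corner_proj hb0 (Phi x 0 i)) = Phi x 0 i.
    exact: (represents_bE PZ).
  rewrite [RHS]corner_valM ext_eltE // E block_strE.
  rewrite -[LHS]/(gscal gT r * gmap (Phi x 0 i) * b1).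
  by rewrite -!mulrA (proj2 hb1).
exists Psi; split=> //.
- by split=> // t u tu; rewrite -[t]hK -[u]hK tu.
- move=> v vE; exists (h v).
  rewrite (additivef_sum _ _ PsiD) -[RHS]vE mulmx_sum_row; apply: eq_bigr => i _.
  rewrite PsiZ PsiE gscal1 scale1r hm map_row /=.
  rewrite -scalerA; congr (_ *: _).
  rewrite -map_row -hm -eqb -mapZ; congr (map_mx _ _).
  exact: (represents_b PZ).
Qed.
End RepresentsExtension.

(** * Finiteness of Picard groups over a ring with finite residue rings *)

Section GroupAlgebraTopology.
Variables (p : nat) (R : comPzRingType) (gT : finGroupType).
Local Notation A := (grpalg R gT).

Lemma grpalgMn (x : A) n g : (x *+ n) g = x g *+ n.
Proof. by rewrite ffunMnE. Qed.

Lemma grpalgB (x y : A) g : (x - y) g = x g - y g.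
Proof. by rewrite !ffunE. Qed.

Lemma pmult_grpalg n (x : A) : pmult p n x <-> forall g, pmult p n (x g).
Proof.
split=> [[y ->] g|/choice[y yE]]; first by exists (y g); rewrite grpalgMn.
by exists [ffun g => y g]; apply/ffunP => g; rewrite grpalgMn ffunE.
Qed.

Lemma grpalg_complete : padically_complete p R -> padically_complete p A.
Proof.
move=> Rc u hu; have /choice[l hl] g : exists l, forall n, pmult p n (l - u n g).
  by apply: Rc => n; rewrite -grpalgB; have /pmult_grpalg := hu n.
exists [ffun g => l g] => n; apply/pmult_grpalg => g.
by rewrite grpalgB ffunE.
Qed.

Lemma grpalg_separated : padically_separated p R -> padically_separated p A.
Proof.
move=> Rs x hx; apply/ffunP => g; rewrite ffunE; apply: Rs => n.
by have /pmult_grpalg := hx n.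
Qed.

Lemma grpalg_torsion_free : torsion_free R -> torsion_free A.
Proof.
move=> Rt n x n0 xn; apply/ffunP => g; rewrite ffunE; apply: (Rt n) => //.
by rewrite -grpalgMn xn ffunE.
Qed.

Lemma grpalg_div N s : (forall x : R, exists y, y *+ N = x *+ p ^ s) ->
  forall x : A, exists y, y *+ N = x *+ p ^ s.
Proof.
move=> Rd x; have /choice[y yE] g := Rd (x g).
by exists [ffun g => y g]; apply/ffunP => g; rewrite !grpalgMn ffunE.
Qed.

Lemma grpalg_closed_subring (S : R -> Prop) : closed_subring p S ->
  closed_subring p (fun x : A => forall g, S (x g)).
Proof.
move=> hS; split=> [g|x y hx hy g|x y hx hy g|n x n0 hx g|x hx g].
- by rewrite ffunE; case: eqP => _; [apply: (csub1 hS) | apply: (csub0 hS)].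
- by rewrite grpalgB; apply: (csubB hS).
- by rewrite grpalgM; apply: (csub_sum hS) => h; apply: (csubM hS).
- by apply: (csub_pure hS n0); rewrite -grpalgMn.
- apply: (csub_lim hS) => n; have [y [hy xy]] := hx n; exists (y g); split=> //.
  by rewrite -grpalgB; have /pmult_grpalg := xy.
Qed.
End GroupAlgebraTopology.

Section MatrixTopology.
Variables (p : nat) (A : pzRingType) (D : nat).
Local Notation E := 'M[A]_D.

Lemma matrixMn (x : E) n i j : (x *+ n) i j = x i j *+ n.
Proof. by rewrite mulmxnE. Qed.

Lemma pmult_matrix n (x : E) : pmult p n x <-> forall i j, pmult p n (x i j).
Proof.
split=> [[y ->] i j|h]; first by exists (y i j); rewrite matrixMn.
have /choice[y yE] (ij : 'I_D * 'I_D) := h ij.1 ij.2.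
exists (\matrix_(i, j) y (i, j)); apply/matrixP => i j.
by rewrite matrixMn mxE -yE.
Qed.

Lemma matrix_complete : padically_complete p A -> padically_complete p E.
Proof.
move=> Rc u hu.
have /choice[l hl] (ij : 'I_D * 'I_D) :
    exists l, forall n, pmult p n (l - u n ij.1 ij.2).
  by apply: Rc => n; have /pmult_matrix/(_ ij.1 ij.2) := hu n; rewrite !mxE.
exists (\matrix_(i, j) l (i, j)) => n; apply/pmult_matrix => i j.
by rewrite !mxE; apply: (hl (i, j)).
Qed.

Lemma matrix_separated : padically_separated p A -> padically_separated p E.
Proof.
move=> Rs x hx; apply/matrixP => i j; rewrite mxE; apply: Rs => n.
by have /pmult_matrix := hx n.
Qed.

Lemma matrix_torsion_free : torsion_free A -> torsion_free E.
Proof.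
move=> Rt n x n0 xn; apply/matrixP => i j; rewrite mxE; apply: (Rt n) => //.
by rewrite -matrixMn xn mxE.
Qed.

Lemma matrix_div N s : (forall x : A, exists y, y *+ N = x *+ p ^ s) ->
  forall x : E, exists y, y *+ N = x *+ p ^ s.
Proof.
move=> Rd x; have /choice[y yE] (ij : 'I_D * 'I_D) := Rd (x ij.1 ij.2).
exists (\matrix_(i, j) y (i, j)); apply/matrixP => i j.
by rewrite !matrixMn mxE yE.
Qed.

Lemma matrix_closed_subring (S : A -> Prop) : closed_subring p S ->
  closed_subring p (fun x : E => forall i j, S (x i j)).
Proof.
move=> hS; split=> [i j|x y hx hy i j|x y hx hy i j|n x n0 hx i j|x hx i j].
- rewrite mxE; case: (i == j); first exact: (csub1 hS).
  exact: (csub0 hS).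
- by rewrite !mxE; apply: (csubB hS).
- by rewrite mxE; apply: (csub_sum hS) => l; apply: (csubM hS).
- by apply: (csub_pure hS n0); rewrite -matrixMn.
- apply: (csub_lim hS) => n; have [y [hy xy]] := hx n; exists (y i j); split=> //.
  by have /pmult_matrix/(_ i j) := xy; rewrite !mxE.
Qed.
End MatrixTopology.

(** * Bounding and counting invertible bimodules *)

Section FinitePicard.
Variables (p : nat) (R : comPzRingType) (gT : finGroupType) (s : nat).
Variables (b : grpalg R gT) (hb : central_idempotent b).
Hypotheses (R_complete : padically_complete p R) (R_sep : padically_separated p R).
Hypothesis R_tf : torsion_free R.
Hypothesis R_div : forall x : R, exists y, y *+ #|gT| = x *+ p ^ s.
Hypothesis R_finite : forall n, exists L : seq R, forall x,
  exists2 r, r \in L & pmult p n (x - r).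
Local Notation A := (grpalg R gT).
Local Notation B := (block hb).

(** Stands in for the finite quotient of R by p^n: equal codes imply congruence. *)
Lemma finite_code n : exists (T : finType) (c : R -> T),
  forall x y, c x = c y -> pmult p n (x - y).
Proof.
have [L hL] := R_finite n.
have /choice[r hr] x : exists r : seq_sub L, pmult p n (x - val r).
  by have [r rL xr] := hL x; exists (SeqSub rL).
exists (seq_sub L), r => x y rxy; apply: pmult_trans (hr x) _.
by rewrite rxy; apply/pmultBC/hr.
Qed.

Lemma pmult_block n (a c : B) :
  (forall g, pmult p n (corner_val a g - corner_val c g)) -> pmult p n (a - c).
Proof.
move=> h; have [y yE] : pmult p n (corner_val a - corner_val c).
  by apply/pmult_grpalg => g; rewrite grpalgB.
exists (corner_proj hb y); apply: (addIr c); rewrite subrK; apply: corner_inj.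
have valMn (z : B) k : corner_val (z *+ k) = corner_val z *+ k.
  elim: k => [|k IHk]; first by rewrite !mulr0n.
  by rewrite !mulrS -IHk corner_valD.
rewrite corner_valD valMn -[corner_val (corner_proj _ _)]/(y * b).
by rewrite -mulrnAl -yE mulrBl !corner_valE subrK.
Qed.

(** Nakayama's lemma by a Neumann series: generation modulo p reads (1 - pY) rho(1) = a Rm, and
    inverting 1 - pY turns the coefficients into forms. Their number is exactly K, which fixes the
    matrix size. *)
Lemma nakayama_dual_basis (M : bimod B B) K (r : 'I_K -> M) : fg_projective M ->
  (forall m, exists (a : 'I_K -> B) y, m = \sum_t a t *: r t + y *+ p) ->
  exists2 t, dual_basis (M := M) t & size t = K.
Proof.
move=> /fg_projective_represents[D /(_ D (leqnn D))[rho]].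
move=> [rM [Phi [[PD PI] PZ PG PS]]] gen.
have [m [hm mE]] := represents_generators rM PD PI PZ PG PS.
have /choice[ay hay] i : exists ay : ('I_K -> B) * M,
    m i = \sum_t ay.1 t *: r t + ay.2 *+ p.
  by have [a [y E]] := gen (m i); exists (a, y).
have PMn x n : Phi (x *+ n) = Phi x *+ n.
  elim: n => [|n IHn]; first by rewrite !mulr0n (additivef0 PD).
  by rewrite !mulrS PD IHn.
pose a : 'M[A]_(D, K) := \matrix_(i, t) corner_val ((ay i).1 t).
pose Rm : 'M[A]_(K, D) := \matrix_t Phi (r t).
pose Y : 'M[A]_D := \matrix_i Phi (ay i).2.
have rhoE : (1 - Y *+ p) * rho 1%g = a *m Rm.
  rewrite mulrBl mul1r; apply: (canLR (addrK _)); apply/row_matrixP => i.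
  rewrite -hm (hay i) PD (additivef_sum _ _ PD) linearD /=; congr (_ + _).
    rewrite row_mul mulmx_sum_row; apply: eq_bigr => t _.
    by rewrite PZ rowK !mxE.
  rewrite -[_ * _]/(_ *m _) row_mul PMn.
  have -> : row i (Y *+ p) = Phi (ay i).2 *+ p by rewrite raddfMn /= rowK.
  by rewrite -PMn (represents_unit PG).
have [l [_ l1 _ _]] := geometric_inverse
  (matrix_complete (D := D) (grpalg_complete (gT := gT) R_complete))
  (matrix_separated (D := D) (grpalg_separated (gT := gT) R_sep))
  (closed_subringT p _) I (ex_intro _ Y (congr1 (GRing.natmul Y) (esym (expn1 p)))).
have {}rhoE : rho 1%g = l *m a *m Rm.
  by rewrite -mulmxA -rhoE -[_ *m _]/(_ * _) mulrA l1 mul1r.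
pose psi t x : B^o := corner_proj hb ((Phi x *m (l *m a)) 0 t).
have psiD t : additivef (psi t).
  move=> x y; apply: corner_inj; rewrite corner_valD /= PD mulmxDl mxE mulrDl //.
have psiZ t (c : B) x : psi t (c *: x) = c *: psi t x.
  apply: corner_inj; rewrite -[RHS]/(corner_val (c * psi t x)) corner_valM /=.
  by rewrite PZ -scalemxAl mxE mulrA.
exists [seq (r t, lin_of (psiD t) (psiZ t)) | t <- enum 'I_K]; last first.
  by rewrite size_map size_enum_ord.
move=> x; rewrite big_map big_enum /=; apply: PI; rewrite (additivef_sum _ _ PD).
rewrite -[LHS](represents_unit PG) rhoE mulmxA mulmx_sum_row.
apply: eq_bigr => t _; rewrite PZ rowK /= -scalerA; congr (_ *: _).
by rewrite (represents_b PZ).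
Qed.

(** K is the number of subsets of the finite set of codes of B modulo p, so it does not depend on
    M. *)
Lemma morita_bounded_generators : exists K, forall M : bimod B B, morita M ->
  exists r : 'I_K -> M, forall m, exists (a : 'I_K -> B) y,
    m = \sum_t a t *: r t + y *+ p.
Proof.
have [T [c hc]] := finite_code 1.
pose C := {ffun gT -> T}; pose code (a : B) : C := [ffun g => c (corner_val a g)].
have codeE a a' : code a = code a' -> pmult p 1 (a - a').
  move=> aa'; apply: pmult_block => g; apply: hc.
  by have /ffunP/(_ g) := aa'; rewrite !ffunE.
exists #|{set C}| => M /morita_pairingP[N [f [g [th hp]]]].
have [thI thK thK'] := mp_thetaI hp.
(* K m encodes the left ideal g(N, m) modulo p, which determines m modulo p
   up to multiples. *)
pose K m : {set C} := [set t | `[< exists n, code (g n m) = t >]].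
have key m m' : K m = K m' -> exists (a : B) y, m = a *: m' + y *+ p.
  move=> KK; have /choice[n' hn'] n : exists n', pmult p 1 (g n m - g n' m').
    have : code (g n m) \in K m' by rewrite -KK inE; apply/asboolP; exists n.
    by rewrite inE => /asboolP[n' E]; exists n'; apply: codeE.
  have [z zE] := mp_f1 hp.
  have {}hn' n : exists y, g n m = g (n' n) m' + y *+ p.
    by have [y yE] := hn' n; exists y; rewrite -[p]expn1 -yE addrC subrK.
  have /choice[y hy] := hn'.
  have rD (x : M) : additivef (bm_ract x : B -> M) by move=> u v; apply: ractDr.
  have rMn (x : M) (u : B) k : bm_ract x (u *+ k) = bm_ract x u *+ k.
    elim: k => [|k IHk]; first by rewrite !mulr0n (additivef0 (rD x)).
    by rewrite !mulrS ractDr IHk.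
  have thMn x k : th (x *+ k) = th x *+ k.
    elim: k => [|k IHk]; first by rewrite !mulr0n (additivef0 (mp_thetaD hp)).
    by rewrite !mulrS (mp_thetaD hp) IHk.
  (* As 1 is the sum of the f(x, n), theta(m) is the sum of the x g(n, m). Replacing g(n, m) by
     g(n', m') + p y gives theta of a multiple of m', up to p. *)
  exists (\sum_(w <- z) f w.1 (n' w.2)), (thI (\sum_(w <- z) bm_ract w.1 (y w.2))).
  apply: (can_inj thK); rewrite (mp_thetaD hp) thMn thK'.
  rewrite -[m in LHS]scale1r -zE !scaler_suml !(additivef_sum _ _ (mp_thetaD hp)).
  rewrite -sumrMnl -big_split; apply: eq_bigr => w _.
  by rewrite /= !(mp_assoc hp) hy ractDr rMn.
have /choice[r hr] (i : 'I_#|{set C}|) : exists x : M,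
    forall m, K m = enum_val i -> K x = enum_val i.
  have [[x hx]|h] := pselect (exists x, K x = enum_val i); first by exists x.
  by exists 0 => m hm; case: h; exists m.
exists r => m; have [|a [y E]] := key m (r (enum_rank (K m))).
  by rewrite (hr _ m) ?enum_rankK.
exists (fun t => if t == enum_rank (K m) then a else 0), y.
rewrite (bigD1 (enum_rank (K m))) //= eqxx big1 ?addr0 // => t /negbTE ->.
by rewrite scale0r.
Qed.

(** The entries of rho modulo p^(s+1) determine the class, by [maranda]. *)
Theorem Pic_finite : grp_finite (Pic B).
Proof.
have [K hK] := morita_bounded_generators.
have [T [c hc]] := finite_code s.+1.
have /choice[rho hrho] (P : Pic B) : exists rho : gT -> 'M[A]_K,
    exists2 M, pic_mem P M & represents rho M.
  have [M [hM ->]] := pic_surj P; have [r hr] := hK M hM.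
  have [t ht tK] := nakayama_dual_basis (morita_fg_projective hM) hr.
  have [rho hrho] := dual_basis_represents ht.
  move: rho hrho; rewrite tK => rho hrho; exists rho, M => //.
  exact: bimod_iso_refl.
pose code (P : Pic B) : {ffun gT * 'I_K * 'I_K * gT -> T} :=
  [ffun z => c (rho P z.1.1.1 z.1.1.2 z.1.2 z.2)].
have code_inj P Q : code P = code Q -> P = Q.
  move=> PQ; have [M PM rM] := hrho P; have [N QN rN] := hrho Q.
  have MN : bimod_iso M N.
    apply: (rep_equiv_iso rM rN).
    apply: (@maranda p _ gT s
      (matrix_complete (D := K) (grpalg_complete (gT := gT) R_complete))
      (matrix_separated (D := K) (grpalg_separated (gT := gT) R_sep))
      (matrix_torsion_free (D := K) (grpalg_torsion_free (gT := gT) R_tf))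
      (matrix_div (D := K) (grpalg_div (gT := gT) R_div))) => //.
    - by case: rM.
    - by case: rN.
    move=> g; apply/pmult_matrix => i j; rewrite !mxE; apply/pmult_grpalg => h.
    rewrite grpalgB; apply: hc.
    by have /ffunP/(_ (g, i, j, h)) := PQ; rewrite !ffunE.
  have [M' [hM' EP]] := pic_surj P; have [N' [hN' EQ]] := pic_surj Q.
  rewrite EP EQ; apply/pic_of_eq; move: PM QN; rewrite EP EQ /= => PM QN.
  exact: bimod_iso_trans PM (bimod_iso_trans MN (bimod_iso_sym QN)).
pose T' := {ffun gT * 'I_K * 'I_K * gT -> T}.
have /choice[f hf] (i : 'I_#|T'|) : exists P : Pic B,
    forall Q, code Q = enum_val i -> P = Q.
  have [[P hP]|h] := pselect (exists P, code P = enum_val i).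
    by exists P => Q hQ; apply: code_inj; rewrite hP hQ.
  by exists gone => Q hQ; case: h; exists Q.
exists #|T'|, f => P; exists (enum_rank (code P)); apply: hf.
by rewrite enum_rankK.
Qed.
End FinitePicard.

(** * Descent to p-adic subrings *)

Lemma rep_equiv_refl (E : pzRingType) (gT : finGroupType) (rho : gT -> E) :
  is_rep rho -> rep_equiv (fun=> True) rho rho.
Proof.
move=> rM; exists (rho 1%g), (rho 1%g).
by split; rewrite ?rM ?mulg1 // => g; rewrite !rM mulg1 mul1g.
Qed.

(** * Transitivity of extension of scalars *)

Section Transitivity.
Variables (R0 R1 R2 : comPzRingType) (iota01 : {rmorphism R0 -> R1}).
Variables (iota12 : {rmorphism R1 -> R2}) (iota02 : {rmorphism R0 -> R2}).
Hypothesis iotaE : forall x, iota12 (iota01 x) = iota02 x.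
Variables (gT : finGroupType) (b0 : grpalg R0 gT) (b1 : grpalg R1 gT) (b2 : grpalg R2 gT).
Variables (hb0 : central_idempotent b0) (hb1 : central_idempotent b1).
Variable hb2 : central_idempotent b2.
Hypotheses (eqb01 : grpalg_map iota01 b0 = b1) (eqb12 : grpalg_map iota12 b1 = b2).
Hypothesis eqb02 : grpalg_map iota02 b0 = b2.

(** Both sides are represented by the same matrices, which avoids handling nested tensor
    products. *)
Lemma bimod_ext_trans (M : bimod (block hb0) (block hb0)) : fg_projective M ->
  bimod_iso (bimod_ext hb2 eqb12 (bimod_ext hb1 eqb01 M)) (bimod_ext hb2 eqb02 M).
Proof.
move=> /fg_projective_represents[D /(_ D (leqnn D))[rho hrho]].
have h1 := represents_ext hb2 eqb12 (represents_ext hb1 eqb01 hrho).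
have h2 := represents_ext hb2 eqb02 hrho.
apply: (rep_equiv_iso h1 h2).
have -> : (fun g => map_mx (grpalg_map iota12 (gT := gT))
      (map_mx (grpalg_map iota01 (gT := gT)) (rho g)))
    = (fun g => map_mx (grpalg_map iota02 (gT := gT)) (rho g)).
  by apply/funext => g; apply/matrixP => i j; rewrite !mxE; apply/ffunP => h;
    rewrite !ffunE iotaE.
by apply: rep_equiv_refl; case: h2.
Qed.

Lemma fg_projective_ext (M : bimod (block hb0) (block hb0)) : fg_projective M ->
  fg_projective (bimod_ext hb1 eqb01 M).
Proof.
move=> /fg_projective_represents[D /(_ D (leqnn D))[rho hrho]].
exact: represents_fg_projective (represents_ext hb1 eqb01 hrho).
Qed.
End Transitivity.

(** * Spreading isomorphisms and descending bimodules *)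

Section Blocks.
Variables (p : nat) (O : idomainType) (m : set O) (k : fieldType).
Variables (res : {rmorphism O -> k}) (gT : finGroupType) (b : grpalg O gT).
Hypothesis p_prime : prime p.
Hypotheses (O_local : local_ring m) (O_complete : complete_ring m).
Hypotheses (O_char0 : [pchar O] =i pred0) (O_residue : residue_field m res).
Hypothesis k_closure : algebraic_closure_Fp p k.
Variable pi : O.
Hypothesis piP : forall x, m x <-> exists y, x = y * pi.
Variable hb : central_idempotent b.

Let k_char : p%:R = 0 :> k := residue_char p_prime k_closure.
Let O_tf : torsion_free O := idomain_torsion_free O_char0.
Let pO_complete : padically_complete p O :=
  local_complete p_prime O_local O_complete O_char0 O_residue k_char piP.
Let O_sep : padically_separated p O :=
  local_separated p_prime O_local O_complete O_char0 O_residue k_char piP.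
Let O_nat n : pmult p 1 (n%:R : O) -> (p %| n)%N :=
  @pmult_natr_dvd p O m k res p_prime O_local O_residue k_closure n.

Local Notation A := (grpalg O gT).
Local Notation mapS S := (@grpalg_map (ps_sort S) O (@ps_val p O S) gT).

Section OverSubring.
Variable S : padic_subring p O.

Lemma ps_valMn (x : ps_sort S) n : ps_val (x *+ n) = ps_val x *+ n.
Proof. exact: (rmorphMn (@ps_val p O S)). Qed.

Lemma ps_valB (x y : ps_sort S) : ps_val (x - y) = ps_val x - ps_val y.
Proof. exact: (rmorphB (@ps_val p O S)). Qed.

Lemma ps_val_inj : injective (@ps_val p O S).
Proof. exact: val_inj. Qed.

Lemma ps_pmult n (x : ps_sort S) : pmult p n x <-> pmult p n (ps_val x).
Proof.
split=> [[y ->]|[y yE]]; first by exists (ps_val y); rewrite ps_valMn.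
have pn : (0 < p ^ n)%N by rewrite expn_gt0 prime_gt0.
have yS : y \in ps_pred S.
  by apply: (ps_divn p_prime O_tf O_nat (S := S) pn); rewrite -yE; apply: ps_valP.
by exists (PsElt yS); apply: ps_val_inj; rewrite ps_valMn.
Qed.

Lemma ps_complete : padically_complete p (ps_sort S).
Proof.
move=> u hu; have [|l hl] := pO_complete (u := fun n => ps_val (u n)).
  by move=> n; rewrite -ps_valB; apply/ps_pmult.
have lS : l \in ps_pred S.
  apply: (ps_closed p_prime pO_complete O_sep O_tf O_nat) => n.
  by exists (ps_val (u n)); split=> //; apply: ps_valP.
by exists (PsElt lS) => n; apply/ps_pmult; rewrite ps_valB.
Qed.

Lemma ps_separated : padically_separated p (ps_sort S).
Proof.
move=> x hx; apply: ps_val_inj; rewrite (rmorph0 (@ps_val p O S)); apply: O_sep => n.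
exact/ps_pmult.
Qed.

Lemma ps_torsion_free : torsion_free (ps_sort S).
Proof.
move=> n x n0 xn; apply: ps_val_inj; rewrite (rmorph0 (@ps_val p O S)).
by apply: (O_tf n0); rewrite -ps_valMn xn (rmorph0 (@ps_val p O S)).
Qed.

Lemma ps_div N s : (0 < N)%N -> (forall x : O, exists y, y *+ N = x *+ p ^ s) ->
  forall x : ps_sort S, exists y, y *+ N = x *+ p ^ s.
Proof.
move=> N0 h x; have [y yE] := h (ps_val x).
have yS : y \in ps_pred S.
  apply: (ps_divn p_prime O_tf O_nat (S := S) N0).
  by rewrite yE -ps_valMn; apply: ps_valP.
by exists (PsElt yS); apply: ps_val_inj; rewrite !ps_valMn.
Qed.

Lemma ps_finite n : exists L : seq (ps_sort S), forall x,
  exists2 r, r \in L & pmult p n (x - r).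
Proof.
have [L [LS LE]] := ps_finite_residues p_prime O_sep O_tf O_nat S n.
exists (pmap insub L) => x; have [r rL xr] := LE (ps_val x) (ps_valP x).
have rS := LS r rL; exists (PsElt rS); last by apply/ps_pmult; rewrite ps_valB.
by rewrite mem_pmap_sub.
Qed.

Lemma Pic_block_finite (c : grpalg (ps_sort S) gT) (hc : central_idempotent c) :
  grp_finite (Pic (block hc)).
Proof.
have gT0 : (0 < #|gT|)%N by rewrite -cardsT cardG_gt0.
have [s hs] := divide_natr p_prime O_local O_complete O_residue k_char piP gT0.
exact: (Pic_finite hc ps_complete ps_separated ps_torsion_free (ps_div gT0 hs) ps_finite).
Qed.

Definition over D (X : 'M[A]_D) : Prop := forall i j g, X i j g \in ps_pred S.

Lemma over_closed D : closed_subring p (@over D).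
Proof.
exact: (matrix_closed_subring D (grpalg_closed_subring gT
  (ps_closed_subring p_prime pO_complete O_sep O_tf O_nat S))).
Qed.

Lemma over_map D (X : 'M[grpalg (ps_sort S) gT]_D) : over (map_mx (mapS S) X).
Proof. by move=> i j g; rewrite mxE ffunE; apply: ps_valP. Qed.

Lemma over_lift D (X : 'M[A]_D) : over X -> exists Y, map_mx (mapS S) Y = X.
Proof.
move=> hX; exists (\matrix_(i, j) [ffun g => PsElt (hX i j g)]).
by apply/matrixP => i j; rewrite !mxE; apply/ffunP => g; rewrite !ffunE.
Qed.

Lemma over_map_inj D D' : injective (fun X : 'M_(D, D') => map_mx (mapS S) X).
Proof.
move=> X Y /matrixP XY; apply/matrixP => i j; apply: grpalg_map_ps_inj.
by have := XY i j; rewrite !mxE.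
Qed.

End OverSubring.

Lemma stage_above (i : stage p b) (s : seq O) n : exists (j : stage p b),
  stage_le i j /\ forall x, x \in s -> exists y, y \in ps_pred j /\ pmult p n (x - y).
Proof.
have /choice[y hy] (x : O) : exists y, padic_algebraic p y /\ pmult p n (x - y).
  exact: (padic_algebraic_dense p_prime O_local O_complete O_char0 O_residue k_closure piP).
have [x|T [iT sT]] := @padic_algebraic_family p O m k res p_prime O_local
    O_char0 O_residue k_closure i [seq y x | x <- s].
  by move=> /mapP[z _ ->]; case: (hy z).
have hT : defined_over b T by move=> g; apply/iT/(stage_def i).
exists (Stage hT); split=> // x xs; exists (y x); split; last by case: (hy x).
by apply: sT; apply: map_f.
Qed.

Lemma stage_upper (i j : stage p b) : exists l : stage p b, stage_le i l /\ stage_le j l.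
Proof.
have [T [iT jT]] := padic_subring_compositum p_prime O_tf O_nat i j.
have hT : defined_over b T by move=> g; apply/iT/(stage_def i).
by exists (Stage hT).
Qed.

(** An approximation of b over T lifts to an idempotent e over T. Being central, b commutes with e,
    and congruent commuting idempotents are equal: b itself has coefficients in T. *)
Lemma stage_exists : exists i : stage p b, True.
Proof.
have /choice[y hy] (x : O) : exists y, padic_algebraic p y /\ pmult p 1 (x - y).
  exact: (padic_algebraic_dense p_prime O_local O_complete O_char0 O_residue k_closure piP).
have [S0 _] := padic_subring_exists p_prime O_tf O_nat.
have [x|T [_ sT]] := @padic_algebraic_family p O m k res p_prime O_local
    O_char0 O_residue k_closure S0 [seq y (b g) | g <- enum gT].
  by move=> /mapP[z _ ->]; case: (hy (b z)).
pose c : A := [ffun g => y (b g)].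
have cT g : c g \in ps_pred T by rewrite ffunE; apply: sT; apply: map_f; rewrite mem_enum.
have bc : pmult p 1 (b - c).
  by apply/pmult_grpalg => g; rewrite grpalgB ffunE; case: (hy (b g)).
have hT := grpalg_closed_subring gT
  (ps_closed_subring p_prime pO_complete O_sep O_tf O_nat T).
have Ac := grpalg_complete (gT := gT) pO_complete.
have As := grpalg_separated (gT := gT) O_sep.
have [|e [eT ee ec]] := idempotent_lift Ac As hT (ltn0Sn 0) (x := c) cT.
  apply: (@pmult_trans _ _ _ (b * b)); last by rewrite (proj1 hb).
  apply: (@pmult_trans _ _ _ (b * c)).
    by rewrite -mulrBl; apply/pmultMr/pmultBC.
  by rewrite -mulrBr; apply/pmultMl/pmultBC.
have be : b = e.
  apply: (idempotent_pmult_eq As (proj1 hb) ee (proj2 hb e)).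
  by apply: pmult_trans bc _; apply: pmultBC.
have bT : defined_over b T by move=> g; rewrite be; apply: eT.
by exists (Stage bT).
Qed.

Definition stage_incl (i j : stage p b) (ij : stage_le i j)
    (M : bimod (stage_block hb i) (stage_block hb i)) :
    bimod (stage_block hb j) (stage_block hb j) :=
  bimod_ext (restrict_idem hb (stage_def j))
    (restrict_incl (stage_def i) (stage_def j) ij) M.

Lemma stage_ext_incl (i j : stage p b) (ij : stage_le i j)
    (M : bimod (stage_block hb i) (stage_block hb i)) : fg_projective M ->
  bimod_iso (stage_ext (stage_incl ij M)) (stage_ext M).
Proof. by apply: bimod_ext_trans. Qed.

Let gT_gt0 : (0 < #|gT|)%N. Proof. by rewrite -cardsT cardG_gt0. Qed.

Lemma matrix_approx (i : stage p b) D n (X Y : 'M[A]_D) : exists (j : stage p b),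
  stage_le i j /\ exists X' Y', [/\ over j X', over j Y', pmult p n (X' - X)
    & pmult p n (Y' - Y)].
Proof.
pose s := [seq X z.1.1 z.1.2 z.2 | z <- enum {: 'I_D * 'I_D * gT}]
  ++ [seq Y z.1.1 z.1.2 z.2 | z <- enum {: 'I_D * 'I_D * gT}].
have [j [ij hj]] := stage_above i s n; exists j; split=> //.
have approx (Z : 'M[A]_D) : (forall i j g, Z i j g \in s) ->
    exists2 Z', over j Z' & pmult p n (Z' - Z).
  move=> Zs; have /choice[z hz] (w : 'I_D * 'I_D * gT) : exists z, z \in ps_pred j
      /\ pmult p n (Z w.1.1 w.1.2 w.2 - z) by apply: hj.
  exists (\matrix_(a, c) [ffun g => z (a, c, g)]).
    by move=> a c g; rewrite mxE ffunE; case: (hz (a, c, g)).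
  apply/pmult_matrix => a c; apply/pmult_grpalg => g.
  by rewrite !mxE !ffunE; apply: pmultBC; case: (hz (a, c, g)).
have [a c g|X' hX' XX'] := approx X.
  by rewrite mem_cat; apply/orP; left; apply/mapP; exists (a, c, g); rewrite ?mem_enum.
have [a c g|Y' hY' YY'] := approx Y.
  by rewrite mem_cat; apply/orP; right; apply/mapP; exists (a, c, g); rewrite ?mem_enum.
by exists X', Y'.
Qed.

(** Serves twice: to recover the invertibility of descended bimodules, and to show that classes
    which agree over O already agree at a later stage. *)
Lemma iso_spread (i : stage p b) (M N : bimod (stage_block hb i) (stage_block hb i)) :
  fg_projective M -> fg_projective N ->
  bimod_iso (stage_ext M) (stage_ext N) ->
  exists (j : stage p b) (ij : stage_le i j),
    bimod_iso (stage_incl ij M) (stage_incl ij N).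
Proof.
move=> /fg_projective_represents[D1 hM] /fg_projective_represents[D2 hN] MN.
pose D := maxn D1 D2.
have [rho hrho] := hM D (leq_maxl _ _); have [sigma hsigma] := hN D (leq_maxr _ _).
have eM := represents_ext hb (restrictE (stage_def i)) hrho.
have eN := represents_ext hb (restrictE (stage_def i)) hsigma.
have [P [Q [_ _ PQ QP PE]]] := represents_rep_equiv eM eN MN.
have [s hs] := divide_natr p_prime O_local O_complete O_residue k_char piP gT_gt0.
have [j [ij [P' [Q' [hP' hQ' PP' QQ']]]]] := matrix_approx i s.+1 P Q.
have Ec := matrix_complete (D := D) (grpalg_complete (gT := gT) pO_complete).
have Es := matrix_separated (D := D) (grpalg_separated (gT := gT) O_sep).
have Et := matrix_torsion_free (D := D) (grpalg_torsion_free (gT := gT) O_tf).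
have Ed := matrix_div (D := D) (grpalg_div (gT := gT) hs).
have rM : is_rep (fun g => map_mx (mapS i) (rho g)) by case: eM.
have sM : is_rep (fun g => map_mx (mapS i) (sigma g)) by case: eN.
have over_ij (X : 'M[A]_D) : over i X -> over j X.
  by move=> hX a c g; apply/ij/hX.
have [P0 [Q0 [hP0 hQ0 PQ0 QP0 PE0]]] := rep_equiv_descend Ec Es Et Ed (over_closed j D)
  rM sM (fun g => over_ij _ (over_map (rho g))) (fun g => over_ij _ (over_map (sigma g)))
  hP' hQ' PQ QP PE PP' QQ'.
exists j, ij.
have fM := represents_ext (restrict_idem hb (stage_def j))
  (restrict_incl (stage_def i) (stage_def j) ij) hrho.
have fN := represents_ext (restrict_idem hb (stage_def j))
  (restrict_incl (stage_def i) (stage_def j) ij) hsigma.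
apply: (rep_equiv_iso fM fN).
have mapE (X : 'M[grpalg (ps_sort i) gT]_D) :
    map_mx (mapS j) (map_mx (grpalg_map (ps_incl ij) (gT := gT)) X) = map_mx (mapS i) X.
  by apply/matrixP => a c; rewrite !mxE; apply/ffunP => g; rewrite !ffunE.
have [P1 P1E] := over_lift hP0; have [Q1 Q1E] := over_lift hQ0.
have inj := @over_map_inj j D D.
have mapM (X Y : 'M[grpalg (ps_sort j) gT]_D) :
    map_mx (mapS j) (X * Y) = map_mx (mapS j) X * map_mx (mapS j) Y.
  by rewrite /GRing.mul /= map_mxM.
exists P1, Q1; split=> // [||g]; apply: inj; rewrite !mapM ?P1E ?Q1E ?mapE //.
Qed.

Lemma bimod_descend (M : bimod (block hb) (block hb)) : fg_projective M ->
  exists (i : stage p b) (M0 : bimod (stage_block hb i) (stage_block hb i)),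
    fg_projective M0 /\ bimod_iso (stage_ext M0) M.
Proof.
move=> /fg_projective_represents[D /(_ D (leqnn D))[rho hrho]].
have [rM [Phi [[PD PI] PZ PG PS]]] := hrho.
have [s hs] := divide_natr p_prime O_local O_complete O_residue k_char piP gT_gt0.
have [i0 _] := stage_exists.
have Ec := matrix_complete (D := D) (grpalg_complete (gT := gT) pO_complete).
have Es := matrix_separated (D := D) (grpalg_separated (gT := gT) O_sep).
have Et := matrix_torsion_free (D := D) (grpalg_torsion_free (gT := gT) O_tf).
have Ed := matrix_div (D := D) (grpalg_div (gT := gT) hs).
pose sq := [seq rho z.1.1.1 z.1.1.2 z.1.2 z.2 | z <- enum {: gT * 'I_D * 'I_D * gT}].
have [i [_ hi]] := stage_above i0 sq (2 * s).+1.
have /choice[w hw] (z : gT * 'I_D * 'I_D * gT) : exists w, w \in ps_pred i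
    /\ pmult p (2 * s).+1 (rho z.1.1.1 z.1.1.2 z.1.2 z.2 - w).
  by apply: hi; apply/mapP; exists z; rewrite ?mem_enum.
pose r g : 'M[A]_D := \matrix_(a, c) [ffun h => w (g, a, c, h)].
have rS g : over i (r g) by move=> a c h; rewrite mxE ffunE; case: (hw (g, a, c, h)).
have rr g : pmult p (2 * s).+1 (r g - rho g).
  apply/pmult_matrix => a c; apply/pmult_grpalg => h.
  by rewrite !mxE !ffunE; apply: pmultBC; case: (hw (g, a, c, h)).
have [rho0 [r0M r0S req]] := multiplicative_descend Ec Es Et Ed (over_closed i D) rM rS rr.
have [P [Q [_ _ PQ QP PE]]] := req.
have QE := intertwiner_inverse rM r0M PQ QP PE.
(* rho0 is rho transported along (P, Q), so the two identities by which b acts as the unit pass to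
   rho0. *)
have r0E g : rho0 g = Q * rho g * P by rewrite -mulrA PE mulrA QP rho1l.
have gscalMl (c : A) (X Y : 'M[A]_D) : (forall x, c * x = x * c) ->
    X * (c *: Y) = c *: (X * Y).
  move=> cC; apply/matrixP => a d; rewrite !mxE mulr_sumr; apply: eq_bigr => l _.
  by rewrite mxE !mulrA cC.
have scaleMl (c : A) (X Y : 'M[A]_D) : c *: X * Y = c *: (X * Y).
  by rewrite /GRing.mul /= scalemxAl.
have r0b : b *: rho0 1%g = rho0 1%g.
  rewrite r0E -scaleMl -gscalMl; last exact: (proj2 hb).
  by rewrite (represents_b_rho rM PD PI PZ PG PS).
have r0sum : \sum_g gscal gT (b g) *: rho0 g = rho0 1%g.
  rewrite [RHS]r0E -(represents_b_sum rM PD PI PZ PG PS) mulr_sumr mulr_suml.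
  apply: eq_bigr => g _; rewrite gscalMl; last exact: gscal_central.
  by rewrite scaleMl r0E.
have /choice[rho1 rho1E] g := over_lift (r0S g).
have inj := @over_map_inj i D D.
pose b0 := restrict (stage_def i).
have b0E g : ps_val (b0 g) = b g by rewrite ffunE.
have mapZ (c : grpalg (ps_sort i) gT) (X : 'M[grpalg (ps_sort i) gT]_D) :
    map_mx (mapS i) (c *: X) = mapS i c *: map_mx (mapS i) X.
  by apply/matrixP => a d; rewrite !mxE rmorphM.
have r1M : is_rep rho1.
  by move=> g h; apply: inj; rewrite /= /GRing.mul /= map_mxM !rho1E -r0M.
have r1b : b0 *: rho1 1%g = rho1 1%g.
  by apply: inj => /=; rewrite mapZ rho1E restrictE.
have r1sum : \sum_g gscal gT (b0 g) *: rho1 g = rho1 1%g.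
  apply: inj => /=; rewrite rho1E -r0sum raddf_sum; apply: eq_bigr => g _.
  rewrite /= mapZ rho1E grpalg_map_gscal; congr (gscal _ _ *: _); exact: b0E.
have hM0 := rep_bimod_represents (restrict_idem hb (stage_def i)) r1M r1b r1sum.
exists i, (rep_bimod (restrict_idem hb (stage_def i)) r1M r1b r1sum); split.
  exact: represents_fg_projective hM0.
have eM0 := represents_ext hb (restrictE (stage_def i)) hM0.
apply: (rep_equiv_iso eM0 hrho).
exists Q, P; split=> // [|g]; rewrite ?rho1E ?QE //.
Qed.

(** M and its inverse N descend as projective bimodules. M0 ⊗ N0 and the regular bimodule become
    isomorphic over O, hence over some j; the other order requires a further stage l, and the first
    isomorphism is extended to l. *)
Lemma morita_descend (M : bimod (block hb) (block hb)) : morita M ->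
  exists (i : stage p b) (M0 : bimod (stage_block hb i) (stage_block hb i)),
    morita M0 /\ bimod_iso M (stage_ext M0).
Proof.
move=> hM; have /moritaP[N [MN NM]] := hM.
have hN : morita N by apply/moritaP; exists M.
have [i1 [M1 [pM1 eM1]]] := bimod_descend (morita_fg_projective hM).
have [i2 [N2 [pN2 eN2]]] := bimod_descend (morita_fg_projective hN).
have [i [i1i i2i]] := stage_upper i1 i2.
pose M0 := stage_incl i1i M1; pose N0 := stage_incl i2i N2.
have pM0 : fg_projective M0 by apply: fg_projective_ext.
have pN0 : fg_projective N0 by apply: fg_projective_ext.
have eM0 : bimod_iso (stage_ext M0) M by apply: bimod_iso_trans (stage_ext_incl i1i pM1) eM1.
have eN0 : bimod_iso (stage_ext N0) N by apply: bimod_iso_trans (stage_ext_incl i2i pN2) eN2.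
have half (l : stage p b) (X Y : bimod (stage_block hb l) (stage_block hb l))
    (X' Y' : bimod (block hb) (block hb)) :
    fg_projective X -> fg_projective Y -> bimod_iso (stage_ext X) X' ->
    bimod_iso (stage_ext Y) Y' -> bimod_iso (bimod_tensor X' Y') (bimod_regular (block hb)) ->
    exists (j : stage p b) (lj : stage_le l j),
      bimod_iso (bimod_tensor (stage_incl lj X) (stage_incl lj Y))
        (bimod_regular (stage_block hb j)).
  move=> pX pY eX eY XY.
  have [|j [lj h]] := @iso_spread l (bimod_tensor X Y) (bimod_regular (stage_block hb l))
      (fg_projective_tensor pX pY) (fg_projective_regular _).
    apply: bimod_iso_trans (bimod_iso_sym (bimod_ext_tensor _ _ X Y)) _.
    apply: bimod_iso_trans (bimod_tensor_iso eX eY) _.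
    exact: bimod_iso_trans XY (bimod_iso_sym (bimod_ext_regular _ _ _)).
  exists j, lj; apply: bimod_iso_trans (bimod_ext_tensor _ _ X Y) _.
  exact: bimod_iso_trans h (bimod_ext_regular _ _ _).
have [j [ij MN1]] := half _ _ _ _ _ pM0 pN0 eM0 eN0 MN.
pose M3 := stage_incl ij M0; pose N3 := stage_incl ij N0.
have pM3 : fg_projective M3 by apply: fg_projective_ext.
have pN3 : fg_projective N3 by apply: fg_projective_ext.
have eM3 : bimod_iso (stage_ext M3) M by apply: bimod_iso_trans (stage_ext_incl ij pM0) eM0.
have eN3 : bimod_iso (stage_ext N3) N by apply: bimod_iso_trans (stage_ext_incl ij pN0) eN0.
have [l [jl NM1]] := half _ _ _ _ _ pN3 pM3 eN3 eM3 NM.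
exists l, (stage_incl jl M3); split.
  apply/moritaP; exists (stage_incl jl N3); split=> //.
  apply: bimod_iso_trans (bimod_ext_tensor _ _ _ _) _.
  exact: bimod_iso_trans (bimod_ext_iso _ _ MN1) (bimod_ext_regular _ _ _).
exact: bimod_iso_sym (bimod_iso_trans (stage_ext_incl jl pM3) eM3).
Qed.

End Blocks.

(** * The Picard group as a colimit *)

Section Groups.
Implicit Types H K : grp.

Lemma gmul_cancel H (x y : H) : gmul x y = x -> y = gone.
Proof.
by move=> E; rewrite -[y]gmul1 -(gmulV x) -gmulA E.
Qed.

Lemma gexpD H (x : H) a c : gexp x (a + c) = gmul (gexp x a) (gexp x c).
Proof.
elim: a => [|a IHa]; first by rewrite gmul1.
by rewrite /gexp addSn !iterS -/(gexp x (a + c)) IHa gmulA.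
Qed.

Lemma ghom1 H K (f : ghom H K) : f gone = gone.
Proof. by apply: (@gmul_cancel _ (f gone)); rewrite -ghomM gmul1. Qed.

Lemma ghom_exp H K (f : ghom H K) x n : f (gexp x n) = gexp (f x) n.
Proof.
elim: n => [|n IHn]; first exact: ghom1.
by rewrite /gexp !iterS ghomM -/(gexp x n) IHn.
Qed.

Lemma finite_order H (x : H) : grp_finite H -> exists n, (0 < n)%N /\ gexp x n = gone.
Proof.
case=> n [f fS]; have /choice[c hc] (a : 'I_n.+1) := fS (gexp x a).
have /injectivePn[a [d ad cad]] : ~~ injectiveb c.
  by apply/negP => /injectiveP/leq_card; rewrite !card_ord ltnn.
have E : gexp x a = gexp x d by rewrite -!hc cad.
wlog ltad : a d ad cad E / (a < d)%N.
  move=> wl; have [|da|/val_inj eqad] := ltngtP a d; first exact: wl.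
    by apply: (wl d a) => //; rewrite eq_sym.
  by rewrite eqad eqxx in ad.
exists (d - a)%N; split; first by rewrite subn_gt0.
by apply: (@gmul_cancel _ (gexp x a)); rewrite -gexpD subnKC // ltnW.
Qed.

(** Every element of L comes from a stage, and elements identified in L are identified later; so the
    induced map may be read off at any stage, and products are computed at a common upper bound. *)
Lemma directed_colimit (I : Type) (le : I -> I -> Prop) (X : I -> grp)
    (f : forall i j, le i j -> ghom (X i) (X j)) (L : grp) (g : forall i, ghom (X i) L) :
  (forall i j, exists l, le i l /\ le j l) ->
  (forall i j (ij : le i j) x, g j (f i j ij x) = g i x) ->
  (forall y, exists i x, g i x = y) ->
  (forall i x y, g i x = g i y -> exists j (ij : le i j), f i j ij x = f i j ij y) ->
  is_colimit f g.
Proof.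
move=> dir gf gS gI; split=> // H u uf.
have wd i j x y : g i x = g j y -> u i x = u j y.
  move=> E; have [l [il jl]] := dir i j.
  have [|r [lr E']] := gI l (f i l il x) (f j l jl y); first by rewrite !gf.
  by rewrite -(uf _ _ il) -(uf _ _ lr) E' uf uf.
have /choice[v hv] y : exists z, forall i x, g i x = y -> u i x = z.
  by have [i [x xy]] := gS y; exists (u i x) => j x' E; apply: wd; rewrite E.
have vM y z : v (gmul y z) = gmul (v y) (v z).
  have [i [x xy]] := gS y; have [j [w wz]] := gS z.
  have [l [il jl]] := dir i j.
  rewrite -(hv y l (f i l il x)) ?gf // -(hv z l (f j l jl w)) ?gf // -ghomM.
  by rewrite (hv (gmul y z)) // ghomM !gf xy wz.
exists (Ghom vM); split=> [i x|v' hv' y]; first exact/esym/hv.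
by have [i [x <-]] := gS y; rewrite hv' /=; apply: hv.
Qed.
End Groups.

Theorem theorem1p6 (p : nat) (O : idomainType) (m : set O) (k : fieldType)
    (res : {rmorphism O -> k}) (gT : finGroupType) (b : grpalg O gT)
    (p_prime : prime p)
    (O_pid : principal_ideal_ring O)
    (O_local : local_ring m)
    (O_complete : complete_ring m)
    (O_char0 : [pchar O] =i pred0)
    (O_residue : residue_field m res)
    (k_closure : algebraic_closure_Fp p k)
    (hb : central_idempotent b) :
  (forall M : bimod (block hb) (block hb), morita M ->
     exists (S : stage p b) (M0 : bimod (stage_block hb S) (stage_block hb S)),
       morita M0 /\ bimod_iso M (stage_ext M0)) /\
  [/\ forall S : stage p b, grp_finite (Pic (stage_block hb S)),
      is_colimit (@stage_map p O gT b hb) (@stage_colim_map p O gT b hb) &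
      forall x : Pic (block hb), exists n, (0 < n)%N /\ gexp x n = gone].
Proof.
have [pi piP] := maximal_generator O_pid O_local.
have desc (M : bimod (block hb) (block hb)) : morita M ->
    exists (S : stage p b) (M0 : bimod (stage_block hb S) (stage_block hb S)),
      morita M0 /\ bimod_iso M (stage_ext M0).
  exact: (morita_descend p_prime O_local O_complete O_char0 O_residue k_closure piP).
have fin (S : stage p b) : grp_finite (Pic (stage_block hb S)).
  exact: (Pic_block_finite p_prime O_local O_complete O_char0 O_residue k_closure piP).
have colimE (i : stage p b) (M : bimod (stage_block hb i) (stage_block hb i)) (hM : morita M) :
    stage_colim_map hb i (pic_of hM)
    = pic_of (morita_ext hb (restrictE (stage_def i)) hM).
  exact: pic_ext_funE.
have mapE (i j : stage p b) (ij : stage_le i j)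
    (M : bimod (stage_block hb i) (stage_block hb i)) (hM : morita M) :
    stage_map hb ij (pic_of hM) = pic_of (morita_ext (restrict_idem hb (stage_def j))
      (restrict_incl (stage_def i) (stage_def j) ij) hM).
  exact: pic_ext_funE.
have surj y : exists i x, @stage_colim_map p O gT b hb i x = y.
  have [M [hM ->]] := pic_surj y; have [i [M0 [hM0 MM0]]] := desc M hM.
  exists i, (pic_of hM0); rewrite colimE; apply/pic_of_eq.
  exact: bimod_iso_sym.
split=> //; split=> // [|x].
  apply: directed_colimit => [i j|i j ij x||i x y].
  - exact: (stage_upper p_prime O_local O_char0 O_residue k_closure).
  - have [M [hM ->]] := pic_surj x; rewrite mapE !colimE; apply/pic_of_eq.
    exact: (stage_ext_incl ij (morita_fg_projective hM)).
  - exact: surj.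
  have [M [hM ->]] := pic_surj x; have [N [hN ->]] := pic_surj y.
  rewrite !colimE => /pic_of_eq MN.
  have [j [ij h]] := iso_spread p_prime O_local O_complete O_char0 O_residue k_closure piP
    (morita_fg_projective hM) (morita_fg_projective hN) MN.
  by exists j, ij; rewrite !mapE; apply/pic_of_eq.
have [i [y <-]] := surj x; have [n [n0 yn]] := finite_order y (fin i).
by exists n; split=> //; rewrite -ghom_exp yn ghom1.
Qed.
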